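(* Let $M$ be a hyperbolic one-holed torus with boundary geodesic $\delta$ of length $l_\delta$. Then $$\sum_{\gamma} \arctan\left(\frac{\cosh(l_\delta/4)}{\sinh(l_\gamma/2)}\right) = \frac{3\pi}{2},$$ where the sum extends over all simple closed geodesics $\gamma\neq\delta$ on $M$ (each unoriented geodesic counted once) and $l_\gamma$ denotes the length of $\gamma$.
   Context: A hyperbolic one-holed torus is a torus with one hole equipped with a hyperbolic structure. Its fundamental group is free on two generators represented by loops $\gamma_1,\gamma_2$ meeting in a single point, whose commutator is a loop around the hole. The structure is uniformized by a representation $\rho:\pi_1(M)\to \mathrm{SL}_2(\mathbf{R})$ for which $\rho([\gamma_1,\gamma_2])$ is hyperbolic of translation length $l_\delta>0$. The geodesic $\delta$ is the boundary geodesic, homotopic to the loop around the hole. *)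

(* Defs.v *)
From mathcomp Require Import all_boot all_order all_algebra.
From mathcomp Require Import all_classical all_reals all_analysis.
From mathcomp Require Import complex.

Set Implicit Arguments.
Unset Strict Implicit.
Unset Printing Implicit Defensive.

Import Order.TTheory GRing.Theory Num.Theory.
Import numFieldNormedType.Exports.

Local Open Scope classical_set_scope.
Local Open Scope ring_scope.
Local Open Scope complex_scope.

Section HyperbolicPlane.
Variable R : realType.

Definition cosh (x : R) : R := (expR x + expR (- x)) / 2.
Definition sinh (x : R) : R := (expR x - expR (- x)) / 2.
Definition arcosh (x : R) : R := ln (x + Num.sqrt (x ^+ 2 - 1)).

(* The hyperbolic plane is the upper half-plane, of curvature -1. *)
Definition upper_half_plane : set R[i] := [set z | 0 < complex.Im z].

Definition hdist (z w : R[i]) : R :=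
  arcosh (1 + (complex.Re (z - w) ^+ 2 + complex.Im (z - w) ^+ 2) /
              (2 * complex.Im z * complex.Im w)).

Definition mobius (g : 'M[R]_2) (z : R[i]) : R[i] :=
  ((g 0 0)%:C * z + (g 0 1)%:C) / ((g 1 0)%:C * z + (g 1 1)%:C).

(* Complete geodesics with unit-speed parametrization. *)
Definition geodesic_line (s : R -> R[i]) : Prop :=
  (forall t, upper_half_plane (s t)) /\
  (forall t u, hdist (s t) (s u) = `|t - u|).

(* g is hyperbolic, with axis s (oriented by g) and translation length l. *)
Definition hyperbolic_along (g : 'M[R]_2) (s : R -> R[i]) (l : R) : Prop :=
  [/\ 0 < l, geodesic_line s & forall t, mobius g (s t) = s (t + l)].

End HyperbolicPlane.

Section FreeGroup.
Variable R : realType.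

(* Words in the generators of the free group of rank two: the first component
   of a letter selects the generator (true: the first, false: the second), the
   second one its exponent (true: 1, false: -1). *)
Definition word := seq (bool * bool).

Definition reduced (w : word) : bool :=
  sorted (fun x y => y != (x.1, ~~ x.2)) w.

Definition eval_letter (A B : 'M[R]_2) (x : bool * bool) : 'M[R]_2 :=
  let g := if x.1 then A else B in if x.2 then g else g^-1.

Definition eval_word (A B : 'M[R]_2) (w : word) : 'M[R]_2 :=
  \prod_(x <- w) eval_letter A B x.

(* The subgroup generated by A and B. *)
Definition generated2 (A B : 'M[R]_2) : set 'M[R]_2 := range (eval_word A B).

End FreeGroup.

Section QuotientSurface.
Variables (R : realType) (G : set 'M[R]_2).

(* Points of the quotient of the hyperbolic plane by G are orbits. *)
Definition proj (z : R[i]) : set R[i] := [set mobius g z | g in G].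

Definition shadow (s : R -> R[i]) : set (set R[i]) := range (proj \o s).

(* c is the point set of a simple closed geodesic of length l: the projection
   of a unit-speed geodesic whose image in the quotient closes up after time l
   and is injective on the circle R/lZ.  Working with point sets forgets both
   the orientation and the starting point. *)
Definition simple_closed_geodesic_of_length (c : set (set R[i])) (l : R) :
    Prop :=
  0 < l /\
  exists s : R -> R[i],
    [/\ geodesic_line s,
        forall t u, proj (s t) = proj (s u) <->
                    exists k : int, u = t + k%:~R * l
      & c = shadow s].

Definition simple_closed_geodesic (c : set (set R[i])) : Prop :=
  exists l, simple_closed_geodesic_of_length c l.

(* The point set c determines l; the default 0 is used only when c is not a
   simple closed geodesic. *)
Definition geodesic_length (c : set (set R[i])) : R :=
  xget 0 [set l | simple_closed_geodesic_of_length c l].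

(* The torus is the product of two unit circles, with one point removed. *)
Definition punctured_torus : set ((R * R) * (R * R)) :=
  [set p | [/\ p.1.1 ^+ 2 + p.1.2 ^+ 2 = 1, p.2.1 ^+ 2 + p.2.2 ^+ 2 = 1
             & p <> ((1, 0), (1, 0))]].

(* The quotient is homeomorphic to the punctured torus: a continuous surjection
   f, open onto its image, whose fibres are exactly the G-orbits.  The point
   x + i y is written (x, y), as R[i] carries no topology in the library. *)
Definition quotient_is_punctured_torus : Prop :=
  exists f : R * R -> (R * R) * (R * R),
    let U : set (R * R) := [set p | 0 < p.2] in
    [/\ {within U, continuous f},
        f @` U = punctured_torus,
        (forall V, open V -> V `<=` U ->
           exists2 W, open W & f @` V = W `&` punctured_torus)
      & (forall p q, U p -> U q ->
           (f p = f q <-> proj (p.1 +i* p.2) = proj (q.1 +i* q.2)))].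

End QuotientSurface.

(* A hyperbolic one-holed torus, uniformized by rho : <gamma1, gamma2> -> SL2(R)
   with rho gamma_i = rho_i.  The surface is represented by its complete
   extension, the quotient of the hyperbolic plane by the image of rho; the
   compact surface with geodesic boundary delta is the convex core of the
   latter, and both have the same closed geodesics. *)
Record one_holed_torus (R : realType) := OneHoledTorus {
  rho1 : 'M[R]_2;
  rho2 : 'M[R]_2;
  det_rho1 : \det rho1 = 1;
  det_rho2 : \det rho2 = 1;

  (* The free group on the two generators acts freely and properly
     discontinuously: each z is moved by a distance bounded below, uniformly
     over all nontrivial elements.  In particular rho is faithful. *)
  covering_action : forall z, upper_half_plane z ->
    exists2 r : R, 0 < r & forall w : word, reduced w -> w != [::] ->
      r <= hdist z (mobius (eval_word rho1 rho2 w) z);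

  topological_type : quotient_is_punctured_torus (generated2 rho1 rho2);

  (* gamma1 and gamma2, realized by geodesics based at their unique common
     point. *)
  axis1 : R -> R[i];
  axis2 : R -> R[i];
  len1 : R;
  len2 : R;
  axis1P : hyperbolic_along rho1 axis1 len1;
  axis2P : hyperbolic_along rho2 axis2 len2;
  base_point : axis1 0 = axis2 0;
  meet_once :
    shadow (generated2 rho1 rho2) axis1 `&` shadow (generated2 rho1 rho2) axis2
    = [set proj (generated2 rho1 rho2) (axis1 0)];

  (* The boundary geodesic and its length, from the commutator of gamma1 and
     gamma2; hyperbolicity rules out a cusp. *)
  boundary_axis : R -> R[i];
  boundary_length : R;
  boundary_axisP :
    hyperbolic_along (rho1 * rho2 * rho1^-1 * rho2^-1)
                     boundary_axis boundary_length
}.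

Definition deck_group (R : realType) (M : one_holed_torus R) : set 'M[R]_2 :=
  generated2 (rho1 M) (rho2 M).

Definition boundary_geodesic (R : realType) (M : one_holed_torus R) :
    set (set R[i]) :=
  shadow (deck_group M) (boundary_axis M).

(* Main.v *)
Require Import Defs.
From mathcomp Require Import all_boot all_order all_algebra.
From mathcomp Require Import all_classical all_reals all_analysis.
From mathcomp Require Import complex ring lra zify.

(** For a simple closed geodesic of length l write x = 2 cosh (l / 2), the trace
of the corresponding element of the group, and put D = 2 cosh (l_delta / 4).
The axes of the two generators cross, so that their commutator has trace at
most 2 ([meeting_axes]); being hyperbolic of length l_delta it has trace
- 2 cosh (l_delta / 2) = 2 - D ^ 2, and the terms of the series are the numbers
gap x = atan (D / sqrt (x ^ 2 - 4)).

The series is a sum over a tree.  From a basis (X, Y) of the free group one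
passes to (X, X Y) and (X Y, Y), and so on: these bases form a binary tree,
and those that start from (X, Y^-1) another one.  Think of the two trees as
the two halves of the planar trivalent tree, cut at an edge between the
regions X and Y; each product formed on the way is a new region.  Two facts
prove the theorem: the regions are in bijection with the simple closed
geodesics other than delta ([geodesic_regions]), and for a suitable basis the
gaps of the traces of the regions add up to 3 pi / 2 ([region_sum]).

The sum.  The traces x, y, z of X, Y, X Y satisfy the equation
x ^ 2 + y ^ 2 + z ^ 2 - x y z = 4 - D ^ 2 of Markoff type, thanks to which three
arctangents attached to the corners of a vertex of the tree add up to pi / 2
([vertex_angles]).  Hence an explicit function rest of a directed edge
splits as twice the gap of the region ahead plus the rests of the two following
edges ([rest_split]), while the rests of the two directions of an edge add up
to 3 pi minus twice the gaps of the regions beside it ([rest_root]).  So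
the partial sums up to depth n miss 3 pi / 2 by half the sum of the rests at
depth n.  That sum tends to 0: all edges can be assumed directed away
from the root ([reduced_basis_exists]), and then the rests at one depth are
bounded by a constant times the gaps at the depth before ([tail_le]), which
tend to 0 because the sum of all gaps is bounded ([tail_small]).

The enumeration.  Since the commutator has trace less than -2, one of its
eigenvectors and three translates of it are the vertices of an ideal
quadrilateral on which the letters X, Y and their inverses play ping-pong
([config_exists]); in particular, the axis of a cyclically reduced word runs
from the arc of its first letter to that of the inverse of its last letter
([ends_of_cyc_reduced]).  A closed geodesic is simple when its axis is crossed
by none of its translates, that is, when no translate of its pair of ends is
linked with the pair itself.  Axes of elements of bases are simple
([simple_letter]).  Conversely, the axis of a simple geodesic cannot cut off
all four corners of the quadrilateral: the innermost arcs would be permuted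
cyclically by the letters and the commutator would fix an end of the axis
([four_corners_fix]), which by discreteness would be that of a boundary geodesic
([simple_axis_frame]).  Hence the word is, up to inversion, positive in X and Y
or in X and Y^-1 ([constant_sign]).  It does not contain both X X and Y Y cyclically, as it would
then cross itself ([not_both_straight]); so it is a shorter word in (X, X Y) or
in (X Y, Y), and by induction the geodesic belongs to a region ([classify]).
Different regions have different geodesics because their homology classes
are pairwise distinct up to sign, by the Stern-Brocot enumeration of slopes
([region_conj_inj]); and delta, of class 0, belongs to none of them.

All of this speaks of axes of group elements and their ends, that is, of 2 x 2
matrices and vectors.  The translation from geodesics of the quotient rests on
the fact that a unit-speed geodesic is the image of the vertical one by a
matrix of determinant 1 ([geodesic_frame]), and on a countability argument
that yields a single group element closing it up
([simple_closed_geodesicP]). *)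

Set Implicit Arguments.
Unset Strict Implicit.
Unset Printing Implicit Defensive.
Import Order.TTheory GRing.Theory Num.Theory.
Local Open Scope ring_scope.

(** * Unimodular 2 x 2 matrices and the cyclic order of the projective line *)

Section Plane.
Variable R : realFieldType.
Implicit Types (g h : 'M[R]_2) (u v w : 'cV[R]_2).

Lemma mx2E g h i j : (g * h) i j = g i 0 * h 0 j + g i 1 * h 1 j.
Proof. by rewrite mxE !big_ord_recl big_ord0 addr0 (_ : lift _ _ = 1) //; exact/val_inj. Qed.

Lemma mxv2E g u i : (g *m u) i 0 = g i 0 * u 0 0 + g i 1 * u 1 0.
Proof. by rewrite mxE !big_ord_recl big_ord0 addr0 (_ : lift _ _ = 1) //; exact/val_inj. Qed.

Lemma ord2P (P : 'I_2 -> Prop) : P 0 -> P 1 -> forall i, P i.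
Proof.
move=> P0 P1; case=> [[|[|//]] lt_i].
  by rewrite (_ : Ordinal _ = 0) //; apply/val_inj.
by rewrite (_ : Ordinal _ = 1) //; apply/val_inj.
Qed.

Lemma mx2P g h : g 0 0 = h 0 0 -> g 0 1 = h 0 1 -> g 1 0 = h 1 0 ->
  g 1 1 = h 1 1 -> g = h.
Proof. by move=> *; apply/matrixP; apply: ord2P; apply: ord2P. Qed.

Lemma cv2P u v : u 0 0 = v 0 0 -> u 1 0 = v 1 0 -> u = v.
Proof. by move=> *; apply/matrixP => i j; rewrite (ord1 j); move: i; apply: ord2P. Qed.

Definition mx2 (a b c d : R) : 'M[R]_2 :=
  \matrix_(i, j) if i == 0 then (if j == 0 then a else b)
                 else (if j == 0 then c else d).

Lemma mx2_00 a b c d : mx2 a b c d 0 0 = a. Proof. by rewrite mxE. Qed.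
Lemma mx2_01 a b c d : mx2 a b c d 0 1 = b. Proof. by rewrite mxE. Qed.
Lemma mx2_10 a b c d : mx2 a b c d 1 0 = c. Proof. by rewrite mxE. Qed.
Lemma mx2_11 a b c d : mx2 a b c d 1 1 = d. Proof. by rewrite mxE. Qed.
Definition mx2_entries := (mx2_00, mx2_01, mx2_10, mx2_11).

Definition cv2 (a b : R) : 'cV[R]_2 := \col_i if i == 0 then a else b.
Lemma cv2_0 a b : cv2 a b 0 0 = a. Proof. by rewrite mxE. Qed.
Lemma cv2_1 a b : cv2 a b 1 0 = b. Proof. by rewrite mxE. Qed.

Lemma det2 g : \det g = g 0 0 * g 1 1 - g 0 1 * g 1 0.
Proof.
rewrite (expand_det_row _ 0) !big_ord_recl big_ord0 addr0 /cofactor !det_mx11 !mxE /=.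
rewrite expr0 mul1r expr1 mulN1r mulrN.
by congr (g _ _ * g _ _ - g _ _ * g _ _); exact/val_inj.
Qed.

Lemma tr2 g : \tr g = g 0 0 + g 1 1.
Proof. by rewrite /mxtrace !big_ord_recl big_ord0 addr0 (_ : lift _ _ = 1) //; exact/val_inj. Qed.

Lemma mx2_1 : (1 : 'M[R]_2) = mx2 1 0 0 1.
Proof. by apply: mx2P; rewrite !mxE. Qed.

Lemma det1_unit g : \det g = 1 -> g \is a GRing.unit.
Proof. by move=> dg; rewrite -[_ \is a _]/(g \in unitmx) unitmxE dg unitr1. Qed.

Lemma inv2 g : \det g = 1 -> g^-1 = mx2 (g 1 1) (- g 0 1) (- g 1 0) (g 0 0).
Proof.
move=> dg; apply: (mulrI (det1_unit dg)); rewrite divrr ?det1_unit // mx2_1.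
by rewrite det2 in dg; apply: mx2P; rewrite !mx2E !mx2_entries; first [ring | rewrite -dg; ring].
Qed.

Lemma det_inv2 g : \det g = 1 -> \det g^-1 = 1.
Proof. by move=> dg; rewrite inv2 // det2 !mx2_entries -dg det2; ring. Qed.

Lemma det_mul2 g h : \det g = 1 -> \det h = 1 -> \det (g * h) = 1.
Proof. by move=> dg dh; rewrite det_mulmx dg dh mulr1. Qed.

Lemma tr_mulC g h : \tr (g * h) = \tr (h * g).
Proof. exact: mxtrace_mulC. Qed.

Lemma tr_inv g : \det g = 1 -> \tr g^-1 = \tr g.
Proof. by move=> dg; rewrite inv2 // !tr2 !mx2_entries addrC. Qed.

Lemma tr_conj g h : \det g = 1 -> \tr (g * h * g^-1) = \tr h.
Proof. by move=> dg; rewrite tr_mulC mulrA mulVr ?det1_unit // mul1r. Qed.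

(** The Cayley-Hamilton identity h + h^-1 = tr h, multiplied by g. *)
Lemma tr_mulV g h : \det h = 1 -> \tr (g * h^-1) = \tr g * \tr h - \tr (g * h).
Proof. by move=> dh; rewrite inv2 // !tr2 !mx2E !mx2_entries; ring. Qed.

Lemma tr_comm g h : \det g = 1 -> \det h = 1 ->
  \tr (g * h * g^-1 * h^-1) =
  \tr g ^+ 2 + \tr h ^+ 2 + \tr (g * h) ^+ 2 - \tr g * \tr h * \tr (g * h) - 2.
Proof.
move=> dg dh; rewrite !inv2 // !tr2 !mx2E !mx2_entries.
transitivity ((g 0 0 + g 1 1) ^+ 2 * \det h + (h 0 0 + h 1 1) ^+ 2 * \det g +
  (g 0 0 * h 0 0 + g 0 1 * h 1 0 + (g 1 0 * h 0 1 + g 1 1 * h 1 1)) ^+ 2 -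
  (g 0 0 + g 1 1) * (h 0 0 + h 1 1) *
  (g 0 0 * h 0 0 + g 0 1 * h 1 0 + (g 1 0 * h 0 1 + g 1 1 * h 1 1))
  - 2 * \det g * \det h); first by rewrite !det2; ring.
by rewrite dg dh !mulr1.
Qed.

(** The determinant of the pair (u, v), an invariant of SL2. *)
Definition br u v : R := u 0 0 * v 1 0 - u 1 0 * v 0 0.

Lemma brC u v : br v u = - br u v. Proof. by rewrite /br; ring. Qed.
Lemma br0 u : br u u = 0. Proof. by rewrite /br; ring. Qed.
Lemma brZl a u v : br (a *: u) v = a * br u v.
Proof. by rewrite /br !mxE; ring. Qed.
Lemma brZr a u v : br u (a *: v) = a * br u v.
Proof. by rewrite /br !mxE; ring. Qed.
Lemma brDl u v w : br (u + v) w = br u w + br v w.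
Proof. by rewrite /br !mxE; ring. Qed.
Lemma brDr u v w : br w (u + v) = br w u + br w v.
Proof. by rewrite /br !mxE; ring. Qed.
Lemma br_mul g u v : \det g = 1 -> br (g *m u) (g *m v) = br u v.
Proof.
move=> dg; rewrite -[RHS]mul1r -dg det2 /br !mxv2E; ring.
Qed.

Lemma plucker a b c d : br a b * br c d - br a c * br b d + br a d * br b c = 0.
Proof. by rewrite /br; ring. Qed.

Lemma br_decomp u v w : br u v *: w = br w v *: u + br u w *: v.
Proof. by apply: cv2P; rewrite !mxE /br; ring. Qed.

Lemma br_eq0P u v : u != 0 -> br u v = 0 -> exists a, v = a *: u.
Proof.
move=> u0 uv0; have [u00|u00] := eqVneq (u 0 0) 0.
  have u10 : u 1 0 != 0.
    by apply: contra u0 => /eqP u10; apply/eqP/cv2P; rewrite ?mxE.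
  exists (v 1 0 / u 1 0); apply: cv2P; rewrite !mxE ?divfK //.
  by move/eqP: uv0; rewrite /br u00 mul0r sub0r oppr_eq0 mulf_eq0 (negPf u10) => /eqP ->; rewrite mulr0.
exists (v 0 0 / u 0 0); apply: cv2P; rewrite !mxE ?divfK //.
apply: (mulfI u00); move/subr0_eq: uv0 => ->; by field.
Qed.

Lemma mulmx2_neq0 g u : \det g = 1 -> u != 0 -> g *m u != 0.
Proof.
move=> dg; apply: contra => /eqP gu0.
by rewrite -[u]mul1mx -[1%:M](mulVr (det1_unit dg)) -mulmxE -mulmxA gu0 mulmx0.
Qed.

Lemma mulmxKV2 g u : \det g = 1 -> g *m (g^-1 *m u) = u.
Proof. by move=> dg; rewrite mulmxA mulmxE divrr ?det1_unit // mul1mx. Qed.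
Lemma mulmxVK2 g u : \det g = 1 -> g^-1 *m (g *m u) = u.
Proof. by move=> dg; rewrite mulmxA mulmxE mulVr ?det1_unit // mul1mx. Qed.

Lemma eigen2 g a : \det g = 1 -> a ^+ 2 - \tr g * a + 1 = 0 ->
  exists2 u : 'cV[R]_2, u != 0 & g *m u = a *: u.
Proof.
move=> dg ea; rewrite det2 in dg; rewrite tr2 in ea.
have nz u : (u 0 0 != 0) || (u 1 0 != 0) -> u != 0.
  by move=> h; apply: contraTneq h => ->; rewrite !mxE eqxx.
have [b0|b0] := eqVneq (g 0 1) 0; last first.
  exists (cv2 (g 0 1) (a - g 0 0)); first by rewrite nz // cv2_0 b0.
  apply: cv2P; rewrite mxv2E !mxE /=; first by ring.
  by apply/eqP; rewrite -subr_eq0; apply/eqP; move: dg ea; nra.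
have [c0|c0] := eqVneq (g 1 0) 0; last first.
  exists (cv2 (a - g 1 1) (g 1 0)); first by rewrite nz // cv2_1 c0 orbT.
  apply: cv2P; rewrite mxv2E !mxE /=; last by ring.
  by apply/eqP; rewrite -subr_eq0; apply/eqP; move: dg ea; nra.
have : (a - g 0 0) * (a - g 1 1) == 0.
  by apply/eqP; move: dg ea; rewrite b0 c0; nra.
rewrite mulf_eq0 !subr_eq0 => /orP[] /eqP ->.
  exists (cv2 1 0); first by rewrite nz // cv2_0 oner_eq0.
  by apply: cv2P; rewrite mxv2E !mxE /= ?b0 ?c0; ring.
exists (cv2 0 1); first by rewrite nz // cv2_1 oner_eq0 orbT.
by apply: cv2P; rewrite mxv2E !mxE /= ?b0 ?c0; ring.
Qed.

Variable e : R.
(** Nonzero vectors stand for points of the projective line, the circle at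
infinity. The sign of the triple product does not depend on the vectors chosen
and gives the cyclic order; the factor e leaves the orientation of the circle
open, so that it can be adapted to a configuration. *)
Definition cyc u v w := 0 < e * (br u v * br v w * br w u).
Definition ccyc u v w := 0 <= e * (br u v * br v w * br w u).

Lemma cyc_rot u v w : cyc u v w = cyc v w u.
Proof. by rewrite /cyc; congr (_ < _ * _); ring. Qed.

Lemma cyc_mul g u v w : \det g = 1 -> cyc (g *m u) (g *m v) (g *m w) = cyc u v w.
Proof. by move=> dg; rewrite /cyc !br_mul. Qed.

Lemma cycZ a b c u v w : a != 0 -> b != 0 -> c != 0 ->
  cyc (a *: u) (b *: v) (c *: w) = cyc u v w.
Proof.
move=> a0 b0 c0; rewrite /cyc !brZl !brZr.
rewrite (_ : e * _ = (a * b * c) ^+ 2 * (e * (br u v * br v w * br w u))); last by ring.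
by rewrite pmulr_rgt0 // exprn_even_gt0 //= !mulf_neq0.
Qed.

Lemma cycW u v w : cyc u v w -> ccyc u v w. Proof. exact: ltW. Qed.

Lemma cyc_asym u v w : cyc u v w -> ~~ ccyc u w v.
Proof. by rewrite /cyc /ccyc (brC v u) (brC w v) (brC u w) -ltNge => h; nra. Qed.

Lemma cyc_nz u v w : cyc u v w -> [/\ br u v != 0, br v w != 0 & br w u != 0].
Proof.
move=> h; split; apply: contraTneq h => E; rewrite /cyc E ?mul0r ?mulr0 ?mul0r ?mulr0 ltxx //.
Qed.

Lemma cyc_e0 u v w : cyc u v w -> e != 0.
Proof. by rewrite /cyc; apply: contraTneq => ->; rewrite mul0r ltxx. Qed.

(** With o as the point at infinity the cyclic order becomes a linear order on
the rest of the circle, of which this is the totality; transitivity comes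
next. *)
Lemma cyc_total o u v : e != 0 -> br o u != 0 -> br o v != 0 -> br u v != 0 ->
  cyc o u v || cyc o v u.
Proof.
move=> e0 ou ov uv; rewrite /cyc.
have -> : e * (br o v * br v u * br u o) = - (e * (br o u * br u v * br v o)).
  by rewrite (brC u v) (brC o u) (brC o v); ring.
rewrite oppr_gt0 -neq_lt eq_sym !mulf_neq0 //.
by rewrite (brC o v) oppr_eq0.
Qed.

(** The Plucker relation, multiplied so that each term has a definite sign. *)
Lemma cyc_trans_identity o u v w :
  e * (br o u * br u w * br w o) * br v o ^+ 2 =
   br o u ^+ 2 * (e * (br o v * br v w * br w o)) +
   br w o ^+ 2 * (e * (br o u * br u v * br v o)).
Proof.
have P := plucker o u v w.
apply/eqP; rewrite -subr_eq0 -[X in _ == X](mulr0 (- e * br o u * br w o * br o v)) -P.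
by apply/eqP; rewrite (brC o v) (brC o w); ring.
Qed.

Lemma cyc_trans o u v w : cyc o u v -> cyc o v w -> cyc o u w.
Proof.
move=> h1 h2; have [_ _ vo] := cyc_nz h1; rewrite /cyc.
have vo2 : 0 < br v o ^+ 2 by rewrite exprn_even_gt0.
rewrite -(pmulr_lgt0 _ vo2) cyc_trans_identity.
by apply: addr_gt0; apply: mulr_gt0 => //; rewrite exprn_even_gt0 //=;
  [case/cyc_nz: h1 | case/cyc_nz: h2].
Qed.

Lemma ccyc_transl o u v w : ccyc o u v -> cyc o v w -> ccyc o u w.
Proof.
move=> h1 h2; have [vo _ _] := cyc_nz h2; rewrite /ccyc.
have vo2 : 0 < br v o ^+ 2 by rewrite exprn_even_gt0 //= brC oppr_eq0.
rewrite -(pmulr_lge0 _ vo2) cyc_trans_identity.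
by apply: addr_ge0; apply: mulr_ge0; rewrite ?sqr_ge0 //; exact: ltW.
Qed.

Lemma ccyc_transr o u v w : cyc o u v -> ccyc o v w -> ccyc o u w.
Proof.
move=> h1 h2; have [_ _ vo] := cyc_nz h1; rewrite /ccyc.
have vo2 : 0 < br v o ^+ 2 by rewrite exprn_even_gt0.
rewrite -(pmulr_lge0 _ vo2) cyc_trans_identity.
by apply: addr_ge0; apply: mulr_ge0; rewrite ?sqr_ge0 //; exact: ltW.
Qed.

Lemma ccyc_rot u v w : ccyc u v w = ccyc v w u.
Proof. by rewrite /ccyc; congr (_ <= _ * _); ring. Qed.

Lemma cyc_trans3 o u v w : cyc o u v -> cyc o v w -> cyc u v w.
Proof.
move=> h1 h2; rewrite cyc_rot; apply: (@cyc_trans v w o u); first by rewrite -cyc_rot.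
by rewrite -cyc_rot -cyc_rot.
Qed.

Lemma cyc_mid o a b v : cyc o a b -> cyc a v b -> cyc o a v /\ cyc o v b.
Proof.
move=> oab avb; have abo : cyc a b o by rewrite -cyc_rot.
split; first by rewrite cyc_rot; exact: cyc_trans avb abo.
by rewrite cyc_rot; exact: cyc_trans3 avb abo.
Qed.

Lemma ccyc_mid o a b v : cyc o a b -> ccyc a v b -> ccyc o v b.
Proof.
move=> oab avb; rewrite -ccyc_rot; apply: (@ccyc_transr b o a v).
  by rewrite -cyc_rot -cyc_rot.
by rewrite -ccyc_rot -ccyc_rot.
Qed.

(** A hyperbolic g moves all the points between its fixed points p and n in
the same direction. With p and n both outside the arc from a to b, the points
a and b lie between them on the same side, and one of the two is moved out of
the arc. *)
Lemma no_common_arc g a b p n (x y : R) : br p n != 0 ->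
  g *m p = x *: p -> g *m n = y *: n -> x * y = 1 -> x ^+ 2 != 1 ->
  cyc b p a -> cyc b n a -> ccyc a (g *m a) b -> ccyc a (g *m b) b -> False.
Proof.
move=> pn0 gp gn xy x1 bpa bna gab gbb.
have pn2 : 0 < br p n ^+ 2 by rewrite exprn_even_gt0.
have gv v : br p n *: (g *m v) = (x * br v n) *: p + (y * br p v) *: n.
  rewrite scalemxAr br_decomp mulmxDr -!scalemxAr gp gn !scalerA.
  by rewrite [x * _]mulrC [y * _]mulrC.
have shift v : br p n ^+ 2 * (e * (br n v * br v (g *m v) * br (g *m v) n)) =
    (x ^+ 2 - 1) * br v n ^+ 2 * (e * (br n v * br v p * br p n)).
  have e1 : br p n * br v (g *m v) = x * br v n * br v p + y * br p v * br v n.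
    by rewrite -brZr gv brDr !brZr.
  have e2 : br p n * br (g *m v) n = x * br v n * br p n.
    by rewrite -brZl gv brDl !brZl br0 mulr0 addr0.
  have -> : br p n ^+ 2 * (e * (br n v * br v (g *m v) * br (g *m v) n)) =
     e * br n v * (br p n * br v (g *m v)) * (br p n * br (g *m v) n) by ring.
  rewrite e1 e2 -xy (brC v n) (brC v p); ring.
have nab : cyc n a b by rewrite -cyc_rot.
have [na0 ab0 bn0] := cyc_nz nab.
have side : 0 < (br n a * br a p * br p n) * (br n b * br b p * br p n).
  have h : 0 < (e * (br b p * br p a * br a b)) * (e * (br b n * br n a * br a b)).
    exact: mulr_gt0.
  have ab2 : 0 <= (e * br a b) ^+ 2 by rewrite sqr_ge0.
  rewrite -(pmulr_rgt0 _ (_ : 0 < (e * br a b) ^+ 2)); last first.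
    by rewrite exprn_even_gt0 //= mulf_neq0 // (cyc_e0 nab).
  have -> : (e * br a b) ^+ 2 *
      (br n a * br a p * br p n * (br n b * br b p * br p n)) =
      br p n ^+ 2 * ((e * (br b p * br p a * br a b)) * (e * (br b n * br n a * br a b))).
    by rewrite (brC p a) (brC b n); ring.
  by rewrite mulr_gt0.
have na2 : 0 < br a n ^+ 2 by rewrite exprn_even_gt0 //= brC oppr_eq0.
have nb2 : 0 < br b n ^+ 2 by rewrite exprn_even_gt0.
have e2 : 0 < e ^+ 2 by rewrite exprn_even_gt0 //= (cyc_e0 nab).
have := shift a; have := shift b.
set Sa := e * (br n a * br a (g *m a) * br (g *m a) n).
set Sb := e * (br n b * br b (g *m b) * br (g *m b) n).
set ca := br n a * br a p * br p n; set cb := br n b * br b p * br p n => hb ha.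
have k0 : x ^+ 2 - 1 != 0 by rewrite subr_eq0.
have ca0 : ca != 0 by apply: contraTneq side; rewrite -/ca => ->; rewrite mul0r ltxx.
have Sab : 0 < Sa * Sb.
  rewrite -(pmulr_rgt0 _ pn2) -(pmulr_rgt0 _ pn2).
  have -> : br p n ^+ 2 * (br p n ^+ 2 * (Sa * Sb)) = (br p n ^+ 2 * Sa) * (br p n ^+ 2 * Sb) by ring.
  rewrite ha hb.
  have -> : (x ^+ 2 - 1) * br a n ^+ 2 * (e * ca) * ((x ^+ 2 - 1) * br b n ^+ 2 * (e * cb)) =
    (x ^+ 2 - 1) ^+ 2 * e ^+ 2 * br a n ^+ 2 * br b n ^+ 2 * (ca * cb) by ring.
  by do 4?[apply: mulr_gt0 => //]; rewrite exprn_even_gt0.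
have [Sa0|Sa0] := ltrP 0 Sa.
  have Sb0 : cyc n b (g *m b) by rewrite /cyc -/Sb; rewrite pmulr_rgt0 in Sab.
  have := cyc_asym (cyc_trans3 nab Sb0); by rewrite gbb.
have {}Sa0 : cyc n (g *m a) a.
  rewrite /cyc (_ : e * _ = - Sa); last by rewrite /Sa (brC (g *m a) a) (brC (g *m a) n) (brC n a); ring.
  by rewrite oppr_gt0 lt_neqAle Sa0 andbT; apply: contraTneq Sab => ->; rewrite mul0r ltxx.
have := cyc_asym (_ : cyc a b (g *m a)); rewrite gab => /(_ _)/negP; apply => //.
by rewrite -cyc_rot; exact: cyc_trans3 Sa0 nab.
Qed.

(** The cross-ratio test for the pairs (u, u') and (v, v') to separate each
other on the circle. *)
Definition linked u u' v v' := br u v * br v u' * br u' v' * br v' u < 0.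

Lemma arc_par a a' b b' v : a != 0 -> b != 0 -> a' != 0 -> b' != 0 ->
  br a a' = 0 -> br b b' = 0 ->
  (cyc a v b = cyc a' v b') * (ccyc a v b = ccyc a' v b').
Proof.
move=> a0 b0 a'0 b'0 /(br_eq0P a0)[x ea] /(br_eq0P b0)[y eb].
have x0 : x != 0 by apply: contraNneq a'0 => x0; rewrite ea x0 scale0r.
have y0 : y != 0 by apply: contraNneq b'0 => y0; rewrite eb y0 scale0r.
have xy2 : 0 < (x * y) ^+ 2 by rewrite exprn_even_gt0 //= mulf_neq0.
have E : e * (br a' v * br v b' * br b' a') =
    (x * y) ^+ 2 * (e * (br a v * br v b * br b a)).
  by rewrite ea eb !brZl !brZr; ring.
by split; rewrite /cyc /ccyc E [RHS](pmulr_rgt0, pmulr_rge0).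
Qed.

Lemma cyc_neq0 u v w : cyc u v w -> [/\ u != 0, v != 0 & w != 0].
Proof.
have z v' : (br 0 v' = 0) by rewrite /br !mxE; ring.
case/cyc_nz => uv vw wu; split.
- by apply: contraNneq uv => ->; rewrite z.
- by apply: contraNneq vw => ->; rewrite z.
- by apply: contraNneq wu => ->; rewrite z.
Qed.

Lemma linked_chain o u v w x :
  cyc o u v -> cyc o v w -> cyc o w x -> linked u w v x.
Proof.
move=> uv vw wx; rewrite /linked.
have h1 := cyc_trans3 uv vw.
have h2 : cyc w x u by rewrite -cyc_rot; apply: (cyc_trans3 (cyc_trans uv vw) wx).
have [_ _ wu0] := cyc_nz h1.
rewrite -oppr_gt0.
have wu2 : 0 < br w u ^+ 2 by rewrite exprn_even_gt0.
have e2 : 0 < e ^+ 2.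
  by rewrite exprn_even_gt0 //= (cyc_e0 h1).
rewrite -(pmulr_rgt0 _ wu2) -(pmulr_rgt0 _ e2).
have -> : e ^+ 2 * (br w u ^+ 2 * - (br u v * br v w * br w x * br x u)) =
   (e * (br u v * br v w * br w u)) * (e * (br w x * br x u * br u w)).
  by rewrite (brC w u); ring.
exact: mulr_gt0.
Qed.

Lemma unlinked_side o u v w : cyc u v w -> cyc u o w ->
   0 < br u v * br v w * br w o * br o u.
Proof.
move=> h1 h2; have [_ _ wu0] := cyc_nz h1.
have wu2 : 0 < br w u ^+ 2 by rewrite exprn_even_gt0.
have e2 : 0 < e ^+ 2.
  by rewrite exprn_even_gt0 //= (cyc_e0 h1).
rewrite -(pmulr_rgt0 _ wu2) -(pmulr_rgt0 _ e2).
have -> : e ^+ 2 * (br w u ^+ 2 * (br u v * br v w * br w o * br o u)) =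
   (e * (br u v * br v w * br w u)) * (e * (br u o * br o w * br w u)).
  by rewrite (brC o u) (brC w o); ring.
exact: mulr_gt0.
Qed.
End Plane.

(** * Words in two letters *)

Definition letter := (bool * bool)%type.
Definition linv (x : letter) : letter := (x.1, ~~ x.2).
(** A quarter turn of the four letters, in the cyclic order A, B, A^-1, B^-1
in which their arcs lie on the circle at infinity. *)
Definition turn (x : letter) : letter := (~~ x.1, if x.1 then x.2 else ~~ x.2).
Definition turnV (x : letter) : letter := (~~ x.1, if x.1 then ~~ x.2 else x.2).
Definition winv (w : word) : word := rev [seq linv x | x <- w].
Definition adj : rel letter := fun x y => y != linv x.

Lemma linvK : involutive linv. Proof. by case=> [[] []]. Qed.
Lemma adj_linv x y : adj (linv y) (linv x) = adj x y.
Proof. by case: x => [[] []]; case: y => [[] []]. Qed.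
Lemma winvK : involutive winv.
Proof. by move=> w; rewrite /winv map_rev revK -map_comp map_id_in // => x _; rewrite /= linvK. Qed.

Section Words.
Variable R : realType.
Variables A B : 'M[R]_2.
Hypotheses (dA : \det A = 1) (dB : \det B = 1).
Local Notation ev := (eval_letter A B).
Local Notation eval := (eval_word A B).

Lemma eval_nil : eval [::] = 1. Proof. by rewrite /eval_word big_nil. Qed.
Lemma eval_cons x w : eval (x :: w) = ev x * eval w.
Proof. by rewrite /eval_word big_cons. Qed.
Lemma eval_cat w1 w2 : eval (w1 ++ w2) = eval w1 * eval w2.
Proof. by rewrite /eval_word big_cat. Qed.
Lemma eval_seq1 x : eval [:: x] = ev x.
Proof. by rewrite eval_cons eval_nil mulr1. Qed.
Lemma eval_rcons w x : eval (rcons w x) = eval w * ev x.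
Proof. by rewrite -cats1 eval_cat eval_seq1. Qed.

Lemma det_ev x : \det (ev x) = 1.
Proof. by rewrite /eval_letter; case: x => [[] []] //=; rewrite det_inv2. Qed.
Lemma det_eval w : \det (eval w) = 1.
Proof.
elim: w => [|x w IH]; first by rewrite eval_nil det1.
by rewrite eval_cons det_mul2 ?det_ev.
Qed.
Lemma ev_linv x : ev (linv x) = (ev x)^-1.
Proof. by rewrite /eval_letter; case: x => [[] []] //=; rewrite invrK. Qed.
Lemma eval_winv w : eval (winv w) = (eval w)^-1.
Proof.
elim: w => [|x w IH]; first by rewrite eval_nil invr1.
rewrite /winv map_cons rev_cons eval_rcons ev_linv IH eval_cons invrM //;
  by rewrite det1_unit // ?det_ev ?det_eval.
Qed.

Definition expo1 (x : letter) : int := if x.1 then (if x.2 then 1 else -1) else 0.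
Definition expo2 (x : letter) : int := if x.1 then 0 else (if x.2 then 1 else -1).
Definition expoA (w : word) : int := \sum_(x <- w) expo1 x.
Definition expoB (w : word) : int := \sum_(x <- w) expo2 x.

Lemma sorted_cons x w : reduced (x :: w) = path adj x w.
Proof. by []. Qed.

Lemma expoA_cons x w : expoA (x :: w) = expo1 x + expoA w.
Proof. by rewrite /expoA big_cons. Qed.
Lemma expoB_cons x w : expoB (x :: w) = expo2 x + expoB w.
Proof. by rewrite /expoB big_cons. Qed.

Lemma reduce w : exists w', [/\ reduced w', eval w' = eval w,
  expoA w' = expoA w, expoB w' = expoB w & (size w' <= size w)%N].
Proof.
elim: w => [|x w [w' [rw ew eA eB sw]]]; first by exists [::].
case: w' rw ew eA eB sw => [|y w'] rw ew eA eB sw.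
  by exists [:: x]; rewrite !expoA_cons !expoB_cons eA eB !eval_cons ew; split.
have [yx|yx] := eqVneq y (linv x); last first.
  exists [:: x, y & w']; rewrite expoA_cons eA expoB_cons eB eval_cons ew.
  rewrite -expoA_cons -expoB_cons -eval_cons; split=> //.
  by rewrite sorted_cons /= /adj yx.
exists w'; split.
- by move: rw; rewrite sorted_cons; exact: path_sorted.
- rewrite eval_cons -ew eval_cons yx ev_linv mulrA divrr ?mul1r //.
  by rewrite det1_unit // det_ev.
- rewrite expoA_cons -eA expoA_cons yx addrA.
  by rewrite -[LHS]add0r; congr (_ + _); case: (x) => [[] []].
- rewrite expoB_cons -eB expoB_cons yx addrA.
  by rewrite -[LHS]add0r; congr (_ + _); case: (x) => [[] []].
- by apply: leqW; apply: ltnW.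
Qed.

Definition cyc_reduced (w : word) := cycle adj w.

Lemma cyc_reduce w : exists g w', [/\ cyc_reduced w',
  (eval g)^-1 * eval w * eval g = eval w' & (size w' <= size w)%N].
Proof.
have [n] := ubnP (size w); elim: n w => // n IH w; rewrite ltnS => sw.
have [w1 [rw ew _ _ s1]] := reduce w.
case: w1 rw ew s1 => [|x s] rw ew s1.
  by exists [::], [::]; rewrite -ew !eval_nil invr1 !mulr1.
case: (lastP s) rw ew s1 => [|t y] rw ew s1.
  exists [::], [:: x]; rewrite eval_nil invr1 mul1r mulr1 ew; split=> //=.
  by rewrite /cyc_reduced /= /adj andbT; case: (x) => [[] []].
have [xy|xy] := eqVneq x (linv y); last first.
  exists [::], (x :: rcons t y); rewrite eval_nil invr1 mul1r mulr1 ew; split=> //=.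
  by rewrite /cyc_reduced /= rcons_path last_rcons /adj xy andbT.
have [|g [w' [cw' ew' sw']]] := IH t.
  by apply: leq_trans sw; move: s1; rewrite /= size_rcons; apply: leq_trans.
exists (x :: g), w'; split=> //; last first.
  by apply: leq_trans sw' _; apply: leq_trans s1; rewrite /= size_rcons; do 2!apply: leqW.
rewrite -ew' -ew !eval_cons eval_rcons invrM ?det1_unit ?det_ev ?det_eval // xy ev_linv invrK.
by rewrite !mulrA !mulrK ?det1_unit ?det_ev.
Qed.
End Words.

(** * Ping-pong on the circle at infinity *)

Section PingPong.
Variable R : realType.
Variables A B : 'M[R]_2.
Local Notation ev := (eval_letter A B).
Local Notation eval := (eval_word A B).

(** The vectors W are the ideal vertices of a quadrilateral, in cyclic order,
whose opposite sides are paired by A and by B. The side of the letter x joins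
W (turnV x) to W x, and the matrix of x maps the side of x^-1 to it;
[config_start] and [config_end] express this up to scaling. *)
Record config (e : R) (W : letter -> 'cV[R]_2) : Prop := Config {
  config_order : forall x, cyc e (W x) (W (turn x)) (W (linv x));
  config_start : forall x, br (ev x *m W (linv x)) (W (turnV x)) = 0;
  config_end : forall x, br (ev x *m W (turn x)) (W x) = 0 }.

Hypotheses (dA : \det A = 1) (dB : \det B = 1).

Lemma turnK x : turnV (turn x) = x. Proof. by case: x => [[] []]. Qed.
Lemma turnVK x : turn (turnV x) = x. Proof. by case: x => [[] []]. Qed.
Lemma turn_linv x : turn (linv x) = turnV x. Proof. by case: x => [[] []]. Qed.
Lemma turnV_linv x : turnV (linv x) = turn x. Proof. by case: x => [[] []]. Qed.
Lemma letterP (x y : letter) :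
  [\/ y = x, y = turn x, y = linv x | y = turnV x].
Proof.
by case: x => [[] []]; case: y => [[] []];
  (try by constructor 1); (try by constructor 2); (try by constructor 3); by constructor 4.
Qed.

Section Config.
Variables (e : R) (W : letter -> 'cV[R]_2).
Hypothesis cW : config e W.

Lemma W_neq0 x : W x != 0. Proof. by case/cyc_neq0: (config_order cW x). Qed.

(** The arc behind the side of x, where every reduced word that begins with x
ends up by ping-pong. The suffix c marks closed arcs, and [outI] is the
complementary arc. *)
Definition inI x v := cyc e (W (turnV x)) v (W x).
Definition inIc x v := ccyc e (W (turnV x)) v (W x).
Definition outI x v := cyc e (W x) v (W (turnV x)).
Definition outIc x v := ccyc e (W x) v (W (turnV x)).

Lemma order_l x : cyc e (W x) (W (linv x)) (W (turnV x)).
Proof.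
by rewrite cyc_rot; have := config_order cW (linv x); rewrite turn_linv linvK.
Qed.

Lemma outP x y v : y != x -> inI y v -> outI x v.
Proof.
rewrite /inI /outI => yx vy.
have h1 := config_order cW x; have h2 := order_l x; have h3 := cyc_trans h1 h2.
case: (letterP x y) yx vy => ->; rewrite ?eqxx // => _; rewrite ?turnK ?turnV_linv => vy.
- exact: cyc_trans vy h3.
- have [_ h] := cyc_mid h1 vy; exact: cyc_trans h h2.
- have E : turnV (turnV x) = linv x by case: (x) => [[] []].
  by rewrite E in vy; have [_ h] := cyc_mid h2 vy.
Qed.

Lemma outcP x y v : y != x -> inIc y v -> outIc x v.
Proof.
rewrite /inIc /outIc => yx vy.
have h1 := config_order cW x; have h2 := order_l x; have h3 := cyc_trans h1 h2.
case: (letterP x y) yx vy => ->; rewrite ?eqxx // => _; rewrite ?turnK ?turnV_linv => vy.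
- exact: ccyc_transl vy h3.
- exact: ccyc_transl (ccyc_mid h1 vy) h2.
- have E : turnV (turnV x) = linv x by case: (x) => [[] []].
  by rewrite E in vy; exact: ccyc_mid h2 vy.
Qed.

Lemma inI_out x v : inI x v -> ~ outI x v.
Proof.
rewrite /inI /outI => h1 h2.
by have := cyc_asym h1; rewrite ccyc_rot (cycW h2).
Qed.

Lemma inI_uniq x y v : inI x v -> inI y v -> y = x.
Proof. by move=> vx vy; apply/eqP/negPn/negP => yx; apply: inI_out vx (outP yx vy). Qed.

(** By [config_start] and [config_end] the letter maps the end points of one
arc to those of the other. *)
Lemma letter_arc x v : (inI x (ev x *m v) = outI (linv x) v) *
  (inIc x (ev x *m v) = outIc (linv x) v).
Proof.
have dx := det_ev dA dB x.
rewrite /inI /inIc /outI /outIc -(cyc_mul e (W (linv x)) v _ dx).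
have -> : ccyc e (W (linv x)) v (W (turnV (linv x))) =
  ccyc e (ev x *m W (linv x)) (ev x *m v) (ev x *m W (turnV (linv x))).
  by rewrite /ccyc !br_mul.
rewrite turnV_linv; have h := @arc_par _ e _ _ _ _ (ev x *m v)
  (mulmx2_neq0 dx (W_neq0 (linv x))) (mulmx2_neq0 dx (W_neq0 (turn x)))
  (W_neq0 (turnV x)) (W_neq0 x) (config_start cW x) (config_end cW x).
by rewrite !h.
Qed.

Lemma letter_map x y v : y != linv x -> inI y v -> inI x (ev x *m v).
Proof. by move=> yx vy; rewrite letter_arc; exact: outP vy. Qed.

Lemma letter_mapc x y v : y != linv x -> inIc y v -> inIc x (ev x *m v).
Proof. by move=> yx vy; rewrite letter_arc; exact: outcP vy. Qed.

Lemma word_map x s y v : path adj x s -> y != linv (last x s) -> inI y v ->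
  inI x (eval (x :: s) *m v).
Proof.
elim: s x => [|z s IH] x /=.
  by move=> _ yx vy; rewrite eval_seq1; exact: letter_map vy.
case/andP=> xz ps yl vy; rewrite eval_cons -mulmxE -mulmxA.
by apply: letter_map (IH _ ps yl vy).
Qed.

Lemma word_mapc x s v : path adj x s -> outIc (linv (last x s)) v ->
  inIc x (eval (x :: s) *m v).
Proof.
elim: s x => [|z s IH] x /=.
  by move=> _ vy; rewrite eval_seq1 letter_arc.
case/andP=> xz ps vy; rewrite eval_cons -mulmxE -mulmxA.
by apply: letter_mapc (IH _ ps vy).
Qed.

(** The point v is compared with the vertices in the linear order seen from
one of them. *)
Lemma inI_cover v : (forall x, br (W x) v != 0) -> exists x, inI x v.
Proof.
move=> nW; pose x : letter := (true, true); have ne := cyc_e0 (config_order cW x).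
have h1 := config_order cW x; have h2 := order_l x; have h3 := cyc_trans h1 h2.
have [k1o _ _] := cyc_nz h1; have [k2o _ _] := cyc_nz h2; have [_ _ k3o] := cyc_nz h2.
rewrite brC oppr_eq0 in k3o.
case/orP: (cyc_total ne k1o (nW x) (nW _)) => k1; last first.
  by exists (turn x); rewrite /inI turnK.
case/orP: (cyc_total ne k2o (nW x) (nW _)) => k2; last first.
  by exists (linv x); rewrite /inI turnV_linv; exact: cyc_trans3 k1 k2.
case/orP: (cyc_total ne k3o (nW x) (nW _)) => k3; last first.
  exists (turnV x); rewrite /inI (_ : turnV (turnV x) = linv x) //; exact: cyc_trans3 k2 k3.
by exists x; rewrite /inI -cyc_rot.
Qed.

Lemma winv_cons x s : exists s', [/\ winv (x :: s) = linv (last x s) :: s',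
   last (linv (last x s)) s' = linv x & path adj x s -> path adj (linv (last x s)) s'].
Proof.
elim: s x => [|y s IH] x; first by exists [::].
have [s' [e1 e2 e3]] := IH y.
exists (rcons s' (linv x)); split.
- by rewrite /winv map_cons rev_cons -/(winv (y :: s)) e1.
- by rewrite last_rcons.
- by move=> /= /andP[xy ps]; rewrite rcons_path e3 //= e2 adj_linv.
Qed.

(** An eigenvector outside the arc of the inverse of the last letter is moved
by ping-pong into the arc of the first letter, and therefore lies there. The
two eigenvectors cannot lie in the same arc, since the word or its inverse
maps the complement of that arc into itself, against [no_common_arc]. *)
Lemma ends_of_cyc_reduced x s p n (a b : R) : cyc_reduced (x :: s) ->
  br p n != 0 -> eval (x :: s) *m p = a *: p -> eval (x :: s) *m n = b *: n ->
  a * b = 1 -> a ^+ 2 != 1 ->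
  (forall y, br (W y) p != 0) -> (forall y, br (W y) n != 0) ->
  (inI x p /\ inI (linv (last x s)) n) \/ (inI x n /\ inI (linv (last x s)) p).
Proof.
rewrite /cyc_reduced /= rcons_path => /andP[ps lx] pn hp hn ab a2 gp gn.
have a0 : a != 0 by apply: contra_eq_neq ab => ->; rewrite mul0r eq_sym oner_eq0.
have b0 : b != 0 by apply: contra_eq_neq ab => ->; rewrite mulr0 eq_sym oner_eq0.
have inZ y c v : c != 0 -> inI y (c *: v) = inI y v.
  move=> c0; rewrite /inI; have := @cycZ _ e 1 c 1 (W (turnV y)) v (W y).
  by rewrite !scale1r; apply; rewrite ?oner_eq0.
have one : forall u c, c != 0 -> eval (x :: s) *m u = c *: u ->
   (forall z, br (W z) u != 0) -> inI x u \/ inI (linv (last x s)) u.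
  move=> u c c0 hu gu; have [y uy] := inI_cover gu.
  have [yl|yl] := eqVneq y (linv (last x s)); first by right; rewrite -yl.
  by left; rewrite -(inZ x c) // -hu; exact: word_map ps yl uy.
case: (one _ _ a0 hp gp) (one _ _ b0 hn gn) => h1 [h2|h2]; [|by left|by right|].
- exfalso; pose g := (eval (x :: s))^-1.
  have dg : \det (eval (x :: s)) = 1 by exact: det_eval.
  have gp' : g *m p = b *: p.
    by rewrite -[in RHS](mulmxVK2 p dg) hp -scalemxAr scalerA mulrC ab scale1r.
  have gn' : g *m n = a *: n.
    by rewrite -[in RHS](mulmxVK2 n dg) hn -scalemxAr scalerA ab scale1r.
  have [s' [e1 e2 e3]] := winv_cons x s.
  have gE : g = eval (linv (last x s) :: s') by rewrite -e1 eval_winv.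
  have out v : outIc x v -> outIc x (g *m v).
    move=> ov; apply: (@outcP x (linv (last x s))).
      by rewrite eq_sym.
    by rewrite gE; apply: word_mapc; [exact: e3|rewrite e2 linvK].
  apply: (@no_common_arc _ e g (W x) (W (turnV x)) p n b a) => //.
  + by rewrite mulrC.
  + apply: contra a2 => /eqP b2; apply/eqP.
    by rewrite -[LHS]mulr1 -b2 -exprMn ab expr1n.
  + by apply: out; rewrite /outIc /ccyc br0 !mul0r mulr0.
  + by apply: out; rewrite /outIc /ccyc br0 mulr0 mul0r mulr0.
- exfalso; pose g := eval (x :: s).
  have out v : outIc (linv (last x s)) v -> outIc (linv (last x s)) (g *m v).
    move=> ov; apply: (@outcP _ x); first exact: lx.
    exact: word_mapc.
  pose l := linv (last x s).
  apply: (@no_common_arc _ e g (W l) (W (turnV l)) p n a b) => //.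
  + by apply: out; rewrite /outIc /ccyc br0 !mul0r mulr0.
  + by apply: out; rewrite /outIc /ccyc br0 mulr0 mul0r mulr0.
Qed.
End Config.
End PingPong.

(** * Ideal quadrilaterals from a commutator of negative trace *)

Section ConfigExists.
Variable R : realType.
Variables A B : 'M[R]_2.
Hypotheses (dA : \det A = 1) (dB : \det B = 1).

(** The commutator has a negative eigenvalue l. The vertices are an
eigenvector u1 of it and the translates u2 = A^-1 u1, u4 = B^-1 u1 and
u3 = B^-1 A^-1 u1, for which A u3 = l u4; so the letters pair the sides, and
only the cyclic order is in question. The Plucker relation between the four
vectors reads g f = - (p ^ 2 - l q ^ 2), which is negative because l is: this
says that the diagonals of the quadrilateral cross. *)
Lemma config_exists : \tr (B * A * B^-1 * A^-1) < -2 ->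
  exists e W, [/\ config A B e W,
    (forall y, exists w, W y = eval_word A B w *m W (true, true)) &
    exists l : R, (B * A * B^-1 * A^-1) *m W (true, true) = l *: W (true, true)].
Proof.
set K := B * A * B^-1 * A^-1; set t := \tr K => t2.
have dAi := det_inv2 dA; have dBi := det_inv2 dB.
have dK : \det K = 1 by rewrite /K !det_mul2.
pose l := (t - Num.sqrt (t ^+ 2 - 4)) / 2.
have s0 : 0 <= t ^+ 2 - 4 by nra.
have s2 := sqr_sqrtr s0; have s1 := sqrtr_ge0 (t ^+ 2 - 4).
have l0 : l < 0 by rewrite /l; lra.
have el : l ^+ 2 - \tr K * l + 1 = 0.
  rewrite -/t /l.
  have -> : ((t - Num.sqrt (t ^+ 2 - 4)) / 2) ^+ 2 - t * ((t - Num.sqrt (t ^+ 2 - 4)) / 2) + 1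
    = (Num.sqrt (t ^+ 2 - 4) ^+ 2 - t ^+ 2 + 4) / 4 by field.
  by rewrite s2; field.
have [u1 u1n hK] := eigen2 dK el.
pose u2 := A^-1 *m u1; pose u4 := B^-1 *m u1; pose u3 := B^-1 *m u2.
have Au2 : A *m u2 = u1 by exact: mulmxKV2.
have Bu4 : B *m u4 = u1 by exact: mulmxKV2.
have Bu3 : B *m u3 = u2 by exact: mulmxKV2.
have u2n : u2 != 0 by exact: mulmx2_neq0.
have u4n : u4 != 0 by exact: mulmx2_neq0.
have u3n : u3 != 0 by exact: mulmx2_neq0.
have Au3 : A *m u3 = l *: u4.
  rewrite -[LHS](mulmxVK2 _ dB) /u4 scalemxAr -hK /K -!mulmxE -!mulmxA.
  by [].
pose p := br u1 u2; pose q := br u4 u1; pose f := br u2 u4; pose g := br u1 u3.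
have e23 : br u2 u3 = - l * q.
  by rewrite -(br_mul _ _ dA) Au2 Au3 brZr /q (brC u1 u4); ring.
have e34 : br u3 u4 = - p by rewrite -(br_mul _ _ dB) Bu3 Bu4 /p brC.
have gf : g * f = - (p ^+ 2 - l * q ^+ 2).
  have := plucker u1 u2 u3 u4; rewrite e23 e34 -/p -/g -/f (brC u4 u1) -/q => h.
  by apply/eqP; rewrite -subr_eq0 -oppr_eq0 -[X in _ == X]h; apply/eqP; ring.
have p_q : p = 0 -> q = 0.
  move=> /(br_eq0P u1n)[k u2k].
  have k0 : k != 0 by apply: contraNneq u2n => k0; rewrite u2k k0 scale0r.
  have u3k : u3 = k *: u4 by rewrite /u3 u2k -scalemxAr.
  have e1 : k *: (A *m u4) = l *: u4 by rewrite scalemxAr -u3k.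
  have e2 : k *: (A *m u1) = u1 by rewrite scalemxAr -u2k.
  have : k * (k * q) = l * q.
    by rewrite /q -[in LHS](br_mul u4 u1 dA) -brZr -brZl e1 e2 brZl.
  move/eqP; rewrite mulrA -subr_eq0 -mulrBl mulf_eq0 => /orP[|/eqP //].
  by rewrite gt_eqF // subr_gt0 (lt_trans l0) // -expr2 exprn_even_gt0.
have q_p : q = 0 -> p = 0.
  move=> q0; have /(br_eq0P u1n)[k u4k] : br u1 u4 = 0 by rewrite brC -/q q0 oppr0.
  have k0 : k != 0 by apply: contraNneq u4n => k0; rewrite u4k k0 scale0r.
  have e1 : k *: (B *m u1) = u1 by rewrite scalemxAr -u4k.
  have e3 : u3 = (l * k) *: u2.
    by rewrite -(mulmxVK2 u3 dA) Au3 u4k scalerA -scalemxAr.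
  have e2 : (l * k) *: (B *m u2) = u2 by rewrite scalemxAr -e3.
  have : k * (l * k * p) = p.
    by rewrite /p -[in LHS](br_mul u1 u2 dB) -brZr -brZl e1 e2.
  move/eqP; rewrite -subr_eq0 -[X in _ - X]mul1r mulrA -mulrBl mulf_eq0 => /orP[|/eqP //].
  rewrite lt_eqF // subr_lt0 (@lt_trans _ _ 0) ?ltr01 //.
  by rewrite mulrCA -expr2 nmulr_rlt0 // exprn_even_gt0.
have p0 : p != 0.
  apply/eqP => p0; have q0 := p_q p0.
  have /(br_eq0P u1n)[k u2k] := p0.
  have /(br_eq0P u1n)[h u4h] : br u1 u4 = 0 by rewrite brC -/q q0 oppr0.
  have e1 : u3 = (k * h) *: u1 by rewrite /u3 u2k -scalemxAr -/u4 u4h scalerA.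
  have e2 : u3 = (l * h * k) *: u1.
    by rewrite -(mulmxVK2 u3 dA) Au3 u4h scalerA -scalemxAr -/u2 u2k scalerA.
  have : ((k * h) * (1 - l)) *: u1 == 0.
    by rewrite mulrBr mulr1 scalerBl -e1 (mulrC _ l) (mulrC k) mulrA -e2 subrr.
  rewrite scaler_eq0 (negPf u1n) orbF mulf_eq0 => /orP[/eqP kh|].
    by move: u3n; rewrite e1 kh scale0r eqxx.
  by rewrite gt_eqF // subr_gt0 (lt_trans l0).
have q0 : q != 0 by apply: contra p0 => /eqP /q_p /eqP.
have gf0 : g * f < 0.
  rewrite gf oppr_lt0; apply: addr_gt0; first by rewrite exprn_even_gt0.
  by rewrite oppr_gt0 nmulr_rlt0 // exprn_even_gt0.
have f0 : f != 0 by apply: contraTneq gf0 => ->; rewrite mulr0 ltxx.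
pose W (x : letter) := if x.1 then (if x.2 then u1 else u3) else (if x.2 then u2 else u4).
(* the sign of p q f makes the triple of vertices u4, u1, u2 positive *)
exists (p * q * f), W; split; last 1 first.
- by exists l.
- split.
  + have p2 : 0 < p ^+ 2 by rewrite exprn_even_gt0.
    have q2 : 0 < q ^+ 2 by rewrite exprn_even_gt0.
    have f2 : 0 < f ^+ 2 by rewrite exprn_even_gt0.
    have pq := mulr_gt0 p2 q2.
    have pos1 : 0 < p ^+ 2 * q ^+ 2 * f ^+ 2 by exact: mulr_gt0.
    have pos2 : 0 < p ^+ 2 * q ^+ 2 * (l * (g * f)).
      by apply: mulr_gt0 => //; rewrite nmulr_rgt0.
    have pos3 : 0 < p ^+ 2 * q ^+ 2 * - (g * f).
      by apply: mulr_gt0 => //; rewrite oppr_gt0.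
    have pos4 : 0 < p ^+ 2 * q ^+ 2 * (- l * f ^+ 2).
      by apply: mulr_gt0 => //; rewrite mulr_gt0 ?oppr_gt0.
    case=> [[] []]; rewrite /cyc /W /=.
    * rewrite e23 (brC u1 u3) -/p -/g; move: pos2; congr (_ < _); ring.
    * rewrite e34 -/q -/g; move: pos3; congr (_ < _); ring.
    * rewrite e23 e34 (brC u2 u4) -/f; move: pos4; congr (_ < _); ring.
    * rewrite -/q -/p -/f; move: pos1; congr (_ < _); ring.
  + case=> [[] []]; rewrite /W /eval_letter /=.
    * by rewrite Au3 brZl br0 mulr0.
    * exact: br0.
    * by rewrite Bu4 br0.
    * exact: br0.
  + case=> [[] []]; rewrite /W /eval_letter /=.
    * by rewrite Au2 br0.
    * have -> : A^-1 *m u4 = l^-1 *: u3.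
        apply: (canRL (scalerK _)); first by rewrite lt_eqF.
        by rewrite scalemxAr -Au3 mulmxVK2.
      by rewrite brZl br0 mulr0.
    * by rewrite Bu3 br0.
    * exact: br0.
- case=> [[] []]; rewrite /W /=.
  + by exists [::]; rewrite eval_nil mul1mx.
  + exists [:: (false, false); (true, false)].
    by rewrite eval_cons eval_seq1 -mulmxE -mulmxA.
  + by exists [:: (true, false)]; rewrite eval_seq1.
  + by exists [:: (false, false)]; rewrite eval_seq1.
Qed.
End ConfigExists.

(** * Arcs at the corners of the quadrilateral *)

Section Corners.
Variable R : realType.
Variables A B : 'M[R]_2.
Hypotheses (dA : \det A = 1) (dB : \det B = 1).
Local Notation ev := (eval_letter A B).
Local Notation eval := (eval_word A B).
Variables (e : R) (W : letter -> 'cV[R]_2).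
Hypothesis cW : config A B e W.
Local Notation inI := (inI e W).
Local Notation outI := (outI e W).

(** Seen from the vertex W k, the arcs of turn k, linv k, turnV k and k follow
each other in this linear order. *)
Lemma from_vertex1 k v : inI (turn k) v -> cyc e (W k) v (W (turn k)).
Proof. by rewrite /inI turnK. Qed.
Lemma from_vertex2 k v : inI (linv k) v ->
  cyc e (W k) (W (turn k)) v /\ cyc e (W k) v (W (linv k)).
Proof. by rewrite /inI turnV_linv; apply: cyc_mid (config_order cW k). Qed.
Lemma from_vertex3 k v : inI (turnV k) v ->
  cyc e (W k) (W (linv k)) v /\ cyc e (W k) v (W (turnV k)).
Proof.
rewrite /inI (_ : turnV (turnV k) = linv k); last by case: (k) => [[] []].
exact: cyc_mid (order_l cW k).
Qed.
Lemma from_vertex4 k v : inI k v -> cyc e (W k) (W (turnV k)) v.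
Proof. by move=> h; rewrite cyc_rot. Qed.

Lemma straight_linked k u v u' v' : inI k u -> inI (linv k) v ->
  inI (turn k) u' -> inI (turnV k) v' -> linked u' v' v u.
Proof.
move=> hu hv hu' hv'.
have [a1 a2] := from_vertex2 hv; have [b1 b2] := from_vertex3 hv'.
apply: (linked_chain (e := e) (o := W k)).
- exact: cyc_trans (from_vertex1 hu') a1.
- exact: cyc_trans a2 b1.
- exact: cyc_trans b2 (from_vertex4 hu).
Qed.

(** The axis of k joins the two sides of k, so that the side of x and the arc
behind it lie entirely to one side of this axis. *)
Lemma letter_axis_side k x p n u v : x.1 != k.1 ->
  inI k p -> inI (linv k) n -> inI x u -> inI x v ->
  0 < br p u * br u n * br n v * br v p.
Proof.
move=> xk hp hn hu hv; have [n1 n2] := from_vertex2 hn; have p1 := from_vertex4 hp.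
have : (x = turn k \/ x = turnV k).
  by move: xk; case: (x) => [[] []]; case: (k) => [[] []] //=; by [left|right].
case=> E; subst x.
  have side z : inI (turn k) z -> cyc e p z n.
    move=> hz; rewrite cyc_rot.
    have n3 := cyc_trans (cyc_trans n2 (order_l cW k)) p1.
    exact: cyc_trans3 (cyc_trans (from_vertex1 hz) n1) n3.
  exact: unlinked_side (side _ hu) (side _ hv).
have side z : inI (turnV k) z -> cyc e n z p.
  move=> hz; have [z1 z2] := from_vertex3 hz.
  exact: cyc_trans3 (cyc_trans n2 z1) (cyc_trans z2 p1).
have := unlinked_side (side _ hu) (side _ hv).
by rewrite (brC u n) (brC p u) (brC v p) (brC n v); congr (_ < _); ring.
Qed.

(** No vertex is fixed by the letter k: two of them go to end points of the
side of k, each to one different from itself, and the other two into the open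
arc of k. *)
Lemma letter_not_vertex k v a y : v != 0 -> ev k *m v = a *: v -> br (W y) v != 0.
Proof.
move=> v0 hv; apply/eqP => /(br_eq0P (W_neq0 cW y))[c vE].
have c0 : c != 0 by apply: contraNneq v0 => c0; rewrite vE c0 scale0r.
have fixW : br (ev k *m W y) (W y) = 0.
  move: hv; rewrite vE -scalemxAr => hv.
  have : c * br (ev k *m W y) (W y) = 0 by rewrite -brZl hv !brZl br0 !mulr0.
  by move/eqP; rewrite mulf_eq0 (negPf c0) => /eqP.
have h1 := config_order cW (linv k); have h2 := order_l cW (linv k).
rewrite turn_linv linvK turnV_linv in h1 h2.
have inK z : outI (linv k) z -> inI k (ev k *m z) by rewrite (letter_arc dA dB cW).
case: (letterP k y) fixW => -> fixW.
- have : outI (linv k) (W k) by rewrite /outI turnV_linv.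
  by move/inK/cyc_nz => [_]; rewrite fixW eqxx.
- have nz : br (W (turn k)) (W k) != 0.
    by have [h _ _] := cyc_nz (config_order cW k); rewrite brC oppr_eq0.
  have W1 := W_neq0 cW k.
  have /(br_eq0P (W_neq0 cW (turn k)))[d dE] : br (W (turn k)) (ev k *m W (turn k)) = 0.
    by rewrite brC fixW oppr0.
  have d0 : d != 0.
    apply: contraTneq (mulmx2_neq0 (det_ev dA dB k) (W_neq0 cW (turn k))).
    by rewrite dE => ->; rewrite scale0r eqxx.
  have := config_end cW k; rewrite dE brZl => /eqP.
  by rewrite mulf_eq0 (negPf d0) (negPf nz).
- have nz : br (W (linv k)) (W (turnV k)) != 0 by case/cyc_nz: h1.
  have /(br_eq0P (W_neq0 cW (linv k)))[d dE] : br (W (linv k)) (ev k *m W (linv k)) = 0.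
    by rewrite brC fixW oppr0.
  have d0 : d != 0.
    apply: contraTneq (mulmx2_neq0 (det_ev dA dB k) (W_neq0 cW (linv k))).
    by rewrite dE => ->; rewrite scale0r eqxx.
  have := config_start cW k; rewrite dE brZl => /eqP.
  by rewrite mulf_eq0 (negPf d0) (negPf nz).
- have : outI (linv k) (W (turnV k)).
    by rewrite /outI turnV_linv; exact: cyc_trans h1 h2.
  by move/inK/cyc_nz => [h _ _]; move: h; rewrite brC fixW oppr0 eqxx.
Qed.

Lemma exists_min (l : seq 'cV[R]_2) o : l != [::] ->
  exists2 m, m \in l & forall z, z \in l -> ~ cyc e o z m.
Proof.
elim: l => // x l IH _; have [l0|/IH [m ml mmin]] := eqVneq l [::].
  exists x; first by rewrite mem_head.
  move=> z; rewrite l0 mem_seq1 => /eqP -> /cyc_nz[_].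
  by rewrite br0 eqxx.
have [xm|xm] := boolP (cyc e o x m).
  exists x; first by rewrite mem_head.
  move=> z; rewrite inE => /orP[/eqP -> /cyc_nz[_]|zl zx]; first by rewrite br0 eqxx.
  exact: mmin zl (cyc_trans zx xm).
exists m; first by rewrite inE ml orbT.
by move=> z; rewrite inE => /orP[/eqP -> /(negP xm)//|]; exact: mmin.
Qed.

(** S is meant to consist of the pairs of ends of the translates of a simple
axis that meet the quadrilateral. A translate that leaves through the side of
x enters again as its image by x^-1 ([Sshift]). The sides of k and turn k meet
at the vertex W k, so that [Scorners] says that every corner is cut off by
some translate. *)
Variable S : 'cV[R]_2 -> 'cV[R]_2 -> Prop.
Hypothesis Ssym : forall u v, S u v -> S v u.
Hypothesis Sends : forall u v, S u v -> exists x y, [/\ x != y, inI x u & inI y v].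
Hypothesis Sshift : forall u v x, S u v -> inI x u ->
  S ((ev x)^-1 *m u) ((ev x)^-1 *m v).
Hypothesis Spar : forall u v u', S u v -> u' != 0 -> br u u' = 0 -> S u' v.
Hypothesis Sunlinked : forall u v u' v', S u v -> S u' v' -> ~ linked u v u' v'.
Hypothesis Sfinite : exists l : seq 'cV[R]_2,
  (forall u v, S u v -> exists2 u', u' \in l & br u u' = 0) /\
  (forall u, u \in l -> exists v, S u v).
Hypothesis Scorners : forall k, exists u v, [/\ S u v, inI (turn k) u & inI k v].

Lemma S_neq0 u v : S u v -> u != 0.
Proof. by move/Sends => [x [y [_ ux _]]]; case/cyc_neq0: ux. Qed.

Lemma in_not_vertex x v y : inI x v -> br (W y) v != 0.
Proof.
move=> vx; have [<-|xy] := eqVneq x y.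
  by have [_ h _] := cyc_nz vx; rewrite brC oppr_eq0.
by have [h _ _] := cyc_nz (outP cW xy vx).
Qed.

(** Of the finitely many ends, let u be the one closest to W k. The translate
that issues from u cuts off the corner as well, since it would otherwise cross
the one that is known to do so. *)
Lemma innermost k : exists u v, [/\ S u v, inI (turn k) u, inI k v &
  forall u' v', S u' v' -> ~ cyc e (W k) u' u].
Proof.
have [g [g' [Sg gk g'k]]] := Scorners k.
have [l [lS Sl]] := Sfinite.
have l0 : l != [::] by have [u' + _] := lS _ _ Sg; case: (l).
have [u ul umin0] := exists_min (W k) l0.
have umin u' v' : S u' v' -> ~ cyc e (W k) u' u.
  move=> Su; have [u1 u1l par] := lS _ _ Su; have [v1 Su1] := Sl _ u1l.
  have [c cE] := br_eq0P (S_neq0 Su) par.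
  have c0 : c != 0 by apply: contraNneq (S_neq0 Su1) => c0; rewrite cE c0 scale0r.
  move=> cu; apply: (umin0 _ u1l); rewrite cE.
  have := @cycZ _ e 1 c 1 (W k) u' u; rewrite !scale1r => -> //; exact: oner_neq0.
have [v Suv] := Sl _ ul.
have [ug|ug] := eqVneq (br g u) 0.
  exists u, g'; split=> //; first exact: Spar Sg (S_neq0 Suv) ug.
  have [c cE] := br_eq0P (S_neq0 Sg) ug.
  have c0 : c != 0 by apply: contraNneq (S_neq0 Suv) => c0; rewrite cE c0 scale0r.
  rewrite cE /inI; have := @cycZ _ e 1 c 1 (W (turnV (turn k))) g (W (turn k)).
  by rewrite !scale1r => -> //; exact: oner_neq0.
have lt : cyc e (W k) u g.
  have [x [y [_ ux _]]] := Sends Suv.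
  have := cyc_total (cyc_e0 gk) (in_not_vertex k ux) (in_not_vertex k gk).
  rewrite brC oppr_eq0 => /(_ ug)/orP[//|h]; first by case: (umin _ _ Sg h).
have uk : inI (turn k) u.
  by rewrite /inI turnK; exact: cyc_trans lt (from_vertex1 gk).
exists u, v; split=> //.
have [x [y [xy ux vy]]] := Sends Suv.
have E := inI_uniq cW uk ux; subst x.
have far : cyc e (W k) (W (turn k)) v -> cyc e (W k) v (W (turnV k)) -> False.
  move=> v1 v2; apply: (Sunlinked Suv Sg); apply: (linked_chain (e := e) (o := W k) lt).
    exact: cyc_trans (from_vertex1 gk) v1.
  exact: cyc_trans v2 (from_vertex4 g'k).
case: (letterP k y) xy vy => -> //; first by rewrite eqxx.
  by move=> _ /from_vertex2 [v1 v2]; case: (far v1 (cyc_trans v2 (order_l cW k))).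
move=> _ /from_vertex3 [v1 v2]; case: (far _ v2).
exact: cyc_trans (config_order cW k) v1.
Qed.

(** The letter that takes one corner to the next one takes the innermost end
to the innermost end: if the image were farther away, its preimage would beat
the first one, and if it were closer, it would beat the second one. Going
around the four corners composes the letters to the commutator, which
therefore fixes the innermost end. *)
Lemma four_corners_fix : exists u v, S u v /\ br u ((B * A * B^-1 * A^-1) *m u) = 0.
Proof.
have step x u v u' v' : S u v -> inI (linv x) v ->
    (forall w w', S w w' -> ~ cyc e (W (linv x)) w u) ->
    S u' v' -> inI (turn (turnV x)) u' ->
    (forall w w', S w w' -> ~ cyc e (W (turnV x)) w u') ->
    inI (turn (linv x)) u ->
    exists c, ev x *m u = c *: u'.
  rewrite turnVK => Su vk umin Su' u'k u'min uk.
  have dx := det_ev dA dB x.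
  have par : br u' (ev x *m u) = 0.
    apply/eqP/negPn/negP => ne.
    have Sx : S (ev x *m u) (ev x *m v).
      have := Sshift (Ssym Su) vk; rewrite ev_linv invrK; exact: Ssym.
    have Sx' := Sshift Su' u'k.
    have xin : inI x (ev x *m u).
      apply: (letter_map dA dB cW) uk; first by case: (x) => [[] []].
    have := cyc_total (cyc_e0 u'k) (in_not_vertex (turnV x) u'k) (in_not_vertex (turnV x) xin) ne.
    case/orP=> h; last exact: u'min Sx h.
    apply: umin Sx' _; rewrite -(cyc_mul e _ _ _ dx) mulmxKV2 //.
    have hp := @cycZ _ e.
    have /(br_eq0P (mulmx2_neq0 dx (W_neq0 cW (linv x))))[c cE] := config_start cW x.
    have c0 : c != 0.
      by apply: contraTneq (W_neq0 cW (turnV x)) => c0; rewrite cE c0 scale0r eqxx.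
    move: h; rewrite cE; have := @cycZ _ e c 1 1 (ev x *m W (linv x)) u' (ev x *m u).
    by rewrite !scale1r => -> //; exact: oner_neq0.
  exact: br_eq0P (S_neq0 Su') par.
have [uA [vA [SA iA jA mA]]] := innermost (true, true).
have [uB [vB [SB iB jB mB]]] := innermost (false, true).
have [ua [va [Sa ia ja ma]]] := innermost (true, false).
have [ub [vb [Sb ib jb mb]]] := innermost (false, false).
have [c1 e1] := step (true, false) _ _ _ _ SA jA mA SB iB mB iA.
have [c2 e2] := step (false, false) _ _ _ _ SB jB mB Sa ia ma iB.
have [c3 e3] := step (true, true) _ _ _ _ Sa ja ma Sb ib mb ia.
have [c4 e4] := step (false, true) _ _ _ _ Sb jb mb SA iA mA ib.
rewrite /eval_letter /= in e1 e2 e3 e4.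
exists uA, vA; split=> //.
rewrite -!mulmxE -!mulmxA e1 -!scalemxAr e2 -!scalemxAr e3 -!scalemxAr e4.
by rewrite !brZr br0 !mulr0.
Qed.
End Corners.

(** * Mobius maps and hyperbolic distance *)

Local Open Scope complex_scope.

Section Hyperbolic.
Variable R : realType.
Implicit Types (g h F : 'M[R]_2) (z w : R[i]).
Notation Re := complex.Re.
Notation Im := complex.Im.

Definition mobius_den g z := (g 1 0 * Re z + g 1 1) ^+ 2 + (g 1 0 * Im z) ^+ 2.

Lemma mobius_den_gt0 g z : \det g = 1 -> 0 < Im z -> 0 < mobius_den g z.
Proof.
rewrite det2 /mobius_den => dg y0; have [c0|c0] := eqVneq (g 1 0) 0.
  rewrite c0 mulr0 subr0 in dg.
  rewrite c0 !mul0r add0r expr0n addr0 exprn_even_gt0 //=.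
  by apply: contra_eq_neq dg => ->; rewrite mulr0 eq_sym oner_eq0.
by rewrite ltr_wpDl ?sqr_ge0 // exprn_even_gt0 //= mulf_neq0 // gt_eqF.
Qed.

Lemma mobiusE g z : \det g = 1 -> 0 < Im z -> mobius g z =
  (((g 0 0 * Re z + g 0 1) * (g 1 0 * Re z + g 1 1) + g 0 0 * g 1 0 * Im z ^+ 2)
      / mobius_den g z) +i* (Im z / mobius_den g z).
Proof.
move=> dg y0; have := mobius_den_gt0 dg y0; rewrite det2 in dg.
case: z y0 => x y /= y0; rewrite /mobius_den /= => N0.
apply/eqP; rewrite eq_complex /=; apply/andP.
have dy : y = (g 0 0 * g 1 1 - g 0 1 * g 1 0) * y by rewrite dg mul1r.
rewrite !mul0r !subr0 !addr0; split; apply/eqP; set K := (_ + _)^-1; first by ring.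
by rewrite [in RHS]dy; ring.
Qed.

Lemma mobius_Im_gt0 g z : \det g = 1 -> 0 < Im z -> 0 < Im (mobius g z).
Proof. by move=> dg y0; rewrite mobiusE //= divr_gt0 // mobius_den_gt0. Qed.

Lemma mobius_denC_neq0 g z : \det g = 1 -> 0 < Im z ->
  (g 1 0)%:C * z + (g 1 1)%:C != 0.
Proof.
move=> dg y0; have := mobius_den_gt0 dg y0; rewrite /mobius_den.
case: z y0 => x y /= y0; apply: contraTneq => /eqP.
rewrite eq_complex /= !mul0r subr0 !addr0 => /andP[/eqP -> /eqP ->].
by rewrite expr0n addr0 ltxx.
Qed.

Lemma mobiusM g h z : \det g = 1 -> \det h = 1 -> 0 < Im z ->
  mobius (g * h) z = mobius g (mobius h z).
Proof.
move=> dg dh y0.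
have n1 := mobius_denC_neq0 dh y0.
have n2 := mobius_denC_neq0 dg (mobius_Im_gt0 dh y0).
have n3 := mobius_denC_neq0 (det_mul2 dg dh) y0.
move: n1 n2 n3; rewrite /mobius !mx2E !rmorphD !rmorphM.
set a := (g 0 0)%:C; set b := (g 0 1)%:C; set c := (g 1 0)%:C; set d := (g 1 1)%:C.
set a' := (h 0 0)%:C; set b' := (h 0 1)%:C; set c' := (h 1 0)%:C; set d' := (h 1 1)%:C.
move=> n1 n2 n3; field; rewrite n1 /=.
by apply: contraNneq n3 => h0; apply/eqP; rewrite -[RHS]h0; ring.
Qed.

Lemma mobius1 z : mobius 1 z = z.
Proof. by rewrite /mobius !mxE /= mul1r mul0r addr0 add0r divr1. Qed.

Lemma mobiusN g z : mobius (- g) z = mobius g z.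
Proof.
rewrite /mobius !mxE !rmorphN !mulNr -!opprD invrN mulrNN //.
Qed.

Lemma mobiusK g z : \det g = 1 -> 0 < Im z -> mobius g^-1 (mobius g z) = z.
Proof.
by move=> dg y0; rewrite -mobiusM ?det_inv2 // mulVr ?det1_unit // mobius1.
Qed.
Lemma mobiusVK g z : \det g = 1 -> 0 < Im z -> mobius g (mobius g^-1 z) = z.
Proof.
by move=> dg y0; rewrite -mobiusM ?det_inv2 // divrr ?det1_unit // mobius1.
Qed.

(** The hyperboloid model: z becomes the symmetric matrix of determinant 1
with entries hc z, hb z and ha z, on which Mobius maps act linearly, and
[hinner] is the bilinear form that polarizes the determinant. It equals the
hyperbolic cosine of the distance. *)
Definition ha z : R := (Im z)^-1.
Definition hb z : R := Re z / Im z.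
Definition hc z : R := (Re z ^+ 2 + Im z ^+ 2) / Im z.
Definition hinner z w : R := (ha z * hc w + hc z * ha w - 2 * hb z * hb w) / 2.

Lemma hcoord_null z : 0 < Im z -> ha z * hc z - hb z ^+ 2 = 1.
Proof. by case: z => x y /= y0; rewrite /ha /hb /hc /=; field; rewrite gt_eqF. Qed.

Lemma hcoord_inj z w : 0 < Im z -> 0 < Im w -> ha z = ha w -> hb z = hb w -> z = w.
Proof.
case: z w => x y [x' y'] /= y0 y'0; rewrite /ha /hb /= => /invr_inj e.
by rewrite e => /(divIf (lt0r_neq0 y'0)) ->.
Qed.

Lemma hdistE z w : 0 < Im z -> 0 < Im w -> hdist z w = arcosh (hinner z w).
Proof.
case: z w => x y [x' y'] /= y0 y'0; rewrite /hdist /hinner /ha /hb /hc /=; congr arcosh.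
by field; rewrite !gt_eqF.
Qed.

Lemma hcoord_mobius g z : \det g = 1 -> 0 < Im z ->
  [/\ ha (mobius g z) = g 1 0 ^+ 2 * hc z + 2 * g 1 0 * g 1 1 * hb z + g 1 1 ^+ 2 * ha z,
      hb (mobius g z) = g 0 0 * g 1 0 * hc z + (g 0 0 * g 1 1 + g 0 1 * g 1 0) * hb z +
         g 0 1 * g 1 1 * ha z
    & hc (mobius g z) = g 0 0 ^+ 2 * hc z + 2 * g 0 0 * g 0 1 * hb z + g 0 1 ^+ 2 * ha z].
Proof.
move=> dg y0; have N0 := mobius_den_gt0 dg y0; rewrite mobiusE //.
rewrite det2 in dg; move: N0; rewrite /ha /hb /hc /mobius_den.
case: z y0 => x y /= y0 N0.
have yn := lt0r_neq0 y0; have Nn := lt0r_neq0 N0; split.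
- by field; rewrite yn Nn.
- by field; rewrite yn Nn.
- set u := (X in (X / _) ^+ 2).
  have e1 : u ^+ 2 + y ^+ 2 = ((g 0 0 * x + g 0 1) ^+ 2 + (g 0 0 * y) ^+ 2) *
      ((g 1 0 * x + g 1 1) ^+ 2 + (g 1 0 * y) ^+ 2).
    have dy : y = (g 0 0 * g 1 1 - g 0 1 * g 1 0) * y by rewrite dg mul1r.
    by rewrite [in LHS]dy /u; ring.
  transitivity ((u ^+ 2 + y ^+ 2) / (((g 1 0 * x + g 1 1) ^+ 2 + (g 1 0 * y) ^+ 2) * y)).
    by field; rewrite yn Nn.
  by rewrite e1; field; rewrite yn Nn.
Qed.

Lemma hinner_mobius g z w : \det g = 1 -> 0 < Im z -> 0 < Im w ->
  hinner (mobius g z) (mobius g w) = hinner z w.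
Proof.
move=> dg y0 y'0; rewrite /hinner.
have [-> -> ->] := hcoord_mobius dg y0; have [-> -> ->] := hcoord_mobius dg y'0.
rewrite det2 in dg; transitivity ((g 0 0 * g 1 1 - g 0 1 * g 1 0) ^+ 2 *
  ((ha z * hc w + hc z * ha w - 2 * hb z * hb w) / 2)); first by field.
by rewrite dg expr1n mul1r.
Qed.

Lemma hdist_mobius g z w : \det g = 1 -> 0 < Im z -> 0 < Im w ->
  hdist (mobius g z) (mobius g w) = hdist z w.
Proof. by move=> dg y0 y'0; rewrite !hdistE ?mobius_Im_gt0 // hinner_mobius. Qed.

Lemma hinner_ge1 z w : 0 < Im z -> 0 < Im w -> 1 <= hinner z w.
Proof.
case: z w => x y [x' y'] /= y0 y'0; rewrite /hinner /ha /hb /hc /=.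
rewrite -subr_ge0 [X in _ <= X](_ : _ = ((x - x') ^+ 2 + (y - y') ^+ 2) / (2 * y * y')).
  by rewrite divr_ge0 ?addr_ge0 ?sqr_ge0 // !mulr_ge0 // ltW.
by field; rewrite !gt_eqF.
Qed.

Lemma coshE x : cosh x = (expR x + (expR x)^-1) / 2 :> R.
Proof. by rewrite /cosh expRN. Qed.
Lemma sinhE x : sinh x = (expR x - (expR x)^-1) / 2 :> R.
Proof. by rewrite /sinh expRN. Qed.
Lemma cosh2_sinh2 (x : R) : cosh x ^+ 2 - sinh x ^+ 2 = 1.
Proof. by rewrite coshE sinhE; field; rewrite expR_eq0. Qed.
Lemma coshD (x y : R) : cosh (x + y) = cosh x * cosh y + sinh x * sinh y.
Proof. by rewrite !coshE !sinhE expRD; field; rewrite !expR_eq0. Qed.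
Lemma coshN (x : R) : cosh (- x) = cosh x.
Proof. by rewrite !coshE expRN invrK addrC. Qed.
Lemma sinhN (x : R) : sinh (- x) = - sinh x.
Proof. by rewrite !sinhE expRN invrK -opprB mulNr. Qed.
Lemma sinh_gt0 (x : R) : 0 < x -> 0 < sinh x.
Proof.
move=> x0; rewrite /sinh divr_gt0 // subr_gt0 ltr_expR; lra.
Qed.
Lemma sinh_ge0 (x : R) : 0 <= x -> 0 <= sinh x.
Proof.
move=> x0; rewrite /sinh divr_ge0 // subr_ge0 ler_expR; lra.
Qed.
Lemma cosh_norm (x : R) : cosh `|x| = cosh x.
Proof. by case: ger0P => // _; rewrite coshN. Qed.

Lemma arcosh_cosh (x : R) : arcosh (cosh x) = `|x|.
Proof.
rewrite -cosh_norm /arcosh; set y := `|x|; have y0 : 0 <= y by exact: normr_ge0.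
have -> : cosh y ^+ 2 - 1 = sinh y ^+ 2 by rewrite -(cosh2_sinh2 y); ring.
rewrite sqrtr_sqr ger0_norm ?sinh_ge0 // (_ : _ + _ = expR y) ?expRK //.
by rewrite /cosh /sinh; field.
Qed.

Lemma cosh_arcosh (x : R) : 1 <= x -> cosh (arcosh x) = x.
Proof.
move=> x1; rewrite coshE /arcosh; set s := Num.sqrt _.
have s2 : s ^+ 2 = x ^+ 2 - 1 by rewrite sqr_sqrtr //; nra.
have s0 : 0 <= s by exact: sqrtr_ge0.
have p0 : 0 < x + s by lra.
rewrite lnK ?posrE //.
have -> : (x + s)^-1 = x - s.
  apply: (mulfI (lt0r_neq0 p0)); rewrite divff ?lt0r_neq0 //.
  by transitivity (x ^+ 2 - s ^+ 2); [rewrite s2; ring | ring].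
by field.
Qed.

Lemma hinner_hdist z w : 0 < Im z -> 0 < Im w -> hinner z w = cosh (hdist z w).
Proof. by move=> y0 y'0; rewrite hdistE // cosh_arcosh // hinner_ge1. Qed.

(** The image of the vertical geodesic by F; its two ends are the columns of
F. *)
Definition hline F t : R[i] := mobius F (0 +i* expR t).

Lemma hline_Im F t : \det F = 1 -> 0 < Im (hline F t).
Proof. by move=> dF; rewrite mobius_Im_gt0 //= expR_gt0. Qed.

Lemma hline_geodesic F : \det F = 1 -> geodesic_line (hline F).
Proof.
move=> dF; split=> [t|t u]; first exact: hline_Im.
rewrite hdist_mobius //= ?expR_gt0 // hdistE /= ?expR_gt0 // -arcosh_cosh; congr (arcosh _).
rewrite /hinner /ha /hb /hc /= coshE expRD expRN; field.
by rewrite !expR_eq0.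
Qed.
End Hyperbolic.

(** * Geodesics of the half-plane *)

Section Geodesics.
Variable R : realType.
Implicit Types (g h F : 'M[R]_2) (z w : R[i]).
Notation Re := complex.Re.
Notation Im := complex.Im.

(** A form of signature (1, 2) is definite on the orthogonal complement of a
vector with positive square, here (a, b, c). *)
Lemma null_perp (a b c x y z : R) : 0 < a -> a * c - b ^+ 2 = 1 ->
  x * z - y ^+ 2 = 0 -> a * z + c * x - 2 * b * y = 0 -> [/\ x = 0, y = 0 & z = 0].
Proof.
move=> a0 abc xyz h.
have e1 : (a * z - c * x) ^+ 2 + 4 * y ^+ 2 = 0.
  have -> : (a * z - c * x) ^+ 2 + 4 * y ^+ 2 =
    (a * z + c * x - 2 * b * y) * (a * z + c * x + 2 * b * y)
    - 4 * a * c * (x * z - y ^+ 2) - 4 * (a * c - b ^+ 2 - 1) * y ^+ 2 by ring.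
  by rewrite h xyz abc; ring.
have y0 : y = 0.
  have : 4 * y ^+ 2 <= 0 by rewrite -e1 lerDr sqr_ge0.
  by rewrite pmulr_rle0 // => y2; apply/eqP; rewrite -sqrf_eq0 eq_le y2 sqr_ge0.
have e2 : a * z - c * x = 0.
  by apply/eqP; rewrite -sqrf_eq0; apply/eqP; rewrite -e1 y0; ring.
have e3 : c * x = 0 by move: h e2; rewrite y0; lra.
have x0 : x = 0.
  move/eqP: e3; rewrite mulf_eq0 => /orP[/eqP c0|/eqP //].
  by have := sqr_ge0 b; move: abc; rewrite c0; lra.
split=> //; move/eqP: e2; rewrite x0 mulr0 subr0 mulf_eq0 gt_eqF //= => /eqP //.
Qed.

Lemma rank_one (a b c : R) : 0 <= a -> 0 <= c -> a * c - b ^+ 2 = 0 ->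
  exists x y, [/\ y ^+ 2 = a, x * y = b & x ^+ 2 = c].
Proof.
move=> a0 c0 /subr0_eq abc.
have h : Num.sqrt c * Num.sqrt a = `|b| by rewrite -sqrtrM // mulrC abc sqrtr_sqr.
have [b0|b0] := lerP 0 b.
  exists (Num.sqrt c), (Num.sqrt a); rewrite !sqr_sqrtr //; split=> //.
  by rewrite h ger0_norm.
exists (- Num.sqrt c), (Num.sqrt a); rewrite sqrrN !sqr_sqrtr //; split=> //.
by rewrite mulNr h ltr0_norm // opprK.
Qed.

(** The dominant exponential gives the sign, at +oo for p and at -oo for n. *)
Lemma growth_ge0 (f : R -> R) p n : (forall t, 0 < f t) ->
  (forall t, f t = expR t * p + expR (- t) * n) -> 0 <= p /\ 0 <= n.
Proof.
have one (k : R -> R) x y : (forall t, 0 < k t) ->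
    (forall t, k t = expR t * x + expR (- t) * y) -> 0 <= x.
  move=> k0 kE; rewrite leNgt; apply/negP => x0.
  have xy : 0 < x + y by have := k0 0; rewrite kE oppr0 expR0 !mul1r.
  have y0 : 0 < y by lra.
  pose t := y / - x; have t0 : 0 <= t by rewrite divr_ge0 ?ltW // oppr_gt0.
  have := k0 t; rewrite kE expRN => h.
  have e0 := expR_gt0 t; have e1 := expR_ge1Dx t.
  have h2 : 0 < expR t ^+ 2 * x + y.
    have -> : expR t ^+ 2 * x + y = expR t * (expR t * x + (expR t)^-1 * y).
      by field; rewrite gt_eqF.
    exact: mulr_gt0.
  have h3 : (1 + t) ^+ 2 <= expR t ^+ 2.
    by rewrite lerXn2r ?nnegrE ?addr_ge0 // ltW.
  have tx : t * x = - y by rewrite /t; field; rewrite lt_eqF.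
  have h4 : expR t ^+ 2 * x <= (1 + t) ^+ 2 * x by rewrite ler_nM2r.
  have h5 : (1 + t) ^+ 2 * x = x - 2 * y - y * t.
    by transitivity (x + 2 * (t * x) + t * (t * x)); [ring | rewrite tx; ring].
  have : 0 <= y * t by rewrite mulr_ge0 // ltW.
  by lra.
move=> f0 fE; split; first exact: one f0 fE.
apply: (one (fun t => f (- t)) n p) => // t.
by rewrite fE opprK addrC.
Qed.

(** In the hyperboloid model the products of the points s t and s u are
cosh (t - u), a kernel of rank 2. So the difference between s t and the
combination cosh t s(0) + sinh t v, with v the unit tangent vector at 0, is
orthogonal to all the points s u and to itself, and vanishes by [null_perp].
This writes s t as expR t P + expR (- t) N with P and N on the null cone, that
is, squares of vectors by [rank_one]: these are the columns of F, up to a sign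
that makes the determinant 1. *)
Lemma geodesic_frame (s : R -> R[i]) : geodesic_line s ->
  exists2 F, \det F = 1 & forall t, s t = hline F t.
Proof.
case=> sH sd; have sI t : 0 < Im (s t) by exact: sH.
pose a t := ha (s t); pose b t := hb (s t); pose c t := hc (s t).
have inE t u : (a t * c u + c t * a u - 2 * b t * b u) / 2 = cosh (t - u).
  by rewrite -[LHS]/(hinner (s t) (s u)) hinner_hdist // sd cosh_norm.
have nul t : a t * c t - b t ^+ 2 = 1 by exact: hcoord_null.
have a0 t : 0 < a t by rewrite /a /ha invr_gt0.
have c0 t : 0 < c t.
  rewrite /c /hc divr_gt0 //; by rewrite ltr_wpDl ?sqr_ge0 // exprn_gt0.
pose S : R := sinh 1; pose C : R := cosh 1.
have S0 : 0 < S by rewrite sinh_gt0.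
have CS : C ^+ 2 - S ^+ 2 = 1 by exact: cosh2_sinh2.
pose va := (a 1 - C * a 0) / S; pose vb := (b 1 - C * b 0) / S.
pose vc := (c 1 - C * c 0) / S.
have coshB (t u : R) : cosh (t - u) = cosh t * cosh u - sinh t * sinh u.
  by rewrite coshD coshN sinhN mulrN.
have key t : [/\ a t = cosh t * a 0 + sinh t * va, b t = cosh t * b 0 + sinh t * vb
    & c t = cosh t * c 0 + sinh t * vc].
  pose x := a t - cosh t * a 0 - sinh t * va.
  pose y := b t - cosh t * b 0 - sinh t * vb.
  pose z := c t - cosh t * c 0 - sinh t * vc.
  have perp u : (x * c u + z * a u - 2 * y * b u) / 2 = 0.
    have -> : (x * c u + z * a u - 2 * y * b u) / 2 =
       ((a t * c u + c t * a u - 2 * b t * b u) / 2)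
       - cosh t * ((a 0 * c u + c 0 * a u - 2 * b 0 * b u) / 2)
       - sinh t * (((a 1 * c u + c 1 * a u - 2 * b 1 * b u) / 2)
           - C * ((a 0 * c u + c 0 * a u - 2 * b 0 * b u) / 2)) / S.
      by rewrite /x /y /z /va /vb /vc; field; rewrite gt_eqF.
    rewrite !inE sub0r coshN !coshB -/S -/C; field; by rewrite gt_eqF.
  have xyz : x * z - y ^+ 2 = 0.
    have -> : x * z - y ^+ 2 = (x * c t + z * a t - 2 * y * b t) / 2
       - cosh t * ((x * c 0 + z * a 0 - 2 * y * b 0) / 2)
       - sinh t * ((x * c 1 + z * a 1 - 2 * y * b 1) / 2
           - C * ((x * c 0 + z * a 0 - 2 * y * b 0) / 2)) / S.
      by rewrite /x /y /z /va /vb /vc; field; rewrite gt_eqF.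
    by rewrite !perp; ring.
  have p0 : a 0 * z + c 0 * x - 2 * b 0 * y = 0.
    by move: (perp 0); clearbody x y z; clear -x; move: (a 0) (b 0) (c 0) => a' b' c' h; lra.
  have [x0 y0 z0] := null_perp (a0 0) (nul 0) xyz p0.
  by move: x0 y0 z0; rewrite /x /y /z; split; lra.
pose Pa := (a 0 + va) / 2; pose Pb := (b 0 + vb) / 2; pose Pc := (c 0 + vc) / 2.
pose Na := (a 0 - va) / 2; pose Nb := (b 0 - vb) / 2; pose Nc := (c 0 - vc) / 2.
have aE t : a t = expR t * Pa + expR (- t) * Na.
  have [-> _ _] := key t; rewrite /cosh /sinh /Pa /Na; by field.
have bE t : b t = expR t * Pb + expR (- t) * Nb.
  have [_ -> _] := key t; rewrite /cosh /sinh /Pb /Nb; by field.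
have cE t : c t = expR t * Pc + expR (- t) * Nc.
  have [_ _ ->] := key t; rewrite /cosh /sinh /Pc /Nc; by field.
have [Pa0 Na0] := growth_ge0 a0 aE; have [Pc0 Nc0] := growth_ge0 c0 cE.
have in10 : (a 1 * c 0 + c 1 * a 0 - 2 * b 1 * b 0) / 2 = C by rewrite inE subr0.
have PP : Pa * Pc - Pb ^+ 2 = 0.
  have -> : Pa * Pc - Pb ^+ 2 = ((a 0 * c 0 - b 0 ^+ 2) * (S - C) ^+ 2 +
      (a 1 * c 1 - b 1 ^+ 2) +
      2 * (S - C) * ((a 1 * c 0 + c 1 * a 0 - 2 * b 1 * b 0) / 2)) / (4 * S ^+ 2).
    by rewrite /Pa /Pb /Pc /va /vb /vc; field; rewrite gt_eqF.
  rewrite !nul in10 (_ : _ + _ = 0) ?mul0r //.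
  by transitivity (1 - (C ^+ 2 - S ^+ 2)); [ring | rewrite CS subrr].
have NN : Na * Nc - Nb ^+ 2 = 0.
  have -> : Na * Nc - Nb ^+ 2 = ((a 0 * c 0 - b 0 ^+ 2) * (S + C) ^+ 2 +
      (a 1 * c 1 - b 1 ^+ 2) -
      2 * (S + C) * ((a 1 * c 0 + c 1 * a 0 - 2 * b 1 * b 0) / 2)) / (4 * S ^+ 2).
    by rewrite /Na /Nb /Nc /va /vb /vc; field; rewrite gt_eqF.
  rewrite !nul in10 (_ : _ + _ - _ = 0) ?mul0r //.
  by transitivity (1 - (C ^+ 2 - S ^+ 2)); [ring | rewrite CS subrr].
have PN : Pa * Nc + Na * Pc - 2 * Pb * Nb = 1.
  rewrite -[RHS](nul 0) (_ : a 0 = Pa + Na); last by rewrite /Pa /Na; field.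
  rewrite (_ : b 0 = Pb + Nb); last by rewrite /Pb /Nb; field.
  rewrite (_ : c 0 = Pc + Nc); last by rewrite /Pc /Nc; field.
  transitivity (Pa * Nc + Na * Pc - 2 * Pb * Nb + (Pa * Pc - Pb ^+ 2) + (Na * Nc - Nb ^+ 2)).
    by rewrite PP NN !addr0.
  by ring.
have [x [y [yP xyP xP]]] := rank_one Pa0 Pc0 PP.
have [x' [y' [yN xyN xN]]] := rank_one Na0 Nc0 NN.
have det2' : (x * y' - x' * y) ^+ 2 = 1.
  rewrite -PN -yP -xyP -xP -yN -xyN -xN; ring.
have [k k2 kd] : exists2 k : R, k ^+ 2 = 1 & k * (x * y' - x' * y) = 1.
  by exists (x * y' - x' * y) => //; rewrite -expr2.
exists (mx2 x (k * x') y (k * y')).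
  by rewrite det2 !mx2_entries -kd; ring.
move=> t; set F := mx2 _ _ _ _.
have dF : \det F = 1 by rewrite det2 !mx2_entries -kd; ring.
have eI : 0 < Im (0 +i* expR t) by exact: expR_gt0.
have [hA hB _] := hcoord_mobius dF eI.
apply: hcoord_inj => //; first exact: hline_Im.
- rewrite hA -/(a t) aE /F !mx2_entries /ha /hb /hc /= expRN -yP -yN.
  transitivity (expR t * y ^+ 2 + k ^+ 2 * ((expR t)^-1 * y' ^+ 2)); first by rewrite k2 mul1r.
  by field; rewrite expR_eq0.
- rewrite hB -/(b t) bE /F !mx2_entries /ha /hb /hc /= expRN -xyP -xyN.
  transitivity (expR t * (x * y) + k ^+ 2 * ((expR t)^-1 * (x' * y'))); first by rewrite k2 mul1r.
  by field; rewrite expR_eq0.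
Qed.
End Geodesics.

(** * Ends and axes *)

Section Axes.
Variable R : realType.
Implicit Types (g h F : 'M[R]_2) (z w : R[i]).
Notation Re := complex.Re.
Notation Im := complex.Im.

(** An interval has positive measure, hence is not countable. *)
Lemma countable_pigeonhole (T : countType) (f : R -> T) :
  exists t u, t != u /\ f t = f u.
Proof.
apply: contrapT => H.
have fI : injective f.
  move=> t u ftu; apply/eqP/negPn/negP => tu; apply: H.
  by exists t, u.
have : countable [set` (`[0, 1] : interval R)].
  by apply/countable_injP; exists (pickle \o f) => t u _ _ /= /(pcan_inj (@pickleK T)) /fI.
move/countable_lebesgue_measure0; rewrite lebesgue_measure_itv /= lte01 oppr0 adde0.
by move=> /eqP; rewrite onee_eq0.
Qed.

(** Homogeneous coordinates of the limits of [hline F t] at -oo and at +oo. *)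
Definition src F : 'cV[R]_2 := col 1 F.
Definition tgt F : 'cV[R]_2 := col 0 F.

Lemma br_frame F : br (tgt F) (src F) = \det F.
Proof. by rewrite det2 /br !mxE; ring. Qed.
Lemma tgtM g F : tgt (g * F) = g *m tgt F.
Proof. by apply: cv2P; rewrite [LHS]mxE mx2E mxv2E !mxE. Qed.
Lemma srcM g F : src (g * F) = g *m src F.
Proof. by apply: cv2P; rewrite [LHS]mxE mx2E mxv2E !mxE. Qed.

Lemma hlineM g F t : \det g = 1 -> \det F = 1 -> hline (g * F) t = mobius g (hline F t).
Proof. by move=> dg dF; rewrite /hline mobiusM //; exact: expR_gt0. Qed.

Lemma frame_change F F' : \det F = 1 ->
  [/\ (F^-1 * F') 0 0 = br (tgt F') (src F), (F^-1 * F') 1 0 = br (tgt F) (tgt F'),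
      (F^-1 * F') 0 1 = br (src F') (src F) & (F^-1 * F') 1 1 = br (tgt F) (src F')].
Proof.
by move=> dF; rewrite inv2 // !mx2E !mx2_entries /br !mxE; split; ring.
Qed.

Lemma mobius_vertical g t u : \det g = 1 ->
  mobius g (0 +i* expR u) = 0 +i* expR t <->
  g 0 0 * g 1 0 * expR u ^+ 2 + g 0 1 * g 1 1 = 0 /\
  expR u = expR t * (g 1 1 ^+ 2 + g 1 0 ^+ 2 * expR u ^+ 2).
Proof.
move=> dg; have u0 : 0 < Im (0 +i* expR u) by exact: expR_gt0.
have := mobius_den_gt0 dg u0; rewrite mobiusE // /mobius_den /=.
rewrite !mulr0 !add0r; set N := _ + _ => N0.
have NE : g 1 1 ^+ 2 + g 1 0 ^+ 2 * expR u ^+ 2 = N by rewrite /N exprMn.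
rewrite NE; have Nn := lt0r_neq0 N0; split=> [[h1 h2]|[h1 h2]].
  split; last by rewrite -h2 divfK.
  by move: h1 => /(canRL (divfK Nn)); rewrite mul0r addrC.
by rewrite addrC h1 mul0r h2 mulfK.
Qed.

Lemma expR_half_ln (x : R) : 0 < x -> expR (ln x / 2) ^+ 2 = x.
Proof.
by move=> x0; rewrite expr2 -expRD -splitr lnK.
Qed.

Lemma hline_eq F F' t u : \det F = 1 -> \det F' = 1 ->
  hline F t = hline F' u <-> mobius (F^-1 * F') (0 +i* expR u) = 0 +i* expR t.
Proof.
move=> dF dF'; have u0 : 0 < Im (0 +i* expR u) by exact: expR_gt0.
have t0 : 0 < Im (0 +i* expR t) by exact: expR_gt0.
rewrite /hline mobiusM ?det_inv2 //; split=> [<-|<-]; first by rewrite mobiusK.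
by rewrite mobiusVK // mobius_Im_gt0.
Qed.

Lemma hline_meet F F' t u : \det F = 1 -> \det F' = 1 -> hline F t = hline F' u ->
  br (tgt F') (src F) * br (tgt F) (tgt F') * expR u ^+ 2 +
  br (src F') (src F) * br (tgt F) (src F') = 0.
Proof.
move=> dF dF' /(hline_eq _ _ dF dF'); have [e1 e2 e3 e4] := frame_change F' dF.
by move/mobius_vertical; rewrite det_mul2 ?det_inv2 // e1 e2 e3 e4 => -[].
Qed.

(** When the ends are linked, the two products in the equation of [hline_meet]
have opposite signs, so that it can be solved for the parameter. *)
Lemma linked_meet F F' : \det F = 1 -> \det F' = 1 ->
  linked (tgt F) (src F) (tgt F') (src F') -> exists t u, hline F t = hline F' u.
Proof.
move=> dF dF'; rewrite /linked => lk.
have [e1 e2 e3 e4] := frame_change F' dF.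
pose M := F^-1 * F'; have dM : \det M = 1 by rewrite det_mul2 ?det_inv2.
have ac : (M 0 0 * M 1 0) * (M 0 1 * M 1 1) < 0.
  rewrite e1 e2 e3 e4; move: lk; congr (_ < _).
  by rewrite (brC (src F') (src F)) (brC (tgt F) (src F')); ring.
have ac0 : M 0 0 * M 1 0 != 0 by apply: contraTneq ac => ->; rewrite mul0r ltxx.
pose v := - (M 0 1 * M 1 1) / (M 0 0 * M 1 0).
have v0 : 0 < v.
  rewrite /v; move: ac0 ac; move: (M 0 0 * M 1 0) (M 0 1 * M 1 1) => Y X Y0 YX.
  have Y2 : 0 < Y ^+ 2 by rewrite exprn_even_gt0.
  rewrite -(pmulr_rgt0 _ Y2) (_ : Y ^+ 2 * (- X / Y) = - (Y * X)) ?oppr_gt0 //.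
  by field.
pose u := ln v / 2; have Eu := expR_half_ln v0.
pose w := expR u / (M 1 1 ^+ 2 + M 1 0 ^+ 2 * expR u ^+ 2).
have N0 : 0 < M 1 1 ^+ 2 + M 1 0 ^+ 2 * expR u ^+ 2.
  rewrite ltr_wpDl ?sqr_ge0 // mulr_gt0 //; last by rewrite exprn_gt0 ?expR_gt0.
  by rewrite exprn_even_gt0 //=; apply: contraNneq ac0 => ->; rewrite mulr0.
have w0 : 0 < w by rewrite divr_gt0 ?expR_gt0.
exists (ln w), u; apply/hline_eq => //; apply/mobius_vertical => //; rewrite lnK ?posrE //.
split; last by rewrite /w divfK // lt0r_neq0.
by rewrite Eu /v mulrC divfK // addNr.
Qed.

(** The equation of [hline_meet] is affine in expR u ^+ 2; if it has two
solutions, then both of its coefficients vanish. *)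
Lemma two_points_axis F F' t t' u u' : \det F = 1 -> \det F' = 1 -> u != u' ->
  hline F t = hline F' u -> hline F t' = hline F' u' ->
  (br (tgt F) (tgt F') = 0 /\ br (src F) (src F') = 0) \/
  (br (tgt F) (src F') = 0 /\ br (src F) (tgt F') = 0).
Proof.
move=> dF dF' uu' /(hline_meet dF dF') h1 /(hline_meet dF dF') h2.
have [e1 e2 e3 e4] := frame_change F' dF.
have dM : \det (F^-1 * F') = 1 by rewrite det_mul2 ?det_inv2.
rewrite det2 e1 e2 e3 e4 in dM.
move: h1 h2 dM; rewrite (brC (src F) (tgt F')) (brC (src F) (src F')).
set a := br (src F) (tgt F'); set c := br (tgt F) (tgt F').
set b := br (src F) (src F'); set d := br (tgt F) (src F').
move=> h1 h2 dM.
have ne : expR u ^+ 2 - expR u' ^+ 2 != 0.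
  rewrite subr_eq0 eqrXn2 ?expR_ge0 //; by apply: contra uu' => /eqP/expR_inj/eqP.
have ac : a * c = 0.
  have : a * c * (expR u ^+ 2 - expR u' ^+ 2) == 0.
    by apply/eqP; transitivity ((- a * c * expR u' ^+ 2 + - b * d) - (- a * c * expR u ^+ 2 + - b * d));
      [ring | rewrite h1 h2 subrr].
  by rewrite mulf_eq0 (negPf ne) orbF => /eqP.
have bd : b * d = 0.
  by move: h1; rewrite mulNr ac oppr0 mul0r add0r mulNr => /eqP; rewrite oppr_eq0 => /eqP.
move/eqP: ac; rewrite mulf_eq0 => /orP[]/eqP z.
  right; split=> //; move/eqP: bd; rewrite mulf_eq0 => /orP[]/eqP // b0.
  by move/eqP: dM; rewrite z b0 !oppr0 !mul0r subr0 eq_sym oner_eq0.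
left; split=> //; move/eqP: bd; rewrite mulf_eq0 => /orP[]/eqP // d0.
by move/eqP: dM; rewrite z d0 !mulr0 subr0 eq_sym oner_eq0.
Qed.

Lemma same_ends_hline F F' : \det F = 1 -> \det F' = 1 ->
  (br (tgt F) (tgt F') = 0 /\ br (src F) (src F') = 0) \/
  (br (tgt F) (src F') = 0 /\ br (src F) (tgt F') = 0) ->
  exists e k : R, e ^+ 2 = 1 /\ forall u, hline F' u = hline F (e * u + k).
Proof.
move=> dF dF' ends.
have [e1 e2 e3 e4] := frame_change F' dF.
have dM : \det (F^-1 * F') = 1 by rewrite det_mul2 ?det_inv2.
have dM' := dM; rewrite det2 in dM'.
case: ends => -[h1 h2].
  have b0 : (F^-1 * F') 0 1 = 0 by rewrite e3 brC h2 oppr0.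
  have c0 : (F^-1 * F') 1 0 = 0 by rewrite e2 h1.
  rewrite b0 mul0r subr0 in dM'.
  have d0 : (F^-1 * F') 1 1 != 0 by apply: contra_eq_neq dM' => ->; rewrite mulr0 eq_sym oner_eq0.
  exists 1, (- ln ((F^-1 * F') 1 1 ^+ 2)); split; first by rewrite expr1n.
  move=> u; apply/esym/hline_eq => //; apply/mobius_vertical => //; split.
    by rewrite b0 c0 mulr0 !mul0r addr0.
  rewrite c0 expr0n mul0r addr0 mul1r expRD expRN lnK ?posrE ?exprn_even_gt0 //.
  by rewrite mulfVK // expf_neq0.
have a0 : (F^-1 * F') 0 0 = 0 by rewrite e1 brC h2 oppr0.
have d0 : (F^-1 * F') 1 1 = 0 by rewrite e4 h1.
rewrite a0 mul0r sub0r in dM'.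
have c0 : (F^-1 * F') 1 0 != 0.
  by apply: contra_eq_neq dM' => ->; rewrite mulr0 oppr0 eq_sym oner_eq0.
exists (-1), (- ln ((F^-1 * F') 1 0 ^+ 2)); split; first by rewrite sqrrN expr1n.
move=> u; apply/esym/hline_eq => //; apply/mobius_vertical => //; split.
  by rewrite a0 d0 mulr0 !mul0r addr0.
rewrite d0 expr0n add0r mulN1r expRD !expRN lnK ?posrE ?exprn_even_gt0 //.
by field; rewrite c0 expR_eq0.
Qed.

(** Two geodesics with two common points have the same ends, so that g
preserves the ends of F as soon as it shifts two points by l. *)
Lemma hyperbolic_ends g F (l t u : R) : \det g = 1 -> \det F = 1 -> t != u ->
  mobius g (hline F t) = hline F (t + l) -> mobius g (hline F u) = hline F (u + l) ->
  exists2 m : R, m ^+ 2 = expR l & g *m tgt F = m *: tgt F /\ g *m src F = m^-1 *: src F.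
Proof.
move=> dg dF tu; rewrite -!hlineM // => /esym h0 /esym h1.
have dgF := det_mul2 dg dF.
have ends := two_points_axis dF dgF tu h0 h1.
move: h0 h1 => /(hline_eq _ _ dF dgF) + /(hline_eq _ _ dF dgF).
set M := F^-1 * (g * F) => /mobius_vertical h0 /mobius_vertical h1.
have dM : \det M = 1 by rewrite det_mul2 ?det_inv2.
have {h0} [_ h0] := h0 dM; have {h1} [_ h1] := h1 dM.
have one v : expR v = expR (v + l) * (M 1 1 ^+ 2 + M 1 0 ^+ 2 * expR v ^+ 2) ->
    1 = expR l * (M 1 1 ^+ 2 + M 1 0 ^+ 2 * expR v ^+ 2).
  move=> h; apply: (mulfI (lt0r_neq0 (expR_gt0 v))); rewrite mulr1 [LHS]h expRD; ring.
have {}h0 := one _ h0; have {}h1 := one _ h1.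
have [e1 e2 e3 e4] := frame_change (g * F) dF; rewrite -/M in e1 e2 e3 e4.
have c0 : M 1 0 = 0.
  have : expR l * (M 1 0 ^+ 2 * (expR t ^+ 2 - expR u ^+ 2)) == 0.
    by apply/eqP; transitivity (expR l * (M 1 1 ^+ 2 + M 1 0 ^+ 2 * expR t ^+ 2) -
      expR l * (M 1 1 ^+ 2 + M 1 0 ^+ 2 * expR u ^+ 2)); [ring | rewrite -h1 -h0 subrr].
  rewrite mulf_eq0 expR_eq0 /= mulf_eq0 sqrf_eq0 => /orP[/eqP //|].
  rewrite subr_eq0 eqrXn2 ?expR_ge0 // => /eqP/expR_inj tu'.
  by rewrite tu' eqxx in tu.
rewrite c0 expr0n mul0r addr0 in h0.
have F0 : br (tgt F) (src F) = 1 by rewrite br_frame.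
have dM' := dM; rewrite det2 c0 mulr0 subr0 in dM'.
have a0 : M 0 0 != 0 by apply: contra_eq_neq dM' => ->; rewrite mul0r eq_sym oner_eq0.
have b0 : M 0 1 = 0.
  case: ends => -[E2 E3]; first by rewrite e3 brC E3 oppr0.
  by move/eqP: a0; rewrite e1 brC E3 oppr0.
have d0 : M 1 1 = (M 0 0)^-1 by apply: (mulfI a0); rewrite dM' divff.
exists (M 0 0).
  move: h0; rewrite d0 exprVn => h0.
  by apply: (mulIf (invr_neq0 (expf_neq0 2 a0))); rewrite -h0 divff // expf_neq0.
have dec (w : 'cV[R]_2) : w = br w (src F) *: tgt F + br (tgt F) w *: src F.
  by rewrite -br_decomp F0 scale1r.
split.
  by rewrite -tgtM [LHS]dec -e1 -e2 c0 scale0r addr0.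
by rewrite -srcM [LHS]dec -e3 -e4 b0 d0 scale0r add0r.
Qed.

Lemma ends_hyperbolic g F (m : R) : \det g = 1 -> \det F = 1 -> m != 0 ->
  g *m tgt F = m *: tgt F -> g *m src F = m^-1 *: src F ->
  forall t, mobius g (hline F t) = hline F (t + ln (m ^+ 2)).
Proof.
move=> dg dF m0 gp gn t; rewrite -hlineM //; apply/esym/hline_eq; rewrite ?det_mul2 //.
have [] := frame_change (g * F) dF; rewrite !tgtM !srcM gp gn !brZl !brZr !br0 !mulr0.
rewrite br_frame dF !mulr1 => e1 e2 e3 e4.
apply/mobius_vertical; first by rewrite !det_mul2 ?det_inv2.
rewrite e1 e2 e3 e4 !mulr0 !mul0r addr0 expr0n mul0r addr0; split=> //.
by rewrite expRD lnK ?posrE ?exprn_even_gt0 // exprVn mulfK // expf_neq0.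
Qed.

Lemma frame_exists (p n : 'cV[R]_2) : br p n != 0 ->
  exists2 F, \det F = 1 & tgt F = (br p n)^-1 *: p /\ src F = n.
Proof.
move=> pn; exists (mx2 (p 0 0 / br p n) (n 0 0) (p 1 0 / br p n) (n 1 0)).
  by rewrite det2 !mx2_entries; move: pn; rewrite /br => pn; field.
by split; apply: cv2P; rewrite !mxE //= mulrC.
Qed.

Lemma hyperbolic_axis g : \det g = 1 -> 2 < \tr g ->
  exists F (l : R), [/\ \det F = 1, 0 < l, \tr g = 2 * cosh (l / 2),
    g *m tgt F = expR (l / 2) *: tgt F & g *m src F = (expR (l / 2))^-1 *: src F].
Proof.
move=> dg tg; set x := \tr g in tg *; pose s := Num.sqrt (x ^+ 2 - 4).
have s2 : s ^+ 2 = x ^+ 2 - 4 by rewrite sqr_sqrtr //; nra.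
have s0 : 0 <= s by exact: sqrtr_ge0.
pose m := (x + s) / 2.
have m1 : 1 < m by rewrite /m; lra.
have m0 : 0 < m by lra.
have mV : m^-1 = (x - s) / 2.
  apply: (mulfI (lt0r_neq0 m0)); rewrite divff ?lt0r_neq0 // /m.
  by transitivity ((x ^+ 2 - s ^+ 2) / 4); [rewrite s2; field | field].
have e1 : m ^+ 2 - x * m + 1 = 0.
  by transitivity ((s ^+ 2 - (x ^+ 2 - 4)) / 4); [rewrite /m; field | rewrite s2 subrr mul0r].
have e2 : m^-1 ^+ 2 - x * m^-1 + 1 = 0.
  by rewrite mV; transitivity ((s ^+ 2 - (x ^+ 2 - 4)) / 4); [field | rewrite s2 subrr mul0r].
have [p p0 gp] := eigen2 dg e1; have [n n0 gn] := eigen2 dg e2.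
have pn : br p n != 0.
  apply/eqP => /(br_eq0P p0)[c nE].
  have : (m - m^-1) *: n == 0.
    by rewrite scalerBl -gn nE -scalemxAr gp !scalerA mulrC subrr.
  rewrite scaler_eq0 (negPf n0) orbF subr_eq0 => /eqP mm.
  have mm1 : m * m = 1 by rewrite {2}mm divff // lt0r_neq0.
  by nra.
have [F dF [Fp Fn]] := frame_exists pn.
have lE : expR (2 * ln m / 2) = m by rewrite mulrC mulKf // lnK.
exists F, (2 * ln m); rewrite lE; split=> //.
- by rewrite mulr_gt0 // ln_gt0.
- by rewrite coshE lE mV /m; field.
- by rewrite Fp -scalemxAr gp !scalerA mulrC.
- by rewrite Fn gn.
Qed.
End Axes.

(** * Closed geodesics of the quotient *)

Section Strip.
Variable R : realType.
Variables A B : 'M[R]_2.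
Hypotheses (dA : \det A = 1) (dB : \det B = 1).
Local Notation ev := (eval_letter A B).
Local Notation eval := (eval_word A B).

(** To be used when the letter k preserves a set: its powers at both ends of a
word can then be disregarded. *)
Lemma strip_powers (k : letter) w : exists v1 u v2,
  [/\ all (fun x => x.1 == k.1) v1, all (fun x => x.1 == k.1) v2,
      eval w = eval v1 * eval u * eval v2 &
      u = [::] \/ exists x s, [/\ u = x :: s, path adj x s, x.1 != k.1
        & (last x s).1 != k.1]].
Proof.
have [n] := ubnP (size w); elim: n w => // n IH w; rewrite ltnS => sw.
have [w1 [rw ew _ _ s1]] := reduce dA dB w.
have {}s1 := leq_trans s1 sw.
case: w1 rw ew s1 => [|x s] rw ew s1.
  by exists [::], [::], [::]; split=> //; [rewrite -ew !eval_nil !mulr1 | left].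
have [xk|xk] := boolP (x.1 == k.1).
  have [v1 [u [v2 [h1 h2 h3 h4]]]] := IH s s1.
  exists (x :: v1), u, v2; split=> //=; first by rewrite xk.
  by rewrite -ew !eval_cons h3 !mulrA.
have [lk|lk] := boolP ((last x s).1 == k.1); last first.
  by exists [::], (x :: s), [::]; rewrite -ew eval_nil mulr1 mul1r; split=> //; right; exists x, s.
case: (lastP s) lk s1 ew rw => [|t y]; first by rewrite /= (negPf xk).
rewrite last_rcons => yk s1 ew rw.
have [|v1 [u [v2 [h1 h2 h3 h4]]]] := IH (x :: t).
  by apply: leq_trans s1; rewrite /= size_rcons.
exists v1, u, (rcons v2 y); split=> //=; first by rewrite all_rcons yk.
by rewrite -ew -rcons_cons !eval_rcons h3 !mulrA.
Qed.
End Strip.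

Section Torus.
Variable R : realType.
Variables A0 B0 : 'M[R]_2.
Hypotheses (dA0 : \det A0 = 1) (dB0 : \det B0 = 1).
Hypothesis discrete : forall z, upper_half_plane z ->
  exists2 r : R, 0 < r & forall w : word, reduced w -> w != [::] ->
      r <= hdist z (mobius (eval_word A0 B0 w) z).
Local Notation G := (generated2 A0 B0).
Local Notation proj := (@Defs.proj R).
Notation Im := complex.Im.
Implicit Types F g h : 'M[R]_2.

Lemma G_word w : G (eval_word A0 B0 w). Proof. by exists w. Qed.
Lemma G_1 : G 1. Proof. by exists [::] => //; exact: eval_nil. Qed.
Lemma G_M g h : G g -> G h -> G (g * h).
Proof. by case=> w1 _ <- [w2 _ <-]; exists (w1 ++ w2) => //; exact: eval_cat. Qed.
Lemma G_V g : G g -> G g^-1.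
Proof. by case=> w _ <-; exists (winv w) => //; exact: eval_winv. Qed.
Lemma G_det g : G g -> \det g = 1.
Proof. by case=> w _ <-; exact: det_eval. Qed.
Lemma G_X g n : G g -> G (g ^+ n).
Proof. by move=> Gg; elim: n => [|n IH]; [exact: G_1 | rewrite exprS; exact: G_M]. Qed.
Lemma G_Xz g (k : int) : G g -> G (g ^ k).
Proof. by move=> Gg; case: k => n; [exact: G_X | rewrite NegzE -exprnN; apply: G_V; exact: G_X]. Qed.

Lemma hdist0 (z : R[i]) : 0 < Im z -> hdist z z = 0.
Proof.
move=> z0; rewrite /hdist subrr /= expr0n addr0 mul0r addr0 /arcosh expr1n subrr.
by rewrite sqrtr0 addr0 ln1.
Qed.

(** A fixed point forces the reduced form of w to be empty, as the action is
free. The exponent sums do not change under reduction; their vanishing makes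
homology classes well defined. *)
Lemma eval_eq1 w z : 0 < Im z -> mobius (eval_word A0 B0 w) z = z ->
  [/\ eval_word A0 B0 w = 1, expoA w = 0 & expoB w = 0].
Proof.
move=> z0 wz; have [w' [rw ew <- <- _]] := reduce dA0 dB0 w.
have [w0|w0] := eqVneq w' [::].
  by rewrite -ew w0 eval_nil /expoA /expoB !big_nil.
have [r r0 /(_ w' rw w0)] := discrete z0.
by rewrite ew wz hdist0 // leNgt r0.
Qed.

Lemma G_free g z : G g -> 0 < Im z -> mobius g z = z -> g = 1.
Proof. by case=> w _ <- z0 /(eval_eq1 z0) []. Qed.

Lemma G_discrete z : 0 < Im z -> exists2 r : R, 0 < r &
  forall g, G g -> g <> 1 -> r <= hdist z (mobius g z).
Proof.
move=> z0; have [r r0 hr] := discrete z0; exists r => // g [w _ <-] w1.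
have [w' [rw ew _ _ _]] := reduce dA0 dB0 w.
rewrite -ew; apply: hr => //; apply/eqP => w0; apply: w1.
by rewrite -ew w0 eval_nil.
Qed.

Lemma proj_refl z : proj G z z.
Proof. by exists 1; [exact: G_1 | exact: mobius1]. Qed.

Lemma proj_G g z : G g -> 0 < Im z -> proj G (mobius g z) = proj G z.
Proof.
move=> Gg z0; have dg := G_det Gg; apply/seteqP; split=> x [h Gh <-].
  by exists (h * g); [exact: G_M | rewrite mobiusM // G_det].
exists (h * g^-1); first by apply: G_M => //; exact: G_V.
by rewrite mobiusM ?det_inv2 ?G_det // ?mobiusK // mobius_Im_gt0.
Qed.

Lemma proj_eqP z w : 0 < Im z -> 0 < Im w ->
  proj G z = proj G w <-> exists2 g, G g & mobius g z = w.
Proof.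
move=> z0 w0; split=> [e|[g Gg <-]]; last by rewrite proj_G.
by have := proj_refl w; rewrite -e => -[g Gg <-]; exists g.
Qed.

(** The axis of h projects to a simple closed geodesic, h being primitive:
only the powers of h bring two points of the axis together. *)
Definition simple_axis F h (l : R) :=
  [/\ G h, 0 < l, forall t, mobius h (hline F t) = hline F (t + l) &
   forall g t u, G g -> mobius g (hline F t) = hline F u ->
     exists k : int, u = t + k%:~R * l].

Lemma det_exp2 g n : \det g = 1 -> \det (g ^+ n) = 1.
Proof. by move=> dg; elim: n => [|n IH]; rewrite ?expr0 ?det1 // exprS det_mul2. Qed.

Lemma hline_inj F t u : \det F = 1 -> hline F t = hline F u -> t = u.
Proof.
move=> dF e; have [_ /(_ t u)] := hline_geodesic dF.
by rewrite e hdist0 ?hline_Im // => /esym/eqP; rewrite normr_eq0 subr_eq0 => /eqP.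
Qed.

Lemma axis_power F h (l : R) : \det F = 1 -> \det h = 1 ->
  (forall t, mobius h (hline F t) = hline F (t + l)) ->
  forall (k : int) t, mobius (h ^ k) (hline F t) = hline F (t + k%:~R * l).
Proof.
move=> dF dh hl.
have pos n t : mobius (h ^+ n) (hline F t) = hline F (t + n%:R * l).
  elim: n t => [|n IH] t; first by rewrite expr0 mobius1 mul0r addr0.
  rewrite exprSr mobiusM ?hl ?IH ?hline_Im //; last by exact: det_exp2.
  by rewrite -addrA -(natr1 n) mulrDl mul1r (addrC l).
case=> n t; first exact: pos.
have dn : \det (h ^+ n.+1) = 1 by exact: det_exp2.
rewrite NegzE -exprnN.
rewrite -[hline F (t + _)](mobiusK dn) ?hline_Im // pos; congr (mobius _ (hline _ _)).
by rewrite mulrNz mulNr addrNK.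
Qed.

(** As the action is free, g is determined by what it does to one point. *)
Lemma simple_axis_power F h (l : R) g t u : \det F = 1 -> simple_axis F h l -> G g ->
  mobius g (hline F t) = hline F u ->
  exists2 k : int, u = t + k%:~R * l & g = h ^ k.
Proof.
move=> dF [Gh l0 hl simp] Gg gtu; have [k uE] := simp _ _ _ Gg gtu.
exists k => //; have dh := G_det Gh; have Gk := G_Xz k Gh.
have : (h ^ k)^-1 * g = 1.
  apply: (@G_free _ (hline F t)); [by apply: G_M => //; exact: G_V | exact: hline_Im |].
  rewrite mobiusM ?det_inv2 ?(G_det Gk) ?(G_det Gg) ?hline_Im // gtu uE.
  by rewrite -(axis_power dF dh hl k t) mobiusK ?(G_det Gk) ?hline_Im.
by move/(congr1 (fun x => h ^ k * x)); rewrite mulrA divrr ?mul1r ?mulr1 // det1_unit // (G_det Gk).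
Qed.

(** For every t some element of the group moves the point of parameter t to
that of parameter t + l. The group being countable, the same element serves
two values of t, hence all of them by [hyperbolic_ends]. *)
Lemma simple_closed_geodesicP c l : simple_closed_geodesic_of_length G c l <->
  exists F h, [/\ \det F = 1, simple_axis F h l & c = shadow G (hline F)].
Proof.
split=> [[l0 [s [sg simp ->]]]|[F [h [dF [Gh l0 hl simp] ->]]]]; last first.
  split=> //; exists (hline F); split=> //; first exact: hline_geodesic.
  move=> t u; rewrite proj_eqP ?hline_Im //; split=> [[g Gg]|[k ->]]; first exact: simp.
  by exists (h ^ k); [exact: G_Xz | apply: axis_power => //; exact: G_det].
have [F dF sF] := geodesic_frame sg.
have {sF} sE : s = hline F by apply/funext.
rewrite {}sE in sg simp *.
have step t : exists w, mobius (eval_word A0 B0 w) (hline F t) = hline F (t + l).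
  have /proj_eqP : proj G (hline F t) = proj G (hline F (t + l)).
    by apply/simp; exists 1; rewrite mul1r.
  by case; rewrite ?hline_Im // => g [w _ <-] e; exists w.
have [f fP] := choice step.
have [t [u [tu ftu]]] := countable_pigeonhole f.
pose h := eval_word A0 B0 (f t); have dh : \det h = 1 by exact: det_eval.
have hu : mobius h (hline F u) = hline F (u + l) by rewrite /h ftu.
have [m m2 [hp hn]] := hyperbolic_ends dh dF tu (fP t) hu.
have m0 : m != 0 by rewrite -sqrf_eq0 m2 expR_eq0.
have hl : forall t, mobius h (hline F t) = hline F (t + l).
  by move=> v; rewrite (ends_hyperbolic dh dF m0 hp hn) m2 expRK.
exists F, h; split=> //; split=> //; first exact: G_word.
move=> g v w Gg gvw; apply/simp; apply/proj_eqP; rewrite ?hline_Im //; by exists g.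
Qed.

Lemma simple_axis_ends F h l : \det F = 1 -> simple_axis F h l ->
  exists2 m : R, m ^+ 2 = expR l & h *m tgt F = m *: tgt F /\ h *m src F = m^-1 *: src F.
Proof.
move=> dF [Gh l0 hl _]; have ne : (0 : R) != 1 by rewrite eq_sym oner_eq0.
exact: hyperbolic_ends (G_det Gh) dF ne (hl 0) (hl 1).
Qed.

Lemma power_eigen h (u : 'cV[R]_2) m (k : int) : \det h = 1 -> m != 0 -> h *m u = m *: u ->
  exists c, h ^ k *m u = c *: u.
Proof.
move=> dh m0 hu; have pos n : h ^+ n *m u = m ^+ n *: u.
  elim: n => [|n IH]; first by rewrite !expr0 mul1mx scale1r.
  by rewrite exprS -mulmxE -mulmxA IH -scalemxAr hu scalerA exprSr.
case: k => n; first by exists (m ^+ n); exact: pos.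
have dn : \det (h ^+ n.+1) = 1 by exact: det_exp2.
exists (m ^+ n.+1)^-1; rewrite NegzE -exprnN.
rewrite -[in RHS](mulmxVK2 u dn) pos -scalemxAr scalerA mulVf ?scale1r //.
by rewrite expf_neq0.
Qed.

(** A translate with linked ends would cross the axis, so that g would be a
power of h; but these fix the ends. *)
Lemma simple_axis_unlinked F h l g : \det F = 1 -> simple_axis F h l -> G g ->
  ~ linked (tgt F) (src F) (g *m tgt F) (g *m src F).
Proof.
move=> dF sF Gg; have dg := G_det Gg; rewrite -tgtM -srcM => lk.
have [t [u]] := linked_meet dF (det_mul2 dg dF) lk.
rewrite hlineM // => /esym gut.
have [k _ gk] := simple_axis_power dF sF Gg gut.
have [m m2 [hp _]] := simple_axis_ends dF sF.
have m0 : m != 0 by rewrite -sqrf_eq0 m2 expR_eq0.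
case: sF => Gh _ _ _.
have [c ce] := power_eigen k (G_det Gh) m0 hp.
by move: lk; rewrite /linked tgtM gk ce brZr br0 mulr0 !mul0r ltxx.
Qed.

(** The group being countable, a single element brings two points of the
second geodesic to the first one, hence the whole of it. *)
Lemma shadow_eq F F' : \det F = 1 -> \det F' = 1 ->
  shadow G (hline F) = shadow G (hline F') ->
  exists g e k, [/\ G g, e ^+ 2 = 1 :> R &
    forall t, hline F' t = mobius g (hline F (e * t + k))].
Proof.
move=> dF dF' eS.
have step t : exists wu : word * R, hline F' t = mobius (eval_word A0 B0 wu.1) (hline F wu.2).
  have : shadow G (hline F) (proj G (hline F' t)) by rewrite eS; exists t.
  case=> u _ /(proj_eqP (hline_Im _ dF) (hline_Im _ dF')) [g [w _ <-] e].
  by exists (w, u).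
have [f fP] := choice step.
have [t [u [tu ftu]]] := countable_pigeonhole (fst \o f).
pose g := eval_word A0 B0 (f t).1; have Gg : G g by exact: G_word.
have dg := G_det Gg.
have e1 : hline (g * F) (f t).2 = hline F' t by rewrite fP hlineM.
have e2 : hline (g * F) (f u).2 = hline F' u by rewrite fP hlineM // /g (ftu : (f t).1 = (f u).1).
have dgF := det_mul2 dg dF.
have [e [k [ee eP]]] := same_ends_hline dgF dF' (two_points_axis dgF dF' tu e1 e2).
by exists g, e, k; split=> // v; rewrite eP hlineM.
Qed.

Lemma shadow_G g F : G g -> \det F = 1 -> shadow G (hline (g * F)) = shadow G (hline F).
Proof.
move=> Gg dF; have E t : proj G (hline (g * F) t) = proj G (hline F t).
  by rewrite hlineM ?(G_det Gg) // proj_G ?hline_Im.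
by apply/seteqP; split=> x [t _ <-]; exists t => //=; rewrite E.
Qed.

Lemma shadow_same_ends F F' : \det F = 1 -> \det F' = 1 ->
  (br (tgt F) (tgt F') = 0 /\ br (src F) (src F') = 0) \/
  (br (tgt F) (src F') = 0 /\ br (src F) (tgt F') = 0) ->
  shadow G (hline F') = shadow G (hline F).
Proof.
move=> dF dF' /(same_ends_hline dF dF') [e [k [e2 eP]]].
apply/seteqP; split=> x [t _ <-].
  by exists (e * t + k) => //=; rewrite eP.
exists (e * (t - k)) => //=; rewrite eP.
by congr (proj G (hline F _)); rewrite mulrA -expr2 e2 mul1r addrNK.
Qed.

(** The conjugate of h' preserves the axis of h, hence is a power of h. *)
Lemma shadow_eq_conj F h l F' h' l' : \det F = 1 -> \det F' = 1 ->
  simple_axis F h l -> simple_axis F' h' l' ->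
  shadow G (hline F) = shadow G (hline F') ->
  exists g (k : int), [/\ G g, g^-1 * h' * g = h ^ k &
     exists2 e : R, e ^+ 2 = 1 & l' = e * k%:~R * l].
Proof.
move=> dF dF' sF sF' /(shadow_eq dF dF')[g [e [k0 [Gg e2 eP]]]].
have [Gh' l'0 hl' _] := sF'.
have dg := G_det Gg; have dh' := G_det Gh'.
have Gc : G (g^-1 * h' * g) by apply: G_M => //; apply: G_M => //; exact: G_V.
have /(simple_axis_power dF sF Gc) : mobius (g^-1 * h' * g) (hline F k0) = hline F (k0 + e * l').
  have h0 := hl' 0; rewrite add0r !eP mulr0 add0r in h0.
  have dgi := det_inv2 dg; have dgh := det_mul2 dgi dh'.
  have I0 := hline_Im k0 dF; have I1 := mobius_Im_gt0 dg I0.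
  rewrite (mobiusM dgh dg I0) (mobiusM dgi dh' I1) h0 mobiusK ?hline_Im //.
  by rewrite addrC.
case=> k kE gE; exists g, k; split=> //; exists e => //.
move/addrI: kE => kE; by rewrite -mulrA -kE mulrA -expr2 e2 mul1r.
Qed.

(** Each of the two lengths is an integral multiple of the other one. *)
Lemma length_unique c l l' : simple_closed_geodesic_of_length G c l ->
  simple_closed_geodesic_of_length G c l' -> l = l'.
Proof.
move=> /simple_closed_geodesicP[F [h [dF sF ->]]] /simple_closed_geodesicP[F' [h' [dF' sF' e]]].
have [_ [k [_ _ [x x2 kl]]]] := shadow_eq_conj dF dF' sF sF' e.
have [_ [k' [_ _ [x' x'2 kl']]]] := shadow_eq_conj dF' dF sF' sF (esym e).
have [_ l0 _ _] := sF; have [_ l'0 _ _] := sF'.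
have le (a b : R) (y : R) (j : int) : 0 < a -> 0 < b -> y ^+ 2 = 1 -> a = y * j%:~R * b -> b <= a.
  move=> a0 b0 y2 aE.
  have aE2 : a ^+ 2 = (j ^+ 2)%:~R * b ^+ 2 by rewrite aE rmorphXn !exprMn y2 mul1r.
  have j0 : j != 0 by apply: contraTneq a0 => j0; rewrite aE j0 mulr0 mul0r ltxx.
  have j1 : (1 : R) <= (j ^+ 2)%:~R.
    by rewrite (ler_int _ 1) -gtz0_ge1 exprn_even_gt0.
  have b2a2 : b ^+ 2 <= a ^+ 2 by rewrite aE2 ler_peMl // sqr_ge0.
  by rewrite -(ler_pXn2r (n := 2)) // nnegrE ltW.
apply/le_anti/andP; split; [exact: le kl | exact: le kl'].
Qed.

Lemma geodesic_lengthE c l : simple_closed_geodesic_of_length G c l ->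
  geodesic_length G c = l.
Proof.
move=> cl; apply: length_unique (cl); rewrite /geodesic_length.
by apply: xgetPex; exists l.
Qed.
End Torus.

(** * Nielsen bases *)

Local Open Scope classical_set_scope.
Local Open Scope ring_scope.
Local Open Scope complex_scope.

Lemma markoff_gt2 (R : realFieldType) (x y z : R) : 2 < x -> 2 < y ->
  x ^+ 2 + y ^+ 2 + z ^+ 2 - x * y * z < 0 -> 2 < z.
Proof.
move=> x2 y2 h; have xy : 0 < x * y by rewrite mulr_gt0 //; lra.
have z0 : 0 < z.
  rewrite -(pmulr_rgt0 _ xy).
  have := sqr_ge0 x; have := sqr_ge0 y; have := sqr_ge0 z; lra.
rewrite ltNge; apply/negP => z2.
have h1 : x * y * z <= 2 * (x * y) by rewrite mulrC ler_wpM2r // ltW.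
have h2 := sqr_ge0 (x - y); have h3 : (x - y) ^+ 2 = x ^+ 2 + y ^+ 2 - 2 * (x * y) by ring.
have := sqr_ge0 z; lra.
Qed.

Section Nielsen.
Variable R : realType.
Variables A0 B0 : 'M[R]_2.
Hypotheses (dA0 : \det A0 = 1) (dB0 : \det B0 = 1).
Local Notation G := (generated2 A0 B0).
Implicit Types F g h X Y : 'M[R]_2.

(** The commutator that fixes the vertex (true, true) of the quadrilateral in
[config_exists]; its inverse is X Y X^-1 Y^-1. *)
Definition comm X Y : 'M[R]_2 := Y * X * Y^-1 * X^-1.

(** The bases that can be reached by these moves, all of which preserve the
commutator up to conjugation and inversion. *)
Inductive nielsen : 'M[R]_2 -> 'M[R]_2 -> Prop :=
| nielsen_refl : nielsen A0 B0
| nielsen_inv X Y : nielsen X Y -> nielsen X Y^-1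
| nielsen_left X Y : nielsen X Y -> nielsen X (X * Y)
| nielsen_right X Y : nielsen X Y -> nielsen (X * Y) Y.

Lemma nielsen_G X Y : nielsen X Y -> G X /\ G Y.
Proof.
elim=> [|{}X {}Y _ [GX GY]|{}X {}Y _ [GX GY]|{}X {}Y _ [GX GY]].
- split; first by exists [:: (true, true)] => //; exact: eval_seq1.
  by exists [:: (false, true)] => //; exact: eval_seq1.
- by split=> //; exact: G_V.
- by split=> //; exact: G_M.
- by split=> //; exact: G_M.
Qed.

Lemma nielsen_det X Y : nielsen X Y -> \det X = 1 /\ \det Y = 1.
Proof. by move/nielsen_G => [/(G_det dA0 dB0) ? /(G_det dA0 dB0)]. Qed.

Lemma generated_letters X Y X' Y' : \det X = 1 -> \det Y = 1 -> \det X' = 1 -> \det Y' = 1 ->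
  generated2 X Y X' -> generated2 X Y Y' -> generated2 X' Y' `<=` generated2 X Y.
Proof.
move=> dX dY dX' dY' hX hY g [w _ <-]; elim: w => [|x w IH].
  by rewrite eval_nil; exists [::]; rewrite ?eval_nil.
rewrite eval_cons; apply: G_M IH; rewrite /eval_letter.
by case: x => [[] []] //=; exact: (G_V dX dY).
Qed.

Lemma nielsen_gen X Y : nielsen X Y -> G `<=` generated2 X Y.
Proof.
have g1 X' Y' : generated2 X' Y' X'.
  by exists [:: (true, true)] => //; exact: eval_seq1.
have g2 X' Y' : generated2 X' Y' Y'.
  by exists [:: (false, true)] => //; exact: eval_seq1.
elim=> [//|{}X {}Y n IH|{}X {}Y n IH|{}X {}Y n IH];
  apply: subset_trans IH _; have [dX dY] := nielsen_det n;
  have dXY := det_mul2 dX dY; have dYi := det_inv2 dY.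
- apply: generated_letters => //; rewrite -{2}[Y]invrK; exact: (G_V dX dYi).
- apply: generated_letters => //.
  rewrite -{2}[Y](mulKr (det1_unit dX)); apply: G_M => //; exact: (G_V dX dXY).
- apply: generated_letters => //.
  rewrite -{2}[X](mulrK (det1_unit dY)); apply: G_M => //; exact: (G_V dXY dY).
Qed.

Lemma comm_inv X Y : \det X = 1 -> \det Y = 1 -> (comm X Y)^-1 = X * Y * X^-1 * Y^-1.
Proof.
move=> /det1_unit uX /det1_unit uY.
rewrite /comm invrM ?unitrMl ?unitrV ?uX ?uY // invrK invrM ?unitrMl ?unitrV ?uX ?uY //.
by rewrite invrK invrM // !mulrA.
Qed.

Lemma inv_conj g h : \det g = 1 -> \det h = 1 -> (g * h * g^-1)^-1 = g * h^-1 * g^-1.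
Proof.
move=> dg dh; have ug := det1_unit dg; have uh := det1_unit dh.
have u : g * h * g^-1 \is a GRing.unit by rewrite det1_unit // !det_mul2 ?det_inv2.
by apply: (mulrI u); rewrite divrr // !mulrA mulrVK // mulrK // divrr.
Qed.

Lemma nielsen_comm X Y : nielsen X Y -> exists2 c, G c &
  comm X Y = c * comm A0 B0 * c^-1 \/ comm X Y = c * (comm A0 B0)^-1 * c^-1.
Proof.
elim=> [|{}X {}Y n [c Gc IH]|{}X {}Y n [c Gc IH]|{}X {}Y n [c Gc IH]].
- by exists 1; [exact: G_1 | left; rewrite invr1 mulr1 mul1r].
- have [GX GY] := nielsen_G n; have [dX dY] := nielsen_det n.
  have uY := det1_unit dY; have uX := det1_unit dX; have uc := det1_unit (G_det dA0 dB0 Gc).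
  have dK0 : comm A0 B0 \is a GRing.unit by rewrite det1_unit // !det_mul2 ?det_inv2.
  exists (Y^-1 * c); first by apply: G_M => //; exact: G_V.
  have -> : comm X Y^-1 = Y^-1 * (comm X Y)^-1 * Y.
    by rewrite comm_inv // /comm invrK !mulrA mulrVK.
  rewrite invrM ?unitrV // invrK.
  have dK1 : \det (comm A0 B0) = 1 by rewrite !det_mul2 ?det_inv2.
  case: IH => ->; [right|left]; rewrite inv_conj ?det_inv2 ?(G_det dA0 dB0 Gc) //.
    by rewrite !mulrA.
  by rewrite invrK !mulrA.
- have [GX GY] := nielsen_G n; have [dX dY] := nielsen_det n.
  have uY := det1_unit dY; have uX := det1_unit dX; have uc := det1_unit (G_det dA0 dB0 Gc).
  exists (X * c); first exact: G_M.
  have -> : comm X (X * Y) = X * comm X Y * X^-1 by rewrite /comm invrM // !mulrA.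
  rewrite invrM //.
  by case: IH => ->; [left|right]; rewrite !mulrA.
- have [GX GY] := nielsen_G n; have [dX dY] := nielsen_det n.
  have uY := det1_unit dY; have uX := det1_unit dX.
  exists c => //; rewrite (_ : comm (X * Y) Y = comm X Y) //.
  by rewrite /comm invrM // !mulrA mulrK.
Qed.

Hypothesis trK : \tr (comm A0 B0) < -2.

Lemma nielsen_trK X Y : nielsen X Y -> \tr (comm X Y) = \tr (comm A0 B0).
Proof.
move=> /nielsen_comm[c Gc]; have dc := G_det dA0 dB0 Gc.
case=> ->; rewrite tr_conj // tr_inv // !det_mul2 ?det_inv2 //.
Qed.

Lemma tr_commE X Y : \det X = 1 -> \det Y = 1 -> \tr (comm X Y) + 2 =
  \tr X ^+ 2 + \tr Y ^+ 2 + \tr (X * Y) ^+ 2 - \tr X * \tr Y * \tr (X * Y).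
Proof. by move=> dX dY; rewrite /comm tr_comm // (tr_mulC Y X); ring. Qed.

Hypotheses (trA0 : 2 < \tr A0) (trB0 : 2 < \tr B0).

Lemma nielsen_markoff X Y : nielsen X Y ->
  \tr X ^+ 2 + \tr Y ^+ 2 + \tr (X * Y) ^+ 2 - \tr X * \tr Y * \tr (X * Y) =
  \tr (comm A0 B0) + 2.
Proof.
by move=> n; have [dX dY] := nielsen_det n; rewrite -(nielsen_trK n) tr_commE.
Qed.

Lemma nielsen_tr_head X Y : nielsen X Y -> 2 < \tr X -> 2 < \tr Y -> 2 < \tr (X * Y).
Proof.
move=> n x2 y2; apply: markoff_gt2 x2 y2 _; by rewrite nielsen_markoff // -ltrBrDr sub0r.
Qed.

Lemma nielsen_tr X Y : nielsen X Y -> 2 < \tr X /\ 2 < \tr Y.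
Proof.
elim=> [|{}X {}Y n [x2 y2]|{}X {}Y n [x2 y2]|{}X {}Y n [x2 y2]]; first by [].
- by have [dX dY] := nielsen_det n; rewrite tr_inv.
- by split=> //; exact: nielsen_tr_head.
- by split=> //; exact: nielsen_tr_head.
Qed.

(** Strip powers of k on both sides from an element g that is not a power of
k. The remaining word begins and ends with letters of the other generator, so
that by ping-pong it sends both ends of the axis behind a single side of that
generator. By [letter_axis_side] these images are not separated by the ends of
the axis, and the translate does not meet it. *)
Lemma simple_letter X Y (k : letter) F (l : R) : nielsen X Y -> \det F = 1 -> 0 < l ->
  eval_letter X Y k *m tgt F = expR (l / 2) *: tgt F ->
  eval_letter X Y k *m src F = (expR (l / 2))^-1 *: src F ->
  simple_axis A0 B0 F (eval_letter X Y k) l.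
Proof.
move=> n dF l0 kp kn; have [dX dY] := nielsen_det n; have [GX GY] := nielsen_G n.
have dk := det_ev dX dY k.
have [e [W [cW _ _]]] : exists e W, [/\ config X Y e W,
    (forall y, exists w, W y = eval_word X Y w *m W (true, true)) &
    exists a : R, (Y * X * Y^-1 * X^-1) *m W (true, true) = a *: W (true, true)].
  by apply: config_exists => //; have := nielsen_trK n; rewrite /comm => ->.
have m0 : expR (l / 2) != 0 by rewrite gt_eqF ?expR_gt0.
have m1 : 1 < expR (l / 2) by rewrite expR_gt1 divr_gt0.
have kl t : mobius (eval_letter X Y k) (hline F t) = hline F (t + l).
  by rewrite (ends_hyperbolic dk dF m0 kp kn) -expRM_natr expRK divfK.
have Gk : G (eval_letter X Y k).
  by rewrite /eval_letter; case: (k) => [[] []] //=; exact: G_V.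
have F1 : br (tgt F) (src F) != 0 by rewrite br_frame dF oner_eq0.
have p0 : tgt F != 0.
  by apply: contraNneq F1 => ->; rewrite /br !mxE !mul0r subrr.
have n0 : src F != 0.
  by apply: contraNneq F1 => ->; rewrite /br !mxE !mulr0 subrr.
have ends : (inI e W k (tgt F) /\ inI e W (linv k) (src F)) \/
            (inI e W k (src F) /\ inI e W (linv k) (tgt F)).
  apply: (@ends_of_cyc_reduced _ X Y dX dY e W cW k [::] _ _ (expR (l / 2)) (expR (l / 2))^-1).
  - by rewrite /cyc_reduced /= /adj andbT; case: (k) => [[] []].
  - by [].
  - by rewrite eval_seq1.
  - by rewrite eval_seq1.
  - by rewrite divff.
  - by rewrite gt_eqF // exprn_egt1.
  - by move=> y; exact: (letter_not_vertex dX dY cW (k := k) _ p0 kp).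
  - by move=> y; exact: (letter_not_vertex dX dY cW (k := k) _ n0 kn).
split=> // g t u Gg gtu.
have powers v : all (fun x => x.1 == k.1) v -> exists z : int, forall t,
    mobius (eval_word X Y v) (hline F t) = hline F (t + z%:~R * l).
  elim: v => [_|x v IH /= /andP[xk /IH [z hz]]].
    by exists 0 => t0; rewrite eval_nil mobius1 mul0r addr0.
  have dx := det_ev dX dY x.
  have [z1 hz1] : exists z1 : int, forall t, mobius (eval_letter X Y x) (hline F t) = hline F (t + z1%:~R * l).
    have [->|xk'] := eqVneq x k; first by exists 1 => t0; rewrite kl mul1r.
    have -> : x = linv k by move: xk xk'; case: (x) => [[] []]; case: (k) => [[] []].
    exists (-1) => t0; have := kl (t0 - l); rewrite subrK => <-.
    by rewrite ev_linv mobiusK ?hline_Im // mulrN1z mulN1r.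
  exists (z + z1) => t0; rewrite eval_cons mobiusM ?hline_Im ?det_eval //.
  by rewrite hz hz1 intrD mulrDl addrA.
have [w _ wE] := nielsen_gen n Gg.
have [v1 [u' [v2 [/powers [z1 hz1] /powers [z2 hz2] wE' hu']]]] := strip_powers dX dY k w.
have du' := det_eval dX dY u'; have dv1 := det_eval dX dY v1; have dv2 := det_eval dX dY v2.
have move_u : mobius (eval_word X Y u') (hline F (t + z2%:~R * l)) = hline F (u - z1%:~R * l).
  have It := hline_Im (t + z2%:~R * l) dF.
  have IU := mobius_Im_gt0 du' It.
  have IV := hline_Im t dF.
  move: gtu; rewrite -wE wE' (mobiusM (det_mul2 dv1 du') dv2 IV) hz2 (mobiusM dv1 du' It).
  have := hz1 (u - z1%:~R * l); rewrite subrK => <- /(congr1 (mobius (eval_word X Y v1)^-1)).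
  by rewrite (mobiusK dv1 IU) (mobiusK dv1 (hline_Im _ dF)).
case: hu' => [u0|[x [s [u'E ps xk lk]]]].
  move: move_u; rewrite u0 eval_nil mobius1 => /(hline_inj dF) h.
  exists (z1 + z2); rewrite intrD mulrDl; lra.
exfalso; have guF := det_mul2 du' dF.
have := hline_meet dF guF (esym _ : hline F (u - z1%:~R * l) = hline (eval_word X Y u' * F) (t + z2%:~R * l)).
rewrite hlineM // move_u => /(_ erefl); rewrite tgtM srcM.
set p := tgt F; set q := src F; set p' := _ *m p; set q' := _ *m q.
set E := expR _ => meet.
have pos : 0 < br p p' * br p' q * br q q' * br q' p.
  have mapk y v : y.1 = k.1 -> inI e W y v -> inI e W x (eval_word X Y u' *m v).
    move=> yk vy; rewrite u'E; apply: (word_map dX dY cW ps _ vy).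
    by apply: contra lk => /eqP yl; rewrite -yk yl.
  case: ends => -[h1 h2].
    by apply: (letter_axis_side cW xk h1 h2); [exact: mapk h1 | exact: mapk h2].
  have := letter_axis_side cW xk h1 h2 (mapk _ _ _ h1) (mapk _ _ _ h2).
  rewrite -/p -/q -/p' -/q' => /(_ erefl erefl).
  by congr (_ < _); ring.
have E2 : 0 <= E ^+ 2 by exact: sqr_ge0.
move: meet pos; rewrite (brC q' q) (brC p q').
set X1 := br p' q; set X2 := br p p'; set X3 := br q' q; set X4 := br p q' => meet pos.
have : X3 * X4 = - (X1 * X2 * E ^+ 2) by lra.
move=> h34; have h5 := mulr_ge0 E2 (sqr_ge0 (X1 * X2)).
move: pos; have -> : X2 * X1 * - X3 * - X4 = - (E ^+ 2 * (X1 * X2) ^+ 2).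
  by transitivity (X1 * X2 * (X3 * X4)); [ring | rewrite h34; ring].
by rewrite oppr_gt0 ltNge h5.
Qed.

Lemma simple_generator X Y (b : bool) : nielsen X Y ->
  exists F l, [/\ \det F = 1, simple_axis A0 B0 F (if b then X else Y) l &
    \tr (if b then X else Y) = 2 * cosh (l / 2)].
Proof.
move=> n; have [dX dY] := nielsen_det n; have [x2 y2] := nielsen_tr n.
have [F [l [dF l0 trE hp hn]]] : exists F (l : R), [/\ \det F = 1, 0 < l,
    \tr (eval_letter X Y (b, true)) = 2 * cosh (l / 2),
    eval_letter X Y (b, true) *m tgt F = expR (l / 2) *: tgt F &
    eval_letter X Y (b, true) *m src F = (expR (l / 2))^-1 *: src F].
  by apply: hyperbolic_axis; rewrite /eval_letter; case: (b).
exists F, l; split=> //.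
rewrite -[if b then X else Y]/(eval_letter X Y (b, true)).
exact: simple_letter.
Qed.
End Nielsen.

(** * Cyclic words *)

Section CyclicWords.
Variable T : Type.
Implicit Types (r : rel T) (w : seq T).

Lemma not_path r x p : ~~ path r x p ->
  exists p1 y z p2, x :: p = p1 ++ y :: z :: p2 /\ ~~ r y z.
Proof.
elim: p x => // y p IH x /=; rewrite negb_and => /orP[xy|/IH].
  by exists [::], x, y, p.
by move=> [p1 [y' [z [p2 [-> h]]]]]; exists (x :: p1), y', z, p2.
Qed.

(** A rotation puts the failing pair at the two ends of the word. *)
Lemma not_cycle r w : ~~ cycle r w ->
  exists u v x s, [/\ w = u ++ v, v ++ u = x :: s & ~~ r (last x s) x].
Proof.
case: w => // x s /not_path [p1 [y [z [p2 [E h]]]]].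
case: (lastP p2) E => [|p2' z'] E.
  have [e1 e2] : x :: s = rcons p1 y /\ x = z.
    have : rcons (x :: s) x = rcons (rcons p1 y) z by rewrite rcons_cons E -!cats1 -catA.
    by move/rcons_inj=> [].
  exists [::], (x :: s), x, s; split; rewrite ?cats0 //.
  have -> : last x s = y; last by rewrite e2.
  by rewrite -[last x s]/(last x (x :: s)) e1 last_rcons.
have [e1 e2] : x :: s = p1 ++ y :: z :: p2' /\ x = z'.
  have : rcons (x :: s) x = rcons (p1 ++ y :: z :: p2') z'.
    by rewrite rcons_cons E -!cats1 -catA.
  by move/rcons_inj=> [].
exists (rcons p1 y), (z :: p2'), z, (p2' ++ rcons p1 y); split=> //.
  by rewrite e1 -cats1 -catA.
by rewrite last_cat last_rcons.
Qed.

Lemma cycle_const (f : pred T) w : cycle (fun x y => f x ==> f y) w ->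
  all f w || all (predC f) w.
Proof.
case: w => // x s; rewrite [cycle _ _]/=.
have [fx|fx] := boolP (f x).
  move=> h; apply/orP; left; rewrite /= fx /=.
  have gen : forall t z, f z -> path (fun x y => f x ==> f y) z t -> all f t.
    elim=> //= y t IH z fz /andP[]; rewrite fz /= => fy /(IH _ fy) ->.
    by rewrite fy.
  by have := gen _ _ fx h; rewrite all_rcons => /andP[].
move=> h; apply/orP; right; rewrite /= fx /=.
have : forall t z, path (fun x y => f x ==> f y) z (rcons t x) -> ~~ f z /\ all (predC f) t.
  elim=> [|y t IH] z /=; first by rewrite andbT => /implyP h1; split=> //; apply: contra fx.
  by move=> /andP[/implyP zy /IH [fy ft]]; split; [apply: contra fy | rewrite fy].
by move/(_ s x h) => [].
Qed.
End CyclicWords.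

Lemma linked_swapl (R : realFieldType) (u v a b : 'cV[R]_2) : linked v u a b = linked u v a b.
Proof.
rewrite /linked (brC b u) (brC v b) (brC u a) (brC a v).
by congr (_ < _); ring.
Qed.
Lemma linked_swapr (R : realFieldType) (u v a b : 'cV[R]_2) : linked u v b a = linked u v a b.
Proof.
rewrite /linked (brC b u) (brC v b) (brC u a) (brC a v).
by congr (_ < _); ring.
Qed.
Lemma linked_mul (R : realFieldType) (g : 'M[R]_2) (u v a b : 'cV[R]_2) : \det g = 1 ->
  linked (g *m u) (g *m v) (g *m a) (g *m b) = linked u v a b.
Proof. by move=> dg; rewrite /linked !br_mul. Qed.
Lemma linkedZ (R : realFieldType) (c1 c2 c3 c4 : R) (u v a b : 'cV[R]_2) :
  c1 != 0 -> c2 != 0 -> c3 != 0 -> c4 != 0 ->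
  linked (c1 *: u) (c2 *: v) (c3 *: a) (c4 *: b) = linked u v a b.
Proof.
move=> h1 h2 h3 h4; rewrite /linked !brZl !brZr.
rewrite (_ : _ * _ = (c1 * c2 * c3 * c4) ^+ 2 * (br u a * br a v * br v b * br b u)).
  by rewrite pmulr_rlt0 // exprn_even_gt0 //= !mulf_neq0.
by ring.
Qed.

Definition positive (w : word) := all (fun x : letter => x.2) w.

Section Parse.
Variable R : realType.
Variables X Y : 'M[R]_2.
Let rB : rel letter := fun x y => x.1 || y.1.
Let rA : rel letter := fun x y => ~~ (x.1 && y.1).

(** If no two letters Y are adjacent, then each Y can be absorbed by the X
before it, which shortens the word by the number of letters Y. *)
Lemma parse_left n (x : letter) (s : word) : (size s < n)%N -> positive (x :: s) -> x.1 ->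
  path rB x s -> exists w, [/\ positive w, w != [::],
    eval_word X (X * Y) w = eval_word X Y (x :: s) &
    (size w + count (fun x : letter => ~~ x.1) (x :: s) = size (x :: s))%N].
Proof.
elim: n x s => // n IH [x1 x2] s; rewrite ltnS => sn /= /andP[]; case: x2 => // _ sp; case: x1 => // _.
case: s sn sp => [|[[] y2] s] sn /= sp.
- by exists [:: (true, true)]; rewrite !eval_seq1.
- move=> ps; have [w [h1 h2 h3 h4]] := IH (true, y2) s sn sp isT ps.
  exists ((true, true) :: w); split=> //=.
    by rewrite eval_cons h3 [in RHS]eval_cons.
  by rewrite /= in h4; rewrite addSn h4.
- case/andP: sp => /= y2t sp; case: s sn sp => [|[z1 z2] s] sn sp /=.
    by exists [:: (false, true)]; rewrite eval_seq1 eval_cons eval_seq1 /= /eval_letter /= y2t.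
  rewrite {1}/rB /= => /andP[z1t ps].
  have [w [h1 h2 h3 h4]] := IH (z1, z2) s (ltnW sn) sp z1t ps.
  exists ((false, true) :: w); split=> //=.
    rewrite eval_cons h3 [in RHS]eval_cons [in RHS]eval_cons mulrA.
    by rewrite /eval_letter /= y2t.
  by rewrite /= in h4; rewrite add0n addSn addnS h4.
Qed.

Lemma parse_right n (x : letter) (s : word) : (size s < n)%N -> positive (x :: s) ->
  ~~ (last x s).1 -> path rA x s -> exists w, [/\ positive w, w != [::],
    eval_word (X * Y) Y w = eval_word X Y (x :: s) &
    (size w + count (fun x : letter => x.1) (x :: s) = size (x :: s))%N].
Proof.
elim: n x s => // n IH [x1 x2] s; rewrite ltnS => sn /= /andP[]; case: x2 => // _ sp.
case: x1; last first.
  case: s sn sp => [|y s] sn sp /=.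
    by exists [:: (false, true)]; rewrite !eval_seq1.
  move=> ly ps; have [w [h1 h2 h3 h4]] := IH y s sn sp ly ps.
  exists ((false, true) :: w); split=> //=.
    by rewrite eval_cons h3 [in RHS]eval_cons.
  by rewrite /= in h4; rewrite add0n addSn h4.
case: s sn sp => [|[y1 y2] s] sn //= /andP[y2t sp] ly; rewrite {1}/rA /= => /andP[y1f ps].
case: s sn sp ly ps => [|z s] sn sp ly ps.
  exists [:: (true, true)]; rewrite eval_seq1 eval_cons eval_seq1 /= /eval_letter /=.
  by rewrite y2t (negPf y1f).
have [|w [h1 h2 h3 h4]] := IH z s (ltnW sn) sp ly; first by case/andP: ps.
exists ((true, true) :: w); split=> //=.
  rewrite eval_cons h3 [in RHS]eval_cons [in RHS]eval_cons mulrA.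
  by rewrite /eval_letter /= y2t (negPf y1f).
by rewrite /= in h4; rewrite (negPf y1f) add0n addSn addnS h4.
Qed.
End Parse.

(** * Words of simple axes *)

Section Classify.
Variable R : realType.
Variables A0 B0 : 'M[R]_2.
Hypotheses (dA0 : \det A0 = 1) (dB0 : \det B0 = 1).
Hypothesis trK : \tr (comm A0 B0) < -2.
Local Notation G := (generated2 A0 B0).
Local Notation nielsen := (nielsen A0 B0).
Implicit Types F g h X Y : 'M[R]_2.

Definition eigendir g (v : 'cV[R]_2) := exists a : R, g *m v = a *: v.

(** The two properties of a geodesic on which the combinatorial arguments
rest: no translate crosses it, and it has no end in common with a translate of
the boundary geodesic. *)
Record simple_frame F : Prop := SimpleFrame {
  simple_frame_det : \det F = 1;
  simple_frame_unlinked : forall g, G g ->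
    ~ linked (tgt F) (src F) (g *m tgt F) (g *m src F);
  simple_frame_tgt : forall g, G g -> ~ eigendir (comm A0 B0) (g *m tgt F);
  simple_frame_src : forall g, G g -> ~ eigendir (comm A0 B0) (g *m src F) }.

Definition axial F h := exists m : R, [/\ m != 0, m ^+ 2 != 1,
  h *m tgt F = m *: tgt F & h *m src F = m^-1 *: src F].

Lemma frame_neq0 F : \det F = 1 -> tgt F != 0 /\ src F != 0.
Proof.
move=> dF; have F1 : br (tgt F) (src F) != 0 by rewrite br_frame dF oner_eq0.
by split; apply: contraNneq F1 => ->; rewrite /br !mxE ?mul0r ?mulr0 subrr.
Qed.

Lemma simple_frame_G F g : G g -> simple_frame F -> simple_frame (g * F).
Proof.
move=> Gg [dF ul gp gn]; have dg := G_det dA0 dB0 Gg.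
split; first exact: det_mul2.
- move=> k Gk; rewrite tgtM srcM.
  have -> : k *m (g *m tgt F) = g *m ((g^-1 * k * g) *m tgt F).
    by rewrite -!mulmxE -!mulmxA mulmxKV2.
  have -> : k *m (g *m src F) = g *m ((g^-1 * k * g) *m src F).
    by rewrite -!mulmxE -!mulmxA mulmxKV2.
  rewrite linked_mul //; apply: ul; do 2?apply: G_M => //; exact: G_V.
- by move=> k Gk; rewrite tgtM mulmxA; apply: gp; exact: G_M.
- by move=> k Gk; rewrite srcM mulmxA; apply: gn; exact: G_M.
Qed.

Lemma axial_conj F g h : \det g = 1 -> axial F h -> axial (g^-1 * F) (g^-1 * h * g).
Proof.
move=> dg [m [m0 m2 hp hn]]; exists m; split=> //.
  by rewrite tgtM -!mulmxE -!mulmxA mulmxKV2 // hp -!scalemxAr.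
by rewrite srcM -!mulmxE -!mulmxA mulmxKV2 // hn -!scalemxAr.
Qed.

Lemma axial_inv F h : \det h = 1 -> axial F h -> axial F h^-1.
Proof.
move=> dh [m [m0 m2 hp hn]]; exists m^-1; split.
- by rewrite invr_eq0.
- by rewrite exprVn; apply: contra m2 => /eqP h1; rewrite -[_ ^+ 2]invrK h1 invr1.
- by rewrite -[in RHS](mulmxVK2 (tgt F) dh) hp -scalemxAr scalerA mulVf // scale1r.
- rewrite -[in RHS](mulmxVK2 (src F) dh) hn -scalemxAr scalerA mulrC invrK mulVf //.
  by rewrite scale1r.
Qed.

Lemma eigendir_inv h v : \det h = 1 -> v != 0 -> eigendir h^-1 v -> eigendir h v.
Proof.
move=> dh v0 [a ha]; exists a^-1.
have a0 : a != 0.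
  apply: contraNneq v0 => a0; apply/eqP.
  by rewrite -(mulmxKV2 v dh) ha a0 scale0r mulmx0.
by apply: (canRL (scalerK a0)); rewrite scalemxAr -ha mulmxKV2.
Qed.

(** The vertices are ends of boundary geodesics. *)
Lemma vertex_free X Y e W F : nielsen X Y -> config X Y e W ->
  (forall y, exists w, W y = eval_word X Y w *m W (true, true)) ->
  eigendir (comm X Y) (W (true, true)) -> simple_frame F ->
  forall y, br (W y) (tgt F) != 0 /\ br (W y) (src F) != 0.
Proof.
move=> n cW Ww [a Ka] sF y; have [dX dY] := nielsen_det dA0 dB0 n.
have [GX GY] := nielsen_G dA0 dB0 n.
have dK0 : \det (comm A0 B0) = 1 by rewrite !det_mul2 ?det_inv2.
have [w wE] := Ww y; have [c Gc cE] := nielsen_comm dA0 dB0 n.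
have Gw : G (eval_word X Y w).
  by apply: (generated_letters dA0 dB0 dX dY GX GY); exists w.
have dc := G_det dA0 dB0 Gc; have dw := G_det dA0 dB0 Gw.
have dci := det_inv2 dc.
pose g := c^-1 * (eval_word X Y w)^-1.
have Gg : G g by apply: G_M; exact: G_V.
have key v : v != 0 -> br (W y) v = 0 -> eigendir (comm A0 B0) (g *m v).
  move=> v0 /(br_eq0P (W_neq0 cW y)) [b vE].
  have b0 : b != 0 by apply: contraNneq v0 => b0; rewrite vE b0 scale0r.
  have gv : g *m v = b *: (c^-1 *m W (true, true)).
    by rewrite vE wE -scalemxAr /g -mulmxE -mulmxA mulmxVK2.
  have eig : eigendir (comm A0 B0) (c^-1 *m W (true, true)).
    have cW0 : c^-1 *m W (true, true) != 0 by rewrite mulmx2_neq0 // (W_neq0 cW).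
    case: cE => cE.
      exists a; rewrite scalemxAr -Ka cE -!mulmxE -!mulmxA mulmxVK2 //.
    apply: eigendir_inv => //; exists a.
    by rewrite scalemxAr -Ka cE -!mulmxE -!mulmxA mulmxVK2.
  case: eig => a' ea'; exists a'.
  by rewrite gv -scalemxAr ea' !scalerA mulrC.
have [p0 n0] := frame_neq0 (simple_frame_det sF).
split; apply/eqP => h.
  exact: (simple_frame_tgt sF Gg (key _ p0 h)).
exact: (simple_frame_src sF Gg (key _ n0 h)).
Qed.

Section Basis.
Variables X Y : 'M[R]_2.
Hypothesis nXY : nielsen X Y.
Variables (e : R) (W : letter -> 'cV[R]_2).
Hypothesis cW : config X Y e W.
Hypothesis Ww : forall y, exists w, W y = eval_word X Y w *m W (true, true).
Hypothesis KW : eigendir (comm X Y) (W (true, true)).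
Variables (F : 'M[R]_2) (w : word).
Hypothesis sF : simple_frame F.
Hypothesis aF : axial F (eval_word X Y w).
Hypothesis cw : cyc_reduced w.
Local Notation eval := (eval_word X Y).
Local Notation ev := (eval_letter X Y).
Local Notation inI := (inI e W).

Let dX : \det X = 1. Proof. by case: (nielsen_det dA0 dB0 nXY). Qed.
Let dY : \det Y = 1. Proof. by case: (nielsen_det dA0 dB0 nXY). Qed.

Lemma G_eval u : G (eval u).
Proof.
have [GX GY] := nielsen_G dA0 dB0 nXY.
by apply: (generated_letters dA0 dB0 dX dY GX GY); exists u.
Qed.

(** The rotated word is cyclically reduced, and its axis is the translate by
the inverse of the prefix u. *)
Lemma rotation_ends u v x s : w = u ++ v -> v ++ u = x :: s ->
  let F' := (eval u)^-1 * F in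
  (inI x (tgt F') /\ inI (linv (last x s)) (src F')) \/
  (inI x (src F') /\ inI (linv (last x s)) (tgt F')).
Proof.
move=> wE vuE F'; have du := det_eval dX dY u.
have Gu := G_V dA0 dB0 (G_eval u).
have sF' : simple_frame F' by exact: simple_frame_G.
have [m [m0 m2 hp hn]] : axial F' (eval (x :: s)).
  rewrite -vuE eval_cat -[eval v](mulKr (det1_unit du)) -eval_cat -wE.
  exact: axial_conj.
have dF' := simple_frame_det sF'.
apply: (ends_of_cyc_reduced dX dY cW (a := m) (b := m^-1)) => //.
- by rewrite -vuE /cyc_reduced -rot_size_cat rot_cycle -wE.
- by rewrite br_frame dF' oner_eq0.
- by rewrite divff.
- by move=> y; case: (vertex_free nXY cW Ww KW sF' y).
- by move=> y; case: (vertex_free nXY cW Ww KW sF' y).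
Qed.

Lemma rotations_unlinked u u' :
  ~ linked ((eval u)^-1 *m tgt F) ((eval u)^-1 *m src F)
           ((eval u')^-1 *m tgt F) ((eval u')^-1 *m src F).
Proof.
have du := det_eval dX dY u.
have GuV := G_V dA0 dB0 (G_eval u'); have Gu := G_eval u.
have h v : (eval u')^-1 *m v = (eval u)^-1 *m ((eval u * (eval u')^-1) *m v).
  by rewrite [RHS]mulmxA mulmxE mulrA mulVr ?det1_unit // mul1r.
rewrite !h linked_mul ?det_inv2 //; apply: simple_frame_unlinked sF _ _; exact: G_M.
Qed.

(** If a letter follows itself in the cyclic word, then a translate of the
axis joins the two sides of that letter. When this happens for both
generators, the two translates cross inside the quadrilateral
([straight_linked]). *)
Lemma not_both_straight u v x s u' v' x' s' :
  w = u ++ v -> v ++ u = x :: s -> last x s = x ->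
  w = u' ++ v' -> v' ++ u' = x' :: s' -> last x' s' = x' -> x' = turn x -> False.
Proof.
move=> w1 e1 l1 w2 e2 l2 xx.
have := rotation_ends w1 e1; have := rotation_ends w2 e2.
rewrite /= l1 l2 !tgtM !srcM xx (_ : linv (turn x) = turnV x); last by case: (x) => [[] []].
have := @rotations_unlinked u' u.
set p := _ *m tgt F; set n := _ *m src F; set p' := _ *m tgt F; set n' := _ *m src F.
move=> ul.
case=> -[a1 a2] [[b1 b2]|[b1 b2]]; apply: ul.
- by rewrite -linked_swapr; apply: (straight_linked cW b1 b2 a1 a2).
- exact: (straight_linked cW b1 b2 a1 a2).
- by rewrite -linked_swapl -linked_swapr; apply: (straight_linked cW b1 b2 a1 a2).
- by rewrite -linked_swapl; apply: (straight_linked cW b1 b2 a1 a2).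
Qed.

(** The pairs of ends, up to scaling, of the translates of the axis that cross
the quadrilateral: there is one for each rotation of the cyclic word w. *)
Definition crossing a b := [/\ a != 0, b != 0 & exists u v, w = u ++ v /\
  ((br ((eval u)^-1 *m tgt F) a = 0 /\ br ((eval u)^-1 *m src F) b = 0) \/
   (br ((eval u)^-1 *m src F) a = 0 /\ br ((eval u)^-1 *m tgt F) b = 0))].

Lemma crossing_sym a b : crossing a b -> crossing b a.
Proof.
case=> a0 b0 [u [v [wE h]]]; split=> //; exists u, v; split=> //.
by case: h => -[h1 h2]; [right|left].
Qed.

Lemma crossing_par a b a' : crossing a b -> a' != 0 -> br a a' = 0 -> crossing a' b.
Proof.
move=> [a0 b0 [u [v [wE h]]]] a'0 /(br_eq0P a0) [c cE]; split=> //; exists u, v; split=> //.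
by rewrite cE !brZr; case: h => -[-> ->]; rewrite mulr0; [left|right].
Qed.

Lemma word_neq0 : w != [::].
Proof.
apply/eqP => w0; case: aF => m [m0 m2 hp hn].
have [p0 _] := frame_neq0 (simple_frame_det sF).
move: hp; rewrite w0 eval_nil mul1mx => /eqP; rewrite -subr_eq0 -{1}[tgt F]scale1r -scalerBl.
rewrite scaler_eq0 (negPf p0) orbF subr_eq0 => /eqP m1.
by rewrite -m1 expr1n eqxx in m2.
Qed.

Lemma in_par x a b c : inI x a -> b = c *: a -> b != 0 -> inI x b.
Proof.
move=> xa bE b0; have c0 : c != 0 by apply: contraNneq b0 => c0; rewrite bE c0 scale0r.
by rewrite bE /inI; have := @cycZ _ e 1 c 1 (W (turnV x)) a (W x);
  rewrite !scale1r => -> //; exact: oner_neq0.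
Qed.

Lemma crossing_split a b : crossing a b -> exists u v x s,
  [/\ w = u ++ v, v ++ u = x :: s &
   ((br ((eval u)^-1 *m tgt F) a = 0 /\ br ((eval u)^-1 *m src F) b = 0) \/
   (br ((eval u)^-1 *m src F) a = 0 /\ br ((eval u)^-1 *m tgt F) b = 0)) /\
   ((inI x a /\ inI (linv (last x s)) b) \/ (inI x b /\ inI (linv (last x s)) a))].
Proof.
move=> [a0 b0 [u [v [wE h]]]].
case vuE : (v ++ u) => [|x s].
  have : size w = 0%N by rewrite wE size_cat addnC -size_cat vuE.
  by have := word_neq0; case: (w).
exists u, v, x, s; split=> //; split=> //.
have := rotation_ends wE vuE; rewrite /= tgtM srcM.
have du := det_inv2 (det_eval dX dY u).
have [p0 n0] := frame_neq0 (simple_frame_det sF).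
have [p1 n1] := (mulmx2_neq0 du p0, mulmx2_neq0 du n0).
case: h => -[/(br_eq0P (mulmx2_neq0 du _)) h1 /(br_eq0P (mulmx2_neq0 du _)) h2].
  have [c1 E1] := h1 p0; have [c2 E2] := h2 n0.
  case=> -[i1 i2]; [left|right].
    by split; [exact: in_par i1 E1 a0 | exact: in_par i2 E2 b0].
  by split; [exact: in_par i1 E2 b0 | exact: in_par i2 E1 a0].
have [c1 E1] := h1 n0; have [c2 E2] := h2 p0.
case=> -[i1 i2]; [right|left].
  by split; [exact: in_par i1 E2 b0 | exact: in_par i2 E1 a0].
by split; [exact: in_par i1 E1 a0 | exact: in_par i2 E2 b0].
Qed.

Lemma rotation_adj u v x s : w = u ++ v -> v ++ u = x :: s -> adj (last x s) x.
Proof.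
move=> wE vuE; have : cyc_reduced (x :: s) by rewrite -vuE /cyc_reduced -rot_size_cat rot_cycle -wE.
by rewrite /cyc_reduced /= rcons_path => /andP[].
Qed.

Lemma crossing_ends a b : crossing a b -> exists x y, [/\ x != y, inI x a & inI y b].
Proof.
move=> /crossing_split [u [v [x [s [wE vuE [_ h]]]]]].
have ad := rotation_adj wE vuE.
case: h => -[h1 h2]; [exists x, (linv (last x s)) | exists (linv (last x s)), x]; split=> //.
by rewrite eq_sym.
Qed.

(** Leaving the quadrilateral through a side rotates the word by one letter:
forwards if it is the side of the first letter, and backwards if it is that of
the inverse of the last letter. *)
Lemma crossing_shift a b x : crossing a b -> inI x a ->
  crossing ((ev x)^-1 *m a) ((ev x)^-1 *m b).
Proof.
move=> Sab xa; have [a0 b0 _] := Sab; have dx := det_inv2 (det_ev dX dY x).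
have [u [v [z [s [wE vuE [h1 h2]]]]]] := crossing_split Sab.
split; try exact: mulmx2_neq0.
suff [u' [v' [k [wE' k0 kE]]]] : exists u' v' (k : R * R), [/\ w = u' ++ v', k.1 != 0 /\ k.2 != 0 &
   (eval u')^-1 *m tgt F = k.1 *: ((ev x)^-1 *m ((eval u)^-1 *m tgt F)) /\
   (eval u')^-1 *m src F = k.2 *: ((ev x)^-1 *m ((eval u)^-1 *m src F))].
  exists u', v'; split=> //; case: kE => -> ->; rewrite !brZl !br_mul //.
  by case: h1 => -[-> ->]; rewrite !mulr0; [left|right].
have [m [m0 m2 hp hn]] := aF; have dw := det_eval dX dY w.
have hpi : (eval w)^-1 *m tgt F = m^-1 *: tgt F.
  by rewrite -[in RHS](mulmxVK2 (tgt F) dw) hp -scalemxAr scalerA mulVf // scale1r.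
have hni : (eval w)^-1 *m src F = m *: src F.
  by rewrite -[in RHS](mulmxVK2 (src F) dw) hn -scalemxAr scalerA divff // scale1r.
have ux := det1_unit (det_ev dX dY x).
have ueval t := det1_unit (det_eval dX dY t).
have xz : x = z \/ x = linv (last z s).
  by case: h2 => -[i1 i2]; [left; exact: (inI_uniq cW i1 xa) | right; exact: (inI_uniq cW i2 xa)].
case: xz => xE.
  case: v wE vuE => [|z' v] wE vuE.
    (* the translate by the whole word is the axis itself *)
    rewrite cats0 in wE; rewrite /= -wE in vuE; exists [:: x], s, (m, m^-1); split=> /=.
    - by rewrite vuE xE.
    - by rewrite invr_eq0.
    - by rewrite eval_seq1 -wE hpi hni -!scalemxAr !scalerA divff // mulVf // !scale1r.
  move: vuE => /= [zE sE]; exists (rcons u x), v, (1, 1); split=> /=.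
  - by rewrite -cats1 -catA wE xE zE.
  - by rewrite oner_eq0.
  - by rewrite eval_rcons invrM // -mulmxE -!mulmxA !scale1r.
have x1 : (ev x)^-1 = ev (last z s) by rewrite xE ev_linv invrK.
have ul := det1_unit (det_ev dX dY (last z s)).
rewrite x1; rewrite lastI in vuE; case: (lastP u) wE vuE => [|u' y] wE vuE.
  rewrite cats0 in vuE; rewrite /= in wE; rewrite -wE in vuE.
  exists (belast z s), [:: last z s], (m^-1, m); split=> /=.
  - by rewrite cats1.
  - by rewrite invr_eq0.
  - have -> : (eval (belast z s))^-1 = ev (last z s) * (eval w)^-1.
      by rewrite vuE eval_rcons invrM // mulrA divrr // mul1r.
    by rewrite -!mulmxE -!mulmxA hpi hni eval_nil invr1 !mul1mx -!scalemxAr.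
have yE : y = last z s by move: vuE; rewrite -rcons_cat => /rcons_inj [].
exists u', (y :: v), (1, 1); split=> /=.
- by rewrite wE -cats1 -catA.
- by rewrite oner_eq0.
- have -> : (eval u')^-1 = ev (last z s) * (eval (rcons u' y))^-1.
    by rewrite yE eval_rcons invrM // mulrA divrr // mul1r.
  by rewrite -!mulmxE -!mulmxA !scale1r.
Qed.

Lemma crossing_unlinked a b a' b' : crossing a b -> crossing a' b' -> ~ linked a b a' b'.
Proof.
move=> [a0 b0 [u [v [wE h]]]] [a'0 b'0 [u' [v' [wE' h']]]].
have ul := @rotations_unlinked u u'; move: ul h h'.
have du := det_inv2 (det_eval dX dY u); have du' := det_inv2 (det_eval dX dY u').
have [p0 n0] := frame_neq0 (simple_frame_det sF).
have := mulmx2_neq0 du p0; have := mulmx2_neq0 du n0.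
have := mulmx2_neq0 du' p0; have := mulmx2_neq0 du' n0.
set p := _ *m tgt F; set n := _ *m src F; set p' := _ *m tgt F; set n' := _ *m src F.
move=> n'1 p'1 n1 p1 ul.
have nz (c : R) (x y : 'cV[R]_2) : x = c *: y -> x != 0 -> c != 0.
  by move=> -> ; apply: contraNneq => ->; rewrite scale0r.
case=> -[/br_eq0P h1 /br_eq0P h2] [] [/br_eq0P h3 /br_eq0P h4].
- have [c1 e1] := h1 p1; have [c2 e2] := h2 n1; have [c3 e3] := h3 p'1; have [c4 e4] := h4 n'1.
  by rewrite e1 e2 e3 e4 linkedZ ?(nz _ _ _ e1) ?(nz _ _ _ e2) ?(nz _ _ _ e3) ?(nz _ _ _ e4).
- have [c1 e1] := h1 p1; have [c2 e2] := h2 n1; have [c3 e3] := h3 n'1; have [c4 e4] := h4 p'1.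
  by rewrite e1 e2 e3 e4 linkedZ ?(nz _ _ _ e1) ?(nz _ _ _ e2) ?(nz _ _ _ e3) ?(nz _ _ _ e4) // linked_swapr.
- have [c1 e1] := h1 n1; have [c2 e2] := h2 p1; have [c3 e3] := h3 p'1; have [c4 e4] := h4 n'1.
  by rewrite e1 e2 e3 e4 linkedZ ?(nz _ _ _ e1) ?(nz _ _ _ e2) ?(nz _ _ _ e3) ?(nz _ _ _ e4) // linked_swapl.
have [c1 e1] := h1 n1; have [c2 e2] := h2 p1; have [c3 e3] := h3 n'1; have [c4 e4] := h4 p'1.
by rewrite e1 e2 e3 e4 linkedZ ?(nz _ _ _ e1) ?(nz _ _ _ e2) ?(nz _ _ _ e3) ?(nz _ _ _ e4) // linked_swapl linked_swapr.
Qed.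

Lemma crossing_rotation u v : w = u ++ v ->
  crossing ((eval u)^-1 *m tgt F) ((eval u)^-1 *m src F).
Proof.
move=> wE; have du := det_inv2 (det_eval dX dY u).
have [p0 n0] := frame_neq0 (simple_frame_det sF).
split; try exact: mulmx2_neq0.
by exists u, v; split=> //; left; rewrite !br0.
Qed.

Lemma crossing_finite : exists l : seq 'cV[R]_2,
  (forall a b, crossing a b -> exists2 a', a' \in l & br a a' = 0) /\
  (forall a, a \in l -> exists b, crossing a b).
Proof.
pose g i := (eval (take i w))^-1.
pose l := [seq g i *m tgt F | i <- iota 0 (size w).+1] ++ [seq g i *m src F | i <- iota 0 (size w).+1].
exists l; split=> [a b [a0 b0 [u [v [wE h]]]]|a].
  have iu : size u \in iota 0 (size w).+1.
    by rewrite mem_iota /= add0n ltnS wE size_cat leq_addr.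
  have gu : g (size u) = (eval u)^-1 by rewrite /g wE take_size_cat.
  case: h => -[h _]; [exists (g (size u) *m tgt F)|exists (g (size u) *m src F)].
  - by rewrite mem_cat; apply/orP; left; apply/mapP; exists (size u).
  - by rewrite gu brC h oppr0.
  - by rewrite mem_cat; apply/orP; right; apply/mapP; exists (size u).
  - by rewrite gu brC h oppr0.
rewrite mem_cat => /orP[] /mapP[i _ ->].
  exists (g i *m src F); apply: (@crossing_rotation _ (drop i w)).
  by rewrite cat_take_drop.
exists (g i *m tgt F); apply: crossing_sym; apply: (@crossing_rotation _ (drop i w)).
by rewrite cat_take_drop.
Qed.

(** The translate goes from the side of the first letter to that of the
inverse of the last one, and these two sides are adjacent here. *)
Lemma corner_of_rotation k u v x s : w = u ++ v -> v ++ u = x :: s ->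
  (x = turn k /\ last x s = linv k) \/ (x = k /\ last x s = linv (turn k)) ->
  exists a b, [/\ crossing a b, inI (turn k) a & inI k b].
Proof.
move=> wE vuE; have Sr := crossing_rotation wE; have := rotation_ends wE vuE.
rewrite /= tgtM srcM => ends [] [xE lE].
  rewrite lE linvK xE in ends; case: ends => -[h1 h2].
    by do 2!eexists; split; [exact: Sr | |].
  by do 2!eexists; split; [exact: crossing_sym Sr | |].
rewrite lE linvK xE in ends; case: ends => -[h1 h2].
  by do 2!eexists; split; [exact: crossing_sym Sr | |].
by do 2!eexists; split; [exact: Sr | |].
Qed.

(** By [four_corners_fix] the axis would have an end in common with a
translate of the boundary geodesic. *)
Lemma not_four_corners : ~ forall k, exists a b,
  [/\ crossing a b, inI (turn k) a & inI k b].
Proof.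
move=> corners.
have [a [b [Sab fix_a]]] := four_corners_fix dX dY cW crossing_sym crossing_ends
  crossing_shift crossing_par crossing_unlinked crossing_finite corners.
have [a0 b0 [u [v [wE h]]]] := Sab.
have [c' cE] := br_eq0P a0 fix_a.
have [c Gc cK] := nielsen_comm dA0 dB0 nXY.
have dc := G_det dA0 dB0 Gc; have du := det_eval dX dY u.
have dK0 : \det (comm A0 B0) = 1 by rewrite !det_mul2 ?det_inv2.
have Kinv t : t != 0 -> br ((eval u)^-1 *m t) a = 0 -> eigendir (comm A0 B0) (c^-1 *m ((eval u)^-1 *m t)).
  move=> t0 /br_eq0P => /(_ (mulmx2_neq0 (det_inv2 du) t0)) [d dE].
  have d0 : d != 0 by apply: contraNneq a0 => d0; rewrite dE d0 scale0r.
  have K1 : comm X Y *m ((eval u)^-1 *m t) = c' *: ((eval u)^-1 *m t).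
    move: cE; rewrite dE -scalemxAr scalerA mulrC -scalerA => /(scalerI d0).
    by rewrite /comm.
  have t1 : c^-1 *m ((eval u)^-1 *m t) != 0 by rewrite !mulmx2_neq0 ?det_inv2.
  case: cK => cK.
    by exists c'; rewrite scalemxAr -K1 cK -!mulmxE -!mulmxA mulmxVK2.
  apply: eigendir_inv => //; exists c'.
  by rewrite scalemxAr -K1 cK -!mulmxE -!mulmxA mulmxVK2.
have [p0 n0] := frame_neq0 (simple_frame_det sF).
have Gg : G (c^-1 * (eval u)^-1).
  by apply: G_M; apply: G_V => //; exact: G_eval.
case: h => -[h _].
  by have := Kinv _ p0 h; rewrite mulmxA; exact: (simple_frame_tgt sF Gg).
by have := Kinv _ n0 h; rewrite mulmxA; exact: (simple_frame_src sF Gg).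
Qed.

(** When a letter x of the cyclic word follows a letter of opposite exponent,
the translate cuts off one of two opposite corners, depending on the direction
of the change; and one of the other two when the truth value of x.1 == x.2
changes. If both were to change in the word, in both directions as the word is
cyclic, all four corners would be cut off. *)
Lemma constant_sign :
  [|| all (fun x : letter => x.2) w, all (fun x : letter => ~~ x.2) w,
      all (fun x : letter => x.1 == x.2) w | all (fun x : letter => x.1 != x.2) w].
Proof.
have ncst (f : pred letter) : ~~ (all f w || all (predC f) w) ->
    (exists u v x s, [/\ w = u ++ v, v ++ u = x :: s, f (last x s) & ~~ f x]) /\
    (exists u v x s, [/\ w = u ++ v, v ++ u = x :: s, ~~ f (last x s) & f x]).
  move=> nc; split.
    have /not_cycle [u [v [x [s [h1 h2]]]]] : ~~ cycle (fun x y => f x ==> f y) w.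
      by apply: contra nc => /cycle_const.
    by rewrite negb_imply => /andP[h3 h4]; exists u, v, x, s.
  have /not_cycle [u [v [x [s [h1 h2]]]]] : ~~ cycle (fun x y => predC f x ==> predC f y) w.
    apply: contra nc => /cycle_const; rewrite orbC => /orP[h|->]; last by rewrite orbT.
    by apply/orP; left; apply: sub_all h => z /=; rewrite negbK.
  by rewrite negb_imply /= negbK => /andP[h3 h4]; exists u, v, x, s.
apply/negPn/negP; rewrite !negb_or => /and4P[n1 n2 n3 n4].
have /ncst [[u1 [v1 [x1 [s1 [w1 e1 l1 f1]]]]] [u2 [v2 [x2 [s2 [w2 e2 l2 f2]]]]]] :
    ~~ (all (fun x : letter => x.2) w || all (predC (fun x : letter => x.2)) w).
  by rewrite negb_or n1.
have /ncst [[u3 [v3 [x3 [s3 [w3 e3 l3 f3]]]]] [u4 [v4 [x4 [s4 [w4 e4 l4 f4]]]]]] :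
    ~~ (all (fun x : letter => x.1 == x.2) w || all (predC (fun x : letter => x.1 == x.2)) w).
  by rewrite negb_or n3.
have ad1 := rotation_adj w1 e1; have ad2 := rotation_adj w2 e2.
have ad3 := rotation_adj w3 e3; have ad4 := rotation_adj w4 e4.
apply: not_four_corners; case=> [[] []].
- apply: corner_of_rotation w2 e2 _; move: ad2 l2 f2.
  by case: (last x2 s2) => [[] []]; case: (x2) => [[] []] //= _ _ _; [left|right].
- apply: corner_of_rotation w1 e1 _; move: ad1 l1 f1.
  by case: (last x1 s1) => [[] []]; case: (x1) => [[] []] //= _ _ _; [left|right].
- apply: corner_of_rotation w3 e3 _; move: ad3 l3 f3.
  by case: (last x3 s3) => [[] []]; case: (x3) => [[] []] //= _ _ _; [right|left].
- apply: corner_of_rotation w4 e4 _; move: ad4 l4 f4.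
  by case: (last x4 s4) => [[] []]; case: (x4) => [[] []] //= _ _ _; [right|left].
Qed.
End Basis.
End Classify.

(** * Simple axes in the tree of bases *)

Section Tree.
Variable R : realType.

Definition child (b : bool) (s : 'M[R]_2 * 'M[R]_2) : 'M[R]_2 * 'M[R]_2 :=
  if b then (s.1, s.1 * s.2) else (s.1 * s.2, s.2).
Definition descend s (l : seq bool) := foldl (fun s b => child b s) s l.

Variables A0 B0 : 'M[R]_2.
Hypotheses (dA0 : \det A0 = 1) (dB0 : \det B0 = 1).
Hypothesis trK : \tr (comm A0 B0) < -2.
Local Notation G := (generated2 A0 B0).
Local Notation nielsen := (nielsen A0 B0).
Local Notation simple_frame := (simple_frame A0 B0).
Implicit Types F g h X Y : 'M[R]_2.

Definition fixes_ends g F := eigendir g (tgt F) /\ eigendir g (src F).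

Lemma nielsen_descend X Y l : nielsen X Y ->
  nielsen (descend (X, Y) l).1 (descend (X, Y) l).2.
Proof.
elim: l X Y => //= b l IH X Y n.
by case: b; apply: IH; [exact: nielsen_left | exact: nielsen_right].
Qed.

(** An eigenvalue of h other than 1 and -1 has a single eigenline, which every
element that commutes with h preserves. *)
Lemma commuting_fixes F h g : \det F = 1 -> \det h = 1 -> axial F h -> g * h = h * g ->
  fixes_ends g F.
Proof.
move=> dF dh [m [m0 m2 hp hn]] gh; have [p0 n0] := frame_neq0 dF.
have key v c : v != 0 -> c ^+ 2 != 1 -> h *m v = c *: v -> eigendir g v.
  move=> v0 c2 hv; apply: br_eq0P => //.
  have : (c ^+ 2 - 1) * br v (g *m v) == 0.
    rewrite mulrBl mul1r subr_eq0 -[X in _ == X](br_mul _ _ dh).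
    have -> : h *m (g *m v) = c *: (g *m v).
      by rewrite mulmxA mulmxE -gh -mulmxE -mulmxA hv -scalemxAr.
    by rewrite hv brZl brZr expr2 mulrA.
  by rewrite mulf_eq0 subr_eq0 (negPf c2) /= => /eqP.
split; first exact: key m2 hp.
apply: key hn => //; rewrite exprVn; apply: contra m2 => /eqP h1.
by rewrite -[_ ^+ 2]invrK h1 invr1.
Qed.

Lemma eval_one_letter X Y (b : bool) w : all (fun x : letter => x.1 == b) w ->
  \det X = 1 -> \det Y = 1 ->
  let g := if b then X else Y in g * eval_word X Y w = eval_word X Y w * g.
Proof.
move=> + dX dY; elim: w => [|x w IH] /=; first by rewrite eval_nil mul1r mulr1.
case/andP=> /eqP xb /IH {}IH; rewrite eval_cons mulrA.
suff -> : (if b then X else Y) * eval_letter X Y x = eval_letter X Y x * (if b then X else Y).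
  by rewrite -!mulrA IH.
rewrite /eval_letter xb; case: (b); case: (x.2) => //.
  by rewrite divrr ?mulVr // det1_unit.
by rewrite divrr ?mulVr // det1_unit.
Qed.

Lemma eval_rot X Y u v : \det X = 1 -> \det Y = 1 ->
  eval_word X Y (v ++ u) = (eval_word X Y u)^-1 * eval_word X Y (u ++ v) * eval_word X Y u.
Proof.
move=> dX dY; rewrite !eval_cat mulKr //; exact: det1_unit (det_eval dX dY u).
Qed.

Lemma positive_cyc_reduced w : positive w -> cyc_reduced w.
Proof.
case: w => // x s; rewrite /positive /= => /andP[x2 s2]; rewrite /cyc_reduced /=.
have gen : forall t z, all (fun x : letter => x.2) (z :: t) -> path adj z t.
  elim=> //= y t IH z /and3P[z2 y2 t2]; rewrite IH /= ?y2 ?t2 // andbT /adj /linv.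
  by apply: contraTneq y2 => ->; rewrite /= z2.
by apply: gen; rewrite /= all_rcons x2 s2.
Qed.

(** Induction on the length. If both letters occur, then one of them never
follows itself, by [not_both_straight]; the word, once rotated, is a shorter
positive word in the basis (X, X Y) or (X Y, Y). If only one letter occurs,
the word is a power of it and has the same axis. *)
Lemma classify_positive n X Y w F : nielsen X Y -> simple_frame F ->
  axial F (eval_word X Y w) -> positive w -> w != [::] -> (size w <= n)%N ->
  exists g l (b : bool), [/\ G g & fixes_ends
     (if b then (descend (X, Y) l).1 else (descend (X, Y) l).2) (g * F)].
Proof.
elim: n X Y w F => [|n IH] X Y w F nXY sF aF pw w0 sw; first by case: w w0 sw {aF pw}.
have [dX dY] := nielsen_det dA0 dB0 nXY.
have dw := det_eval dX dY w; have dF := simple_frame_det sF.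
have one (b : bool) : all (fun x : letter => x.1 == b) w -> exists g l (b : bool), [/\ G g & fixes_ends
     (if b then (descend (X, Y) l).1 else (descend (X, Y) l).2) (g * F)].
  move=> wb; exists 1, [::], b; split; first exact: G_1.
  rewrite mul1r; apply: (commuting_fixes dF dw aF).
  by have := eval_one_letter wb dX dY; case: (b).
have [/one//|wA] := boolP (all (fun x : letter => x.1 == true) w).
have [/one//|wB] := boolP (all (fun x : letter => x.1 == false) w).
have cw := positive_cyc_reduced pw.
have [e [W [cW Ww KW]]] : exists e W, [/\ config X Y e W,
    (forall y, exists w, W y = eval_word X Y w *m W (true, true)) &
    exists a : R, (Y * X * Y^-1 * X^-1) *m W (true, true) = a *: W (true, true)].
  by apply: config_exists => //; have := nielsen_trK dA0 dB0 nXY; rewrite /comm => ->.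
have rot_axial u v : w = u ++ v ->
    simple_frame ((eval_word X Y u)^-1 * F) /\
    axial ((eval_word X Y u)^-1 * F) (eval_word X Y (v ++ u)).
  move=> wE; split; first by apply: simple_frame_G => //; apply: G_V => //; exact: G_eval.
  by rewrite eval_rot // -wE; apply: axial_conj => //; exact: det_eval.
have GV u : G (eval_word X Y u)^-1 by apply: G_V => //; exact: G_eval.
pose rB : rel letter := fun x y => x.1 || y.1.
pose rA : rel letter := fun x y => ~~ (x.1 && y.1).
have straight : cycle rB w || cycle rA w.
  apply/negPn/negP; rewrite negb_or => /andP[/not_cycle hB /not_cycle hA].
  have [u1 [v1 [x1 [s1 [w1 e1 n1]]]]] := hB; have [u2 [v2 [x2 [s2 [w2 e2 n2]]]]] := hA.
  have pos (u v : word) x s : w = u ++ v -> v ++ u = x :: s -> x.2 /\ (last x s).2.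
    move=> wE vu; have : all (fun x : letter => x.2) (x :: s).
      by rewrite -vu all_cat andbC -all_cat -wE.
    move=> h; split; first by case/andP: h.
    by move/allP: h; apply; exact: mem_last.
  have [p1 q1] := pos _ _ _ _ w1 e1; have [p2 q2] := pos _ _ _ _ w2 e2.
  have xE1 : x1 = (false, true) /\ last x1 s1 = (false, true).
    by move: n1 p1 q1; rewrite /rB; case: (last x1 s1) => [[] []]; case: (x1) => [[] []].
  have xE2 : x2 = (true, true) /\ last x2 s2 = (true, true).
    by move: n2 p2 q2; rewrite /rA; case: (last x2 s2) => [[] []]; case: (x2) => [[] []].
  case: xE1 => xE1 lE1; case: xE2 => xE2 lE2.
  apply: (not_both_straight dA0 dB0 nXY cW Ww KW sF aF cw w2 e2 _ w1 e1).
  - by rewrite lE2 xE2.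
  - by rewrite lE1 xE1.
  - by rewrite xE1 xE2.
have hasA : (0 < count (fun x : letter => x.1) w)%N.
  by rewrite -has_count; move: wB; rewrite -has_predC; apply: sub_has => z /=; case: (z.1).
have hasB : (0 < count (fun x : letter => ~~ x.1) w)%N.
  by rewrite -has_count; move: wA; rewrite -has_predC; apply: sub_has => z /=; case: (z.1).
case/orP: straight => straight.
  have [u [v [x [s [wE vuE x1]]]]] : exists u v x s, [/\ w = u ++ v, v ++ u = x :: s & x.1].
    case: w w0 straight {aF pw sw dw one wA wB cw rot_axial GV hasB} hasA => // x s _ st hA.
    have [x1|x1] := boolP x.1; first by exists [::], (x :: s), x, s; rewrite cats0.
    move: st hA; case: (lastP s) => [|t z]; first by rewrite /= (negPf x1).
    rewrite /= rcons_path last_rcons => /andP[_]; rewrite /rB (negPf x1) orbF => z1 _.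
    by exists (x :: t), [:: z], z, (x :: t); rewrite -cats1.
  have [sF' aF'] := rot_axial _ _ wE.
  have px : positive (x :: s) by rewrite -vuE /positive all_cat andbC -all_cat -wE.
  have ps : path rB x s.
    have : cycle rB (x :: s) by rewrite -vuE -rot_size_cat rot_cycle -wE.
    by rewrite /= rcons_path => /andP[].
  have [w2 [pw2 w20 ew2 sw2]] := parse_left X Y (ltnSn (size s)) px x1 ps.
  rewrite vuE -ew2 in aF'.
  have cnt : count (fun x : letter => ~~ x.1) (x :: s) = count (fun x : letter => ~~ x.1) w.
    by rewrite -vuE wE !count_cat addnC.
  have szE : size (x :: s) = size w by rewrite -vuE wE !size_cat addnC.
  have [|g [l [b [Gg hg]]]] := IH _ _ w2 _ (nielsen_left nXY) sF' aF' pw2 w20.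
    rewrite -ltnS; apply: leq_trans sw; rewrite -szE -sw2 cnt -addn1 leq_add2l //.
  exists (g * (eval_word X Y u)^-1), (true :: l), b; split; first exact: G_M.
  by rewrite -mulrA.
have [u [v [x [s [wE vuE x1]]]]] : exists u v x s, [/\ w = u ++ v, v ++ u = x :: s & ~~ (last x s).1].
  case: w w0 straight {aF pw sw dw one wA wB cw rot_axial GV hasA} hasB => // x s _ st hB.
  have [x1|x1] := boolP (last x s).1; last by exists [::], (x :: s), x, s; rewrite cats0.
  move: st hB x1; case: (lastP s) => [|t z]; first by rewrite /= => _; case: x.1.
  rewrite /= !rcons_path !last_rcons => /andP[/andP[_ tz]]; rewrite /rA => zx _ z1.
  exists (x :: t), [:: z], z, (x :: t); rewrite -cats1; split=> //=.
  by move: tz; rewrite /rA z1 andbT.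
have [sF' aF'] := rot_axial _ _ wE.
have px : positive (x :: s) by rewrite -vuE /positive all_cat andbC -all_cat -wE.
have ps : path rA x s.
  have : cycle rA (x :: s) by rewrite -vuE -rot_size_cat rot_cycle -wE.
  by rewrite /= rcons_path => /andP[].
have [w2 [pw2 w20 ew2 sw2]] := parse_right X Y (ltnSn (size s)) px x1 ps.
rewrite vuE -ew2 in aF'.
have cnt : count (fun x : letter => x.1) (x :: s) = count (fun x : letter => x.1) w.
  by rewrite -vuE wE !count_cat addnC.
have szE : size (x :: s) = size w by rewrite -vuE wE !size_cat addnC.
have [|g [l [b [Gg hg]]]] := IH _ _ w2 _ (nielsen_right nXY) sF' aF' pw2 w20.
  rewrite -ltnS; apply: leq_trans sw; rewrite -szE -sw2 cnt -addn1 leq_add2l //.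
exists (g * (eval_word X Y u)^-1), (false :: l), b; split; first exact: G_M.
by rewrite -mulrA.
Qed.

(** The starting points of the two trees: words positive in X and Y, and words
positive in X and Y^-1. *)
Definition root (c : bool) X Y := if c then (X, Y) else (X, Y^-1).

(** After cyclic reduction, and up to inversion, the word is positive in X and
Y or in X and Y^-1, by [constant_sign]. *)
Lemma classify X Y h F : nielsen X Y -> simple_frame F -> G h -> axial F h ->
  exists g c l (b : bool), [/\ G g & fixes_ends
     (if b then (descend (root c X Y) l).1 else (descend (root c X Y) l).2) (g * F)].
Proof.
move=> nXY sF Gh aF; have [dX dY] := nielsen_det dA0 dB0 nXY.
have [w0 _ hE] := nielsen_gen dA0 dB0 nXY Gh.
have [k [w [cw wE _]]] := cyc_reduce dX dY w0.
have Gk : G (eval_word X Y k) by exact: G_eval.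
have dk := det_eval dX dY k.
pose F' := (eval_word X Y k)^-1 * F.
have sF' : simple_frame F' by apply: simple_frame_G => //; exact: G_V.
have aF' : axial F' (eval_word X Y w) by rewrite -wE hE; exact: axial_conj.
have dw := det_eval dX dY w.
have [e [W [cW Ww KW]]] : exists e W, [/\ config X Y e W,
    (forall y, exists w, W y = eval_word X Y w *m W (true, true)) &
    exists a : R, (Y * X * Y^-1 * X^-1) *m W (true, true) = a *: W (true, true)].
  by apply: config_exists => //; have := nielsen_trK dA0 dB0 nXY; rewrite /comm => ->.
have wn : w != [::] by exact: word_neq0 sF' aF'.
have main c w1 : axial F' (eval_word (root c X Y).1 (root c X Y).2 w1) -> positive w1 -> w1 != [::] ->
   exists g c l (b : bool), [/\ G g & fixes_ends
     (if b then (descend (root c X Y) l).1 else (descend (root c X Y) l).2) (g * F)].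
  move=> a1 p1 n1; have nr : nielsen (root c X Y).1 (root c X Y).2.
    by rewrite /root; case: (c) => //=; exact: nielsen_inv.
  have [g [l [b [Gg hg]]]] := classify_positive nr sF' a1 p1 n1 (leqnn _).
  exists (g * (eval_word X Y k)^-1), c, l, b; split; first by apply: G_M => //; exact: G_V.
  by move: hg; rewrite -surjective_pairing mulrA.
have aFi : axial F' (eval_word X Y (winv w)) by rewrite eval_winv //; exact: axial_inv.
have winvn : winv w != [::].
  by apply: contra wn => /eqP e0; rewrite -(winvK w) e0.
have relabel w1 : all (fun x : letter => x.1 == x.2) w1 ->
    eval_word X Y^-1 [seq (x.1, true) | x <- w1] = eval_word X Y w1.
  elim: w1 => [|x w1 IH] /=; first by rewrite !eval_nil.
  move=> /andP[/eqP xx /IH {}IH]; rewrite !eval_cons IH; congr (_ * _).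
  by rewrite /eval_letter /= -xx; case: (x.1).
case/or4P: (constant_sign dA0 dB0 nXY cW Ww KW sF' aF' cw) => h1.
- exact: main true w aF' h1 wn.
- apply: (main true (winv w) aFi _ winvn).
  by rewrite /positive /winv all_rev all_map; exact: h1.
- apply: (main false [seq (x.1, true) | x <- w]).
  + by rewrite /= relabel.
  + by rewrite /positive all_map; apply/allP.
  + by case: (w) wn.
- have h2 : all (fun x : letter => x.1 == x.2) (winv w).
    rewrite /winv all_rev all_map; apply: sub_all h1 => x /=.
    by case: x => [[] []].
  apply: (main false [seq (x.1, true) | x <- winv w]).
  + by rewrite /= relabel.
  + by rewrite /positive all_map; apply/allP.
  + by case: (winv w) winvn.
Qed.
End Tree.

(** * Angles at a vertex of the tree *)

Import numFieldNormedType.Exports.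

Section Arctan.
Variable R : realType.

(** The hypothesis says that a is the cotangent of atan b + atan c, and
b + c > 0 places this angle between 0 and pi. *)
Lemma atan_triple (a b c : R) : a * b + b * c + c * a = 1 -> 0 < b + c ->
  atan a + atan b + atan c = pi / 2.
Proof.
move=> abc bc; pose x := atan b; pose y := atan c.
have bx : b = tan x by rewrite /x atanK.
have cy : c = tan y by rewrite /y atanK.
have rng z : 0 < cos (atan z : R).
  by rewrite cos_gt0_pihalf // atan_gtNpi2 atan_ltpi2.
have cx := rng b; have cyp := rng c; rewrite -/x in cx; rewrite -/y in cyp.
have [x1 x2] := (atan_gtNpi2 b, atan_ltpi2 b).
have [y1 y2] := (atan_gtNpi2 c, atan_ltpi2 c).
rewrite -/x in x1 x2; rewrite -/y in y1 y2.
have sxy : sin (x + y) = cos x * cos y * (b + c).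
  by rewrite sinD bx cy /tan; field; rewrite !gt_eqF.
have cxy : cos (x + y) = cos x * cos y * (1 - b * c).
  by rewrite cosD bx cy /tan; field; rewrite !gt_eqF.
have s0 : 0 < sin (x + y) by rewrite sxy !mulr_gt0.
have a_cot : a = cos (x + y) / sin (x + y).
  rewrite sxy cxy; have -> : 1 - b * c = a * (b + c) by rewrite -abc; ring.
  by field; rewrite !gt_eqF.
have xy0 : 0 < x + y.
  rewrite ltNge; apply/negP => h; move: s0; rewrite -[x + y]opprK sinN oppr_gt0 ltNge => /negP; apply.
  by apply: sin_ge0_pi; apply/andP; split; lra.
have xypi : x + y < pi by lra.
suff -> : atan a = pi / 2 - (x + y) by rewrite -/x -/y; lra.
rewrite a_cot -[RHS]tanK; last by rewrite in_itv /=; apply/andP; split; lra.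
by congr atan; rewrite /tan -[pi / 2 - _]opprB cosN sinN cosB sinB cos_pihalf sin_pihalf; field; rewrite gt_eqF.
Qed.

Lemma atan_inv (u : R) : 0 < u -> atan u + atan u^-1 = pi / 2.
Proof.
move=> u0; rewrite -[LHS]addr0 -(atan0 R); apply: atan_triple.
  by rewrite divff ?gt_eqF // mulr0 mul0r !addr0.
by rewrite addr0 invr_gt0.
Qed.

Lemma atan_increment (v u : R) : 0 <= v -> v <= u ->
  (u - v) / (1 + u ^+ 2) <= atan u - atan v <= u - v.
Proof.
move=> v0; rewrite le_eqVlt => /orP[/eqP ->|vu]; first by rewrite !subrr mul0r lexx.
have der (x : R) : x \in `]v, u[ -> is_derive x 1 (@atan R) (1 + x ^+ 2)^-1.
  by move=> _; exact: is_derive1_atan.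
have cont : {within `[v, u], continuous (@atan R)}.
  by apply: continuous_subspaceT => x; exact: continuous_atan.
have [c] := @MVT R (@atan R) (fun x => (1 + x ^+ 2)^-1) v u vu der cont.
rewrite in_itv /= => /andP[vc cu] ->.
have p t : 0 < 1 + t ^+ 2 :> R by rewrite ltr_wpDr ?sqr_ge0.
have uv : 0 <= u - v by rewrite subr_ge0 ltW.
apply/andP; split.
  rewrite mulrC ler_wpM2r // lef_pV2 ?posrE // lerD2l.
  by rewrite lerXn2r ?nnegrE ?ltW //; lra.
by rewrite ler_piMl // invf_le1 // lerDl sqr_ge0.
Qed.

Lemma atan_ge (u : R) : 0 < u -> u / (1 + u ^+ 2) <= atan u.
Proof.
by move=> u0; have /andP[] := atan_increment (lexx 0) (ltW u0); rewrite atan0 !subr0.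
Qed.
Lemma atan_le (u : R) : 0 < u -> atan u <= u.
Proof.
by move=> u0; have /andP[] := atan_increment (lexx 0) (ltW u0); rewrite atan0 !subr0.
Qed.
End Arctan.

Section Angles.
Variable R : realType.
Variable D : R.
Hypothesis D0 : 0 < D.
Implicit Types x y z m : R.

(** The term of the series for a geodesic with trace x, where D stands for
2 cosh (l_delta / 4). *)
Definition gap x : R := atan (D / Num.sqrt (x ^+ 2 - 4)).
(** Attached to the edge of the tree with regions of traces x and y on its two
sides, directed towards the region of trace z: twice the sum of all the gaps
from there on, once the tails in [gap_sum_tail] are known to vanish. *)
Definition rest x y z : R := let w := 2 * z - x * y in
  3 * pi / 2 - gap x - gap y - atan (w / (2 * D)) - atan (w / (y * D)) - atan (w / (x * D)).
(** The equation between the traces x, y, z of X, Y, X Y when the trace of the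
commutator of X and Y is 2 - D ^+ 2. *)
Definition markoff x y z := x ^+ 2 + y ^+ 2 + z ^+ 2 - x * y * z = 4 - D ^+ 2.

Lemma markoff_child1 x y z : markoff x y z -> markoff x z (x * z - y).
Proof. by rewrite /markoff => <-; ring. Qed.
Lemma markoff_child2 x y z : markoff x y z -> markoff z y (z * y - x).
Proof. by rewrite /markoff => <-; ring. Qed.
Lemma markoff_flip x y z : markoff x y z -> markoff x y (x * y - z).
Proof. by rewrite /markoff => <-; ring. Qed.

Lemma sqrt_gt0 x : 2 < x -> 0 < Num.sqrt (x ^+ 2 - 4).
Proof. by move=> x2; rewrite sqrtr_gt0; nra. Qed.
Lemma sqrt_sqr x : 2 < x -> Num.sqrt (x ^+ 2 - 4) ^+ 2 = x ^+ 2 - 4.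
Proof. by move=> x2; rewrite sqr_sqrtr //; nra. Qed.

Lemma gap_gt0 x : 2 < x -> 0 < gap x.
Proof. by move=> x2; rewrite -(atan0 R) lt_atan // divr_gt0 // sqrt_gt0. Qed.

Lemma gapE x : 2 < x -> gap x = pi / 2 - atan (Num.sqrt (x ^+ 2 - 4) / D).
Proof.
move=> x2; have := @atan_inv R (D / Num.sqrt (x ^+ 2 - 4)).
by rewrite divr_gt0 ?sqrt_gt0 // invf_div => /(_ isT); rewrite /gap; lra.
Qed.

(** By the equation, the products in pairs of the three tangents add up to 1. *)
Lemma vertex_angles x y z : 2 < x -> 0 < y -> 0 < z -> markoff x y z ->
  atan ((y * z - 2 * x) / (2 * D)) + atan ((x * y - 2 * z) / (y * D)) +
  atan ((x * z - 2 * y) / (z * D)) = pi / 2.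
Proof.
move=> x2 y0 z0 mk; have Dn := lt0r_neq0 D0; have yn := lt0r_neq0 y0; have zn := lt0r_neq0 z0.
apply: atan_triple.
  have -> : (y * z - 2 * x) / (2 * D) * ((x * y - 2 * z) / (y * D)) +
    (x * y - 2 * z) / (y * D) * ((x * z - 2 * y) / (z * D)) +
    (x * z - 2 * y) / (z * D) * ((y * z - 2 * x) / (2 * D)) =
    (4 - (x ^+ 2 + y ^+ 2 + z ^+ 2 - x * y * z)) / D ^+ 2.
    by field; rewrite yn zn Dn.
  by rewrite (mk : _ = _); field.
have -> : (x * y - 2 * z) / (y * D) + (x * z - 2 * y) / (z * D) =
   2 * (x ^+ 2 - (x ^+ 2 + y ^+ 2 + z ^+ 2 - x * y * z)) / (y * z * D).
  by field; rewrite yn zn Dn.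
rewrite mk divr_gt0 ?mulr_gt0 //; have := sqr_ge0 D; nra.
Qed.

(** The three instances of [vertex_angles] at the vertex where the regions x,
y and z meet. *)
Lemma rest_split x y z : 2 < x -> 2 < y -> 2 < z -> markoff x y z ->
  rest x y z = 2 * gap z + rest x z (x * z - y) + rest z y (z * y - x).
Proof.
move=> x2 y2 z2 mk; rewrite /rest.
have x0 : 0 < x by lra. have y0 : 0 < y by lra. have z0 : 0 < z by lra.
have mk2 : markoff y x z by move: mk; rewrite /markoff => <-; ring.
have mk3 : markoff z x y by move: mk; rewrite /markoff => <-; ring.
have v1 := vertex_angles x2 y0 z0 mk.
have v2 := vertex_angles y2 x0 z0 mk2.
have v3 := vertex_angles z2 x0 y0 mk3.
have -> : 2 * (x * z - y) - x * z = x * z - 2 * y by ring.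
have -> : 2 * (z * y - x) - z * y = y * z - 2 * x by ring.
have neg t : atan ((2 * z - x * y) / t) = - atan ((x * y - 2 * z) / t).
  have -> : 2 * z - x * y = - (x * y - 2 * z) by ring.
  by rewrite mulNr atanN.
rewrite !neg; move: v1 v2 v3; rewrite (mulrC y x) (mulrC z x) (mulrC z y).
by move: (pi : R) => p; lra.
Qed.

(** The two directions of an edge have opposite values of w. *)
Lemma rest_root x y z : rest x y z + rest x y (x * y - z) + 2 * gap x + 2 * gap y = 3 * pi.
Proof.
rewrite /rest; have -> : 2 * (x * y - z) - x * y = - (2 * z - x * y) by ring.
by rewrite !mulNr !atanN; move: (pi : R) => p; lra.
Qed.

(** By the equation, w is at most y times the square root of x ^+ 2 - 4, and
symmetrically; so the two last angles of the rest are bounded by the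
complements of the gaps of x and y, and the first one by pi / 2. *)
Lemma rest_ge0 x y z : 2 < x -> 2 < y -> 2 < z -> markoff x y z -> 0 <= rest x y z.
Proof.
move=> x2 y2 z2 mk; rewrite /rest !gapE //; set w := 2 * z - x * y.
have x0 : 0 < x by lra. have y0 : 0 < y by lra.
have w2 : w ^+ 2 = x ^+ 2 * y ^+ 2 - 4 * (x ^+ 2 + y ^+ 2 - 4 + D ^+ 2).
  rewrite /w; have -> : D ^+ 2 = 4 - (x ^+ 2 + y ^+ 2 + z ^+ 2 - x * y * z) by rewrite mk; ring.
  by ring.
have le a b : 2 < a -> 0 < b -> w ^+ 2 <= b ^+ 2 * (a ^+ 2 - 4) ->
    atan (w / (b * D)) <= atan (Num.sqrt (a ^+ 2 - 4) / D).
  move=> a2 b0 h; apply: le_atan.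
  rewrite invfM mulrA; apply: ler_wpM2r; first by rewrite invr_ge0 ltW.
  rewrite ler_pdivrMr //.
  have [w0|w0] := lerP 0 w; last by rewrite ltW // (lt_le_trans w0) // mulr_ge0 ?sqrtr_ge0 // ltW.
  have sb : 0 <= Num.sqrt (a ^+ 2 - 4) * b by rewrite mulr_ge0 ?sqrtr_ge0 // ltW.
  by rewrite -ler_sqr ?nnegrE // exprMn sqrt_sqr // [X in _ <= X]mulrC.
have D2 := sqr_ge0 D.
have h1 := le x y x2 y0; have h2 := le y x y2 x0.
have {}h1 := h1 _; have {}h2 := h2 _.
have k1 : w ^+ 2 <= y ^+ 2 * (x ^+ 2 - 4) by rewrite w2; nra.
have k2 : w ^+ 2 <= x ^+ 2 * (y ^+ 2 - 4) by rewrite w2; nra.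
move: (h1 k1) (h2 k2) (atan_ltpi2 (w / (2 * D))); move: (pi : R) => p; lra.
Qed.
End Angles.

(** * Vanishing of the tails *)

Section Tails.
Variable R : realType.
Variable D : R.
Hypothesis D2 : 2 < D.
Implicit Types (x y z m : R).
Local Notation gap := (gap D).
Local Notation rest := (rest D).
Local Notation markoff := (markoff D).
Let D0 : 0 < D. Proof. exact: lt_trans D2. Qed.

Definition markoff_state x y z := [/\ 2 < x, 2 < y, 2 < z & markoff x y z].

Lemma markoff_third x y z : 2 < x -> 2 < y -> markoff x y z -> 2 < z.
Proof.
move=> x2 y2 mk; apply: markoff_gt2 x2 y2 _; rewrite (mk : _ = _) subr_lt0.
have -> : (4 : R) = 2 ^+ 2 by ring.
by rewrite ltr_pXn2r // nnegrE ltW.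
Qed.

Lemma markoff_state_child1 x y z : markoff_state x y z -> markoff_state x z (x * z - y).
Proof.
move=> [x2 y2 z2 mk]; have mk1 := markoff_child1 mk.
by split=> //; exact: markoff_third mk1.
Qed.

Lemma markoff_state_child2 x y z : markoff_state x y z -> markoff_state z y (z * y - x).
Proof.
move=> [x2 y2 z2 mk]; have mk1 := markoff_child2 mk.
by split=> //; exact: markoff_third mk1.
Qed.

(** Beyond the directed edge (x, y, z): the gaps of depth less than n, the
rests at depth n, and the gaps at depth n. *)
Fixpoint gap_sum n x y z := if n is n'.+1 then
  gap z + gap_sum n' x z (x * z - y) + gap_sum n' z y (z * y - x) else 0.
Fixpoint tail n x y z := if n is n'.+1 then
  tail n' x z (x * z - y) + tail n' z y (z * y - x) else rest x y z.
Fixpoint level n x y z := if n is n'.+1 then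
  level n' x z (x * z - y) + level n' z y (z * y - x) else gap z.

Lemma gap_sum_tail n x y z : markoff_state x y z ->
  2 * gap_sum n x y z + tail n x y z = rest x y z.
Proof.
elim: n x y z => [|n IH] x y z s /=; first by rewrite mulr0 add0r.
have h1 := IH _ _ _ (markoff_state_child1 s); have h2 := IH _ _ _ (markoff_state_child2 s).
case: s => x2 y2 z2 mk; rewrite (rest_split D0 x2 y2 z2 mk) -h1 -h2; ring.
Qed.

Lemma tail_ge0 n x y z : markoff_state x y z -> 0 <= tail n x y z.
Proof.
elim: n x y z => [|n IH] x y z s /=; first by case: s => *; exact: rest_ge0.
by rewrite addr_ge0 // IH //; [exact: markoff_state_child1 | exact: markoff_state_child2].
Qed.

Lemma gap_sumS n x y z : gap_sum n.+1 x y z = gap_sum n x y z + level n x y z.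
Proof.
elim: n x y z => [|n IH] x y z; first by rewrite /= !addr0 add0r.
have -> : gap_sum n.+2 x y z =
  gap z + gap_sum n.+1 x z (x * z - y) + gap_sum n.+1 z y (z * y - x) by [].
by rewrite (IH x z) (IH z y) /=; ring.
Qed.

(** An edge directed away from the root: z is the larger root of the equation
that has x and y given. This property, and the lower bound m for the traces,
pass on to the following edges. *)
Definition outward m x y z := [/\ m <= x, m <= y, m <= z, x * y <= 2 * z & markoff x y z].

Lemma outward_state m x y z : 2 < m -> outward m x y z -> markoff_state x y z.
Proof. by move=> m2 [h1 h2 h3 _ mk]; split=> //; exact: lt_le_trans m2 _. Qed.

Lemma outward_child m x y z : 2 < m -> outward m x y z -> outward m x z (x * z - y).
Proof.
move=> m2 [h1 h2 h3 xy mk]; have x0 : 0 < x by lra.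
have zx : x * y <= 2 * z := xy.
have k : 2 * y <= x * z.
  have x24 : 4 <= x ^+ 2 by nra.
  have z0 : 0 <= z by lra.
  have := ler_wpM2r z0 x24; rewrite -(ler_pM2l x0); nra.
split=> //; [|lra|exact: markoff_child1].
have : 2 * z <= x * z by rewrite ler_pM2r //; lra.
have : y <= z by rewrite -(ler_pM2l (_ : 0 < 2 :> R)) //; nra.
nra.
Qed.

Lemma outward_sym m x y z : outward m x y z -> outward m y x z.
Proof.
case=> h1 h2 h3 xy mk; split=> //; first by rewrite mulrC.
by move: mk; rewrite /markoff => <-; ring.
Qed.

Lemma rest_sym x y z : rest x y z = rest y x z.
Proof. by rewrite /rest (mulrC y x); ring. Qed.

Definition decay m : R := (2 * D + 4 * (1 + D ^+ 2) / D) / ((m ^+ 2 - 4) / m ^+ 2).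

(** Beyond an edge that leads to a large z, two angles in the rest are close
to pi / 2 and the third one nearly cancels with the gap of x, all within a
multiple of 1 / z. *)
Lemma child_rest_le m x y z : 2 < m -> outward m x y z ->
  rest x z (x * z - y) <= decay m / z.
Proof.
move=> m2 g; have [x2 y2 z2 mk] := outward_state m2 g; case: g => mx my mz xy _.
have x0 : 0 < x by lra. have y0 : 0 < y by lra. have z0 : 0 < z by lra. have m0 : 0 < m by lra.
(* d compares x ^+ 2 - 4 with x ^+ 2 uniformly in x >= m *)
pose d := (m ^+ 2 - 4) / m ^+ 2; have dE : d = (m ^+ 2 - 4) / m ^+ 2 by [].
have m24 : 0 < m ^+ 2 - 4 by nra.
have d0 : 0 < d by rewrite divr_gt0 // exprn_gt0.
have dm : d * m ^+ 2 = m ^+ 2 - 4 by rewrite /d divfK // gt_eqF // exprn_gt0.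
have d1 : d < 1 by rewrite /d ltr_pdivrMr ?exprn_gt0 //; lra.
clearbody d.
have xx : d * x ^+ 2 <= x ^+ 2 - 4.
  have : (1 - d) * m ^+ 2 <= (1 - d) * x ^+ 2.
    by apply: ler_wpM2l; [lra | rewrite ler_sqr ?nnegrE // ltW].
  lra.
pose w := x * z - 2 * y.
have wd : d * x * z <= w.
  rewrite -(ler_pM2l x0).
  have : d * x ^+ 2 * z <= (x ^+ 2 - 4) * z by rewrite ler_pM2r.
  rewrite /w; nra.
have dxz : 0 < d * x * z by exact: mulr_gt0 (mulr_gt0 d0 x0) z0.
have w0 : 0 < w by exact: lt_le_trans wd.
have xz : x <= z by nra.
rewrite /rest (_ : 2 * (x * z - y) - x * z = w); last by rewrite /w; ring.
have wE : w ^+ 2 = z ^+ 2 * (x ^+ 2 - 4) - 4 * (x ^+ 2 - 4 + D ^+ 2).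
  rewrite /w; have -> : D ^+ 2 = 4 - (x ^+ 2 + y ^+ 2 + z ^+ 2 - x * y * z).
    by rewrite (mk : _ = _); ring.
  by ring.
pose s := Num.sqrt (x ^+ 2 - 4).
have s0 : 0 < s by exact: sqrt_gt0.
have s2 : s ^+ 2 = x ^+ 2 - 4 by exact: sqrt_sqr.
have inv (v : R) : 0 < v -> pi / 2 - atan v <= v^-1.
  by move=> v0; have := atan_inv v0; have := @atan_le R v^-1; rewrite invr_gt0 => /(_ v0); lra.
have b1 : pi / 2 - atan (w / (2 * D)) <= D / (d * z).
  apply: le_trans (inv _ _) _; first by rewrite divr_gt0 // mulr_gt0.
  rewrite invf_div ler_pdivrMr // mulrAC ler_pdivlMr ?mulr_gt0 //.
  have : d * (2 * z) <= w by apply: le_trans wd; rewrite -mulrA ler_pM2l // ler_pM2r // ltW.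
  by move=> h; rewrite (mulrC 2 D) -mulrA ler_pM2l //; move: h; rewrite mulrCA.
have b3 : pi / 2 - atan (w / (x * D)) <= D / (d * z).
  apply: le_trans (inv _ _) _; first by rewrite divr_gt0 // mulr_gt0.
  rewrite invf_div ler_pdivrMr // mulrAC ler_pdivlMr ?mulr_gt0 //.
  rewrite (mulrC x D) -mulrA ler_pM2l //; apply: le_trans wd.
  by rewrite mulrCA mulrA.
have b2 : pi / 2 - gap x - atan (w / (z * D)) <= 4 * (1 + D ^+ 2) / D / (d * z).
  rewrite gapE // -/s.
  have ws : w / z <= s.
    rewrite ler_pdivrMr // -ler_sqr ?nnegrE ?mulr_ge0 ?ltW // exprMn s2 wE.
    have := sqr_ge0 D; nra.
  have v0 : 0 <= w / (z * D) by rewrite divr_ge0 ?mulr_ge0 ?ltW.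
  have vs : w / (z * D) <= s / D by rewrite invfM mulrA ler_pM2r // invr_gt0.
  have /andP[_ h] := atan_increment v0 vs.
  have -> : pi / 2 - (pi / 2 - atan (s / D)) - atan (w / (z * D)) = atan (s / D) - atan (w / (z * D)).
    by move: (pi : R) => p; lra.
  apply: le_trans h _.
  have -> : s / D - w / (z * D) = (s - w / z) / D by field; rewrite !gt_eqF.
  have -> : 4 * (1 + D ^+ 2) / D / (d * z) = (4 * (1 + D ^+ 2) / (d * z)) / D by rewrite mulrAC.
  rewrite ler_pM2r ?invr_gt0 // ler_pdivlMr ?mulr_gt0 //.
  have e1 : (s - w / z) * (s + w / z) * z ^+ 2 = 4 * (x ^+ 2 - 4 + D ^+ 2).
    transitivity (s ^+ 2 * z ^+ 2 - w ^+ 2); first by field; rewrite gt_eqF.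
    by rewrite s2 wE; ring.
  have sw : 0 <= s - w / z by rewrite subr_ge0.
  have e2 : (s - w / z) * (d * x * z) * z <= 4 * (x ^+ 2 - 4 + D ^+ 2).
    rewrite -e1 -[X in X <= _]mulrA -[X in _ <= X]mulrA; apply: ler_wpM2l => //.
    have : d * x * z <= w := wd.
    have : 0 <= s * z ^+ 2 by rewrite mulr_ge0 ?sqr_ge0 // ltW.
    have -> : (s + w / z) * z ^+ 2 = s * z ^+ 2 + w * z by field; rewrite gt_eqF.
    have : d * x * z * z <= w * z by rewrite ler_pM2r.
    by lra.
  have e3 : 4 * (x ^+ 2 - 4 + D ^+ 2) <= 4 * (1 + D ^+ 2) * (x * z).
    have : x ^+ 2 <= x * z by rewrite expr2 ler_pM2l.
    have : D ^+ 2 * 1 <= D ^+ 2 * (x * z).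
      by rewrite ler_pM2l ?exprn_gt0 //; nra.
    nra.
  have xz0 : 0 < x * z by rewrite mulr_gt0.
  rewrite -(ler_pM2r xz0); apply: le_trans e3; apply: le_trans e2.
  by rewrite le_eqVlt; apply/orP; left; apply/eqP; ring.
have -> : decay m / z = D / (d * z) + D / (d * z) + 4 * (1 + D ^+ 2) / D / (d * z).
  by rewrite /decay -dE; field; rewrite !gt_eqF.
have gz := gap_gt0 D0 z2.
move: b1 b2 b3; move: (pi : R) => p b1 b2 b3; lra.
Qed.

Definition tail_const m : R := 2 * (decay m * ((1 + D ^+ 2) / D)).

Lemma decay_gt0 m : 2 < m -> 0 < decay m.
Proof.
move=> m2; have m24 : 0 < m ^+ 2 - 4 by nra.
have D2' : 0 < 1 + D ^+ 2 by rewrite ltr_wpDr ?sqr_ge0.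
have m2p : 0 < m ^+ 2 by rewrite exprn_gt0 //; lra.
have t1 : 0 < 2 * D by rewrite mulr_gt0.
have t2 : 0 < 4 * (1 + D ^+ 2) / D by rewrite divr_gt0 // mulr_gt0.
by apply: divr_gt0; [exact: addr_gt0 | exact: divr_gt0].
Qed.

Lemma inv_le_gap z : 2 < z -> z^-1 <= (1 + D ^+ 2) / D * gap z.
Proof.
move=> z2; have z0 : 0 < z by lra.
have D2' : 0 < 1 + D ^+ 2 by rewrite ltr_wpDr ?sqr_ge0.
have sz : Num.sqrt (z ^+ 2 - 4) <= z.
  rewrite -[X in _ <= X](ger0_norm (ltW z0)) -sqrtr_sqr ler_wsqrtr // gerBl //.
have u0 : 0 < D / z by rewrite divr_gt0.
have h1 : atan (D / z) <= gap z.
  by apply: le_atan; rewrite ler_pM2l // lef_pV2 ?posrE // sqrt_gt0.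
have h2 := atan_ge u0.
have h3 : D / z / (1 + D ^+ 2) <= gap z.
  apply: le_trans h1; apply: le_trans h2; rewrite ler_pM2l // lef_pV2 ?posrE //; last first.
    by rewrite ltr_wpDr ?sqr_ge0.
  have h : D / z <= D by rewrite ler_pdivrMr // ler_peMr ?ltW //; lra.
  by rewrite lerD2l lerXn2r // nnegrE ltW.
have -> : z^-1 = (1 + D ^+ 2) / D * (D / z / (1 + D ^+ 2)) by field; rewrite !gt_eqF.
by rewrite ler_pM2l // divr_gt0.
Qed.

(** For one edge, both quantities are of the order of 1 / z, by
[child_rest_le] and [inv_le_gap]. *)
Lemma tail_le m n x y z : 2 < m -> outward m x y z ->
  tail n.+1 x y z <= tail_const m * level n x y z.
Proof.
move=> m2; elim: n x y z => [|n IH] x y z g.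
  have [x2 y2 z2 mk] := outward_state m2 g.
  rewrite [tail _ _ _ _]/= [level _ _ _ _]/=.
  have h1 := child_rest_le m2 g.
  have h2 : rest z y (z * y - x) <= decay m / z.
    by rewrite rest_sym mulrC; exact: child_rest_le (outward_sym g).
  have h3 : decay m / z <= decay m * ((1 + D ^+ 2) / D * gap z).
    by rewrite ler_pM2l ?decay_gt0 // inv_le_gap.
  rewrite mulrA in h3; rewrite /tail_const -mulrA; move: h1 h2 h3.
  by move: (decay m * _ * _) (decay m / z) => t u h1 h2 h3; lra.
have -> : tail n.+2 x y z = tail n.+1 x z (x * z - y) + tail n.+1 z y (z * y - x) by [].
rewrite [level _ _ _ _]/= mulrDr lerD //.
  exact: IH (outward_child m2 g).
have g2 := outward_sym (outward_child m2 (outward_sym g)).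
by rewrite [z * y]mulrC; exact: IH g2.
Qed.

Lemma level_ge0 n x y z : markoff_state x y z -> 0 <= level n x y z.
Proof.
elim: n x y z => [|n IH] x y z s /=; first by case: s => _ _ z2 _; rewrite ltW // gap_gt0.
by rewrite addr_ge0 // IH //; [exact: markoff_state_child1 | exact: markoff_state_child2].
Qed.

Lemma gap_sum_ge0 n x y z : markoff_state x y z -> 0 <= gap_sum n x y z.
Proof.
move=> s; elim: n => [//|n IH]; by rewrite gap_sumS addr_ge0 // level_ge0.
Qed.

(** Otherwise the gaps of each depth would have a sum bounded below, by
[tail_le], and the sum of all of them would be infinite; but [gap_sum_tail]
bounds it. *)
Lemma tail_small m x y z (eps : R) : 2 < m -> outward m x y z -> 0 < eps ->
  exists n, tail n x y z < eps.
Proof.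
move=> m2 g e0; have s := outward_state m2 g.
have C0 : 0 < tail_const m.
  have p := decay_gt0 m2; have q : 0 < (1 + D ^+ 2) / D.
    by rewrite divr_gt0 // ltr_wpDr ?sqr_ge0.
  by rewrite /tail_const; apply: mulr_gt0 => //; exact: mulr_gt0.
pose d := eps / tail_const m; have d0 : 0 < d by rewrite divr_gt0.
apply: contrapT => H.
have big n : eps <= tail n x y z.
  by rewrite leNgt; apply/negP => h; apply: H; exists n.
have lev n : d <= level n x y z.
  rewrite ler_pdivrMr // mulrC; exact: le_trans (big n.+1) (tail_le n m2 g).
have sum n : n%:R * d <= gap_sum n x y z.
  elim: n => [|n IH]; first by rewrite mul0r.
  by rewrite gap_sumS -natr1 mulrDl mul1r lerD.
have bound n : n%:R * d <= rest x y z.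
  apply: le_trans (sum n) _; rewrite -(gap_sum_tail n s).
  have := tail_ge0 n s; have := gap_sum_ge0 n s; lra.
have := bound (Num.truncn (rest x y z / d)).+1.
apply/negP; rewrite -ltNge -ltr_pdivrMr //.
exact: truncnS_gt.
Qed.

Lemma tail_nonincreasing n x y z : markoff_state x y z -> tail n.+1 x y z <= tail n x y z.
Proof.
move=> s; have := gap_sum_tail n s; rewrite -(gap_sum_tail n.+1 s) gap_sumS.
have := level_ge0 n s; lra.
Qed.

Lemma tail_mono n k x y z : markoff_state x y z -> (n <= k)%N -> tail k x y z <= tail n x y z.
Proof.
move=> s /subnK <-; elim: (k - n)%N => [|j IH]; first by rewrite add0n.
by rewrite addSn; apply: le_trans IH; exact: tail_nonincreasing.
Qed.

(** All three edges at the vertex (x, y, z) are directed away from it. *)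
Definition reduced_triple x y z := [/\ 2 * z <= x * y, 2 * y <= x * z & 2 * x <= y * z].

(** [rest_root] with [gap_sum_tail] for both directions of the edge between
the regions x and y; by reducedness, all the edges that follow are directed
outward, so that the tails vanish. *)
Lemma gap_sum_limit x y z (eps : R) : markoff_state x y z -> reduced_triple x y z -> 0 < eps ->
  exists n, forall k, (n <= k)%N -> 3 * pi / 2 - eps <
    gap x + gap y + gap_sum k x y z + gap_sum k x y (x * y - z) <= 3 * pi / 2.
Proof.
move=> s [r1 r2 r3] e0; have [x2 y2 z2 mk] := s.
pose m := Num.min x (Num.min y z).
have mx : m <= x by rewrite ge_min lexx.
have my : m <= y by rewrite !ge_min lexx orbT.
have mz : m <= z by rewrite !ge_min lexx !orbT.
have m2 : 2 < m by rewrite !lt_min x2 y2 z2.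
have s' : markoff_state x y (x * y - z).
  by have mk' := markoff_flip mk; split=> //; exact: markoff_third mk'.
have g1 : outward m x z (x * z - y).
  split=> //; [|lra|exact: markoff_child1].
  by have : 2 * y <= x * z := r2; nra.
have g2 : outward m z y (z * y - x).
  split=> //; [|lra|exact: markoff_child2].
  by have : 2 * x <= y * z := r3; nra.
have g3 : outward m x y (x * y - z).
  split=> //; [nra|lra|exact: markoff_flip].
have e3 : 0 < eps / 2 by rewrite divr_gt0.
have [n1 h1] := tail_small m2 g1 e3; have [n2 h2] := tail_small m2 g2 e3.
have [n3 h3] := tail_small m2 g3 e3.
exists (maxn n1.+1 (maxn n2.+1 n3)) => k; rewrite !geq_max => /and3P[k1 k2 k3].
have t := gap_sum_tail k s; have t' := gap_sum_tail k s'.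
have p := tail_ge0 k s; have p' := tail_ge0 k s'.
have root := rest_root D x y z.
have sm' : tail k x y (x * y - z) < eps / 2 by exact: le_lt_trans (tail_mono s' k3) h3.
have sm : tail k x y z < eps.
  case: k k1 k2 {k3 t t' p p' sm'} => // k k1 k2 /=.
  have a1 := le_lt_trans (tail_mono (n := n1) (k := k) (markoff_state_child1 s) k1) h1.
  have a2 := le_lt_trans (tail_mono (n := n2) (k := k) (markoff_state_child2 s) k2) h2.
  lra.
move: root t t' p p' sm sm'; move: (pi : R) => P root t t' p p' sm sm'.
by apply/andP; split; lra.
Qed.
End Tails.

(** * Existence of a reduced basis *)

Section Reduction.
Variable R : realType.

(** Replacing z by t = x y - z lowers the sum of the three traces by
2 z - x y. If the new triple is not reduced, say x t < 2 y, then the equation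
gives D ^+ 2 <= (y - t) (y + t), which bounds this amount from below. *)
Lemma descent_step (D x y z : R) : markoff_state D x y z -> x * y < 2 * z ->
  ~ reduced_triple x y (x * y - z) -> D ^+ 2 <= (2 * z - x * y) * (x + y + z).
Proof.
move=> [x2 y2 z2 mk] xy nr.
pose t := x * y - z.
have dE : D ^+ 2 = 4 - (x ^+ 2 + y ^+ 2 + t ^+ 2 - x * y * t).
  by have := markoff_flip mk; rewrite -/t => mk'; rewrite (mk' : _ = _); ring.
have wE : 2 * z - x * y = x * y - 2 * t by rewrite /t; ring.
have zE : z = x * y - t by rewrite /t; ring.
have tz : t < z by lra.
rewrite wE in xy *; set w := x * y - 2 * t.
have w0 : 0 < w by rewrite /w -wE; lra.
have main a b : 2 < a -> 2 < b -> a * b = x * y -> a ^+ 2 + b ^+ 2 = x ^+ 2 + y ^+ 2 ->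
    a + b = x + y -> a * t < 2 * b -> D ^+ 2 <= w * (x + y + z).
  move=> a2 b2 ab ab2 abS h.
  have bt : b - t <= w / 2 by rewrite /w -ab; nra.
  have e1 : D ^+ 2 = b * (2 * b - (2 * b - a * t)) - b ^+ 2 - t ^+ 2 - (a ^+ 2 - 4).
    by rewrite dE -ab -ab2; ring.
  have t0 : 0 < b + t \/ b + t <= 0 by case: (ltrP 0 (b + t)); [left|right].
  have b0 : 0 < b * (2 * b - a * t) by rewrite mulr_gt0 //; lra.
  have a24 : 0 < a ^+ 2 - 4 by nra.
  have e2 : D ^+ 2 <= (b - t) * (b + t).
    rewrite e1; have -> : b * (2 * b - (2 * b - a * t)) - b ^+ 2 - t ^+ 2 - (a ^+ 2 - 4) =
      (b - t) * (b + t) - b * (2 * b - a * t) - (a ^+ 2 - 4) by ring.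
    lra.
  have bts : b + t <= x + y + z by lra.
  case: t0 => t0; last first.
    have : 0 <= D ^+ 2 := sqr_ge0 D.
    have : 0 < w * (x + y + z) by rewrite mulr_gt0 //; lra.
    by have : (b - t) * (b + t) <= 0; [nra | lra].
  apply: le_trans e2 _; nra.
case: (ltrP (x * t) (2 * y)) => [h|h1]; first by apply: (main x y) => //; ring.
case: (ltrP (y * t) (2 * x)) => [h|h2]; first by apply: (main y x) => //; ring.
by case: nr; split=> //; rewrite -/t; lra.
Qed.

Variables A0 B0 : 'M[R]_2.
Hypotheses (dA0 : \det A0 = 1) (dB0 : \det B0 = 1).
Hypothesis trK : \tr (comm A0 B0) < -2.
Hypotheses (trA0 : 2 < \tr A0) (trB0 : 2 < \tr B0).
Local Notation G := (generated2 A0 B0).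
Local Notation nielsen := (nielsen A0 B0).
Implicit Types F g h X Y : 'M[R]_2.

(** The number D of the series, equal to 2 cosh (l_delta / 4). *)
Definition hole_const : R := Num.sqrt (2 - \tr (comm A0 B0)).
Local Notation D := hole_const.

Lemma hole_const_sqr : D ^+ 2 = 2 - \tr (comm A0 B0).
Proof. by rewrite sqr_sqrtr // subr_ge0 ltW // (lt_trans trK) //; lra. Qed.

Lemma hole_const_gt2 : 2 < D.
Proof.
have h : (2 : R) ^+ 2 < D ^+ 2.
  rewrite hole_const_sqr; have : (2 : R) ^+ 2 = 4 by ring.
  by move=> ->; move: trK; move: (\tr _) => k; lra.
by move: h; rewrite ltr_pXn2r ?nnegrE ?sqrtr_ge0.
Qed.

Lemma nielsen_state X Y : nielsen X Y -> markoff_state D (\tr X) (\tr Y) (\tr (X * Y)).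
Proof.
move=> n; have [x2 y2] := nielsen_tr dA0 dB0 trK trA0 trB0 n; split=> //.
  exact: (nielsen_tr_head dA0 dB0 trK n).
rewrite /markoff (nielsen_markoff dA0 dB0 n) hole_const_sqr.
move: (\tr _) => k; ring.
Qed.

Lemma tr_left X Y : \det X = 1 -> \tr (X * (X * Y)) = \tr X * \tr (X * Y) - \tr Y.
Proof.
move=> dX; have := tr_mulV (X * Y) dX; rewrite tr_conj // => ->.
rewrite (tr_mulC X (X * Y)) (mulrC (\tr X)); ring.
Qed.
Lemma tr_right X Y : \det Y = 1 -> \tr (X * Y * Y) = \tr (X * Y) * \tr Y - \tr X.
Proof.
move=> dY; have := tr_mulV (X * Y) dY; rewrite mulrK ?det1_unit // => ->; ring.
Qed.
Lemma tr_flip X Y : \det Y = 1 -> \tr (X * Y^-1) = \tr X * \tr Y - \tr (X * Y).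
Proof. exact: tr_mulV. Qed.

Definition reduced_basis X Y := reduced_triple (\tr X) (\tr Y) (\tr (X * Y)).

(** As long as the basis is not reduced, a move lowers the sum of its three
traces, by at least D ^+ 2 divided by the initial sum except perhaps in the
last step; the sum being positive, the process ends. *)
Lemma reduced_basis_exists : exists X Y, nielsen X Y /\ reduced_basis X Y.
Proof.
pose sum X Y := \tr X + \tr Y + \tr (X * Y).
pose S0 := sum A0 B0.
have spos X Y : nielsen X Y -> 0 < sum X Y.
  by case/nielsen_state => x2 y2 z2 _; rewrite /sum; lra.
have n0 : nielsen A0 B0 by exact: nielsen_refl.
have S00 : 0 < S0 := spos _ _ n0.
pose d := D ^+ 2 / S0.
have d0 : 0 < d by rewrite divr_gt0 // exprn_gt0 // (lt_trans _ hole_const_gt2).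
have ind (k : nat) : forall X Y, nielsen X Y -> sum X Y <= S0 -> sum X Y <= k%:R * d ->
   exists X Y, nielsen X Y /\ reduced_basis X Y.
  elim: k => [|k IH] X Y n sS sk.
    by have := spos _ _ n; rewrite ltNge; move: sk; rewrite mul0r => ->.
  have [dX dY] := nielsen_det dA0 dB0 n.
  case: (pselect (reduced_basis X Y)) => [h|nr]; first by exists X, Y.
  (* a descent either reaches a reduced basis or gains at least d *)
  have go X' Y' x y z : nielsen X' Y' -> markoff_state D x y z -> x * y < 2 * z ->
      x + y + z = sum X Y -> \tr X' = x -> \tr Y' = y -> \tr (X' * Y') = x * y - z ->
      exists X Y, nielsen X Y /\ reduced_basis X Y.
    move=> n' st xy sE tx ty tz.
    case: (pselect (reduced_basis X' Y')) => [h|nr']; first by exists X', Y'.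
    have h : D ^+ 2 <= (2 * z - x * y) * (x + y + z).
      by apply: descent_step => //; move: nr'; rewrite /reduced_basis tx ty tz.
    have w0 : 0 < 2 * z - x * y by rewrite subr_gt0.
    have gain : d <= 2 * z - x * y.
      by rewrite ler_pdivrMr //; apply: le_trans h _; rewrite sE ler_pM2l.
    have sE' : sum X' Y' = sum X Y - (2 * z - x * y) by rewrite -sE /sum tx ty tz; ring.
    apply: (IH X' Y') => //; rewrite sE'; first by lra.
    by move: sk; rewrite -natr1 mulrDl mul1r; lra.
  have [x2 y2 z2 mk] := nielsen_state n.
  case: (ltrP (\tr X * \tr Y) (2 * \tr (X * Y))) => [h1|h1].
    by apply: (go X Y^-1) h1 _ _ _ _ => //; [exact: nielsen_inv | exact: tr_inv | exact: tr_flip].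
  case: (ltrP (\tr X * \tr (X * Y)) (2 * \tr Y)) => [h2|h2].
    apply: (go X (X * Y)) h2 _ _ _ _ => //; [exact: nielsen_left | | | exact: tr_left].
    - by split=> //; move: mk; rewrite /markoff => <-; ring.
    - by rewrite /sum; ring.
  case: (ltrP (\tr Y * \tr (X * Y)) (2 * \tr X)) => [h3|h3].
    apply: (go (X * Y) Y (\tr (X * Y)) (\tr Y) (\tr X)) => //; last exact: tr_right.
    - exact: nielsen_right.
    - by split=> //; move: mk; rewrite /markoff => <-; ring.
    - by rewrite mulrC.
    - by rewrite /sum; ring.
  by case: nr.
pose k := (Num.truncn (S0 / d)).+1.
apply: (ind k A0 B0) => //.
by rewrite -ler_pdivrMr // ltW // truncnS_gt.
Qed.
End Reduction.

(** * Homology classes of the regions *)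

Section Abelianization.
Variable R : realType.
Variables A0 B0 : 'M[R]_2.
Hypotheses (dA0 : \det A0 = 1) (dB0 : \det B0 = 1).
Hypothesis discrete : forall z, upper_half_plane z ->
  exists2 r : R, 0 < r & forall w : word, reduced w -> w != [::] ->
      r <= hdist z (mobius (eval_word A0 B0 w) z).
Local Notation G := (generated2 A0 B0).
Local Notation nielsen := (nielsen A0 B0).
Implicit Types F g h X Y : 'M[R]_2.

(** The class of g in the abelianization Z^2 of the free group on A0 and B0. *)
Definition homology g (v : int * int) := exists w,
  [/\ eval_word A0 B0 w = g, expoA w = v.1 & expoB w = v.2].

Lemma expo_cat w1 w2 : expoA (w1 ++ w2) = expoA w1 + expoA w2 /\
  expoB (w1 ++ w2) = expoB w1 + expoB w2.
Proof. by rewrite /expoA /expoB !big_cat. Qed.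

Lemma expo_winv w : expoA (winv w) = - expoA w /\ expoB (winv w) = - expoB w.
Proof.
elim: w => [|x w [IHA IHB]]; first by rewrite /expoA /expoB !big_nil oppr0.
rewrite /winv map_cons rev_cons -cats1 !(expo_cat _ _).1 !(expo_cat _ _).2 -/(winv w).
have nA : expoA [::] = 0 by rewrite /expoA big_nil.
have nB : expoB [::] = 0 by rewrite /expoB big_nil.
rewrite IHA IHB !expoA_cons !expoB_cons nA nB !addr0 !opprD.
by split; rewrite addrC; congr (_ - _); case: (x) => [[] []].
Qed.

Lemma homology1 : homology 1 0.
Proof. by exists [::]; rewrite eval_nil /expoA /expoB !big_nil. Qed.
Lemma homologyM g h u v : homology g u -> homology h v -> homology (g * h) (u + v).
Proof.
move=> [w1 [<- a1 b1]] [w2 [<- a2 b2]]; exists (w1 ++ w2); rewrite eval_cat.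
by rewrite (expo_cat _ _).1 (expo_cat _ _).2 a1 a2 b1 b2.
Qed.
Lemma homologyV g u : homology g u -> homology g^-1 (- u).
Proof.
move=> [w [<- a b]]; exists (winv w); rewrite eval_winv //.
by rewrite (expo_winv _).1 (expo_winv _).2 a b.
Qed.
Lemma homology_G g : G g -> exists v, homology g v.
Proof. by case=> w _ <-; exists (expoA w, expoB w), w. Qed.
Lemma homology_unique g u v : homology g u -> homology g v -> u = v.
Proof.
move=> hu /homologyV hv; have [w [w1 a b]] := homologyM hu hv.
have dg : \det g = 1 by case: hu => w' [<- _ _]; exact: det_eval.
have i0 : 0 < complex.Im (0 +i* (1 : R)) by exact: ltr01.
have wi : mobius (eval_word A0 B0 w) (0 +i* 1) = 0 +i* 1.
  by rewrite w1 divrr ?det1_unit // mobius1.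
have [_ a0 b0] := eval_eq1 dA0 dB0 discrete i0 wi.
apply/eqP; rewrite -subr_eq0; apply/eqP.
by rewrite [LHS]surjective_pairing -a -b a0 b0.
Qed.
Lemma homologyX g u n : homology g u -> homology (g ^+ n) (u *+ n).
Proof.
move=> h; elim: n => [|n IH]; first by rewrite expr0 mulr0n; exact: homology1.
by rewrite exprS mulrS; exact: homologyM.
Qed.
Lemma homologyXz g u (k : int) : homology g u -> homology (g ^ k) (u *~ k).
Proof.
move=> h; case: k => n; first exact: homologyX.
by rewrite NegzE -exprnN mulrNz; apply: homologyV; exact: homologyX.
Qed.
Lemma homology_conj g h u : G g -> homology h u -> homology (g^-1 * h * g) u.
Proof.
move=> /homology_G [v hv] hu; have := homologyM (homologyM (homologyV hv) hu) hv.
by rewrite addrAC addNr add0r.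
Qed.

Definition indep (u v : int * int) := u.1 * v.2 - u.2 * v.1 != 0.

Lemma nielsen_homology X Y : nielsen X Y ->
  exists u v, [/\ homology X u, homology Y v & indep u v].
Proof.
elim=> [|{}X {}Y _ [u [v [hX hY i]]]|{}X {}Y _ [u [v [hX hY i]]]|{}X {}Y _ [u [v [hX hY i]]]].
- exists (1, 0), (0, 1); split=> //.
    by exists [:: (true, true)]; rewrite eval_seq1 /expoA /expoB !big_seq1.
  by exists [:: (false, true)]; rewrite eval_seq1 /expoA /expoB !big_seq1.
- exists u, (- v); split=> //; first exact: homologyV.
  by move: i; rewrite /indep /= !mulrN -opprD oppr_eq0.
- exists u, (u + v); split=> //; first exact: homologyM.
  move: i; rewrite /indep; congr (_ != _); rewrite /=; ring.
- exists (u + v), v; split=> //; first exact: homologyM.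
  move: i; rewrite /indep; congr (_ != _); rewrite /=; ring.
Qed.

(** The exponents of X and Y in the product of the basis at the end of the
path l, enumerated by the Stern-Brocot tree. *)
Fixpoint slope (l : seq bool) : nat * nat := match l with
  | [::] => (1, 1)%N
  | b :: l' => let pq := slope l' in
     if b then (pq.1 + pq.2, pq.2)%N else (pq.1, pq.1 + pq.2)%N end.

Lemma slope_gt0 l : (0 < (slope l).1)%N /\ (0 < (slope l).2)%N.
Proof. by elim: l => // b l [h1 h2]; case: b => /=; rewrite ?addn_gt0 ?h1 ?h2. Qed.

(** The larger entry of the slope tells which move came first. *)
Lemma slope_inj : injective slope.
Proof.
have g0 := slope_gt0; elim=> [|b l IH] [|b' l'] //=.
- by have [h1 h2] := g0 l'; case: b' => -[]; lia.
- by have [h1 h2] := g0 l; case: b => -[]; lia.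
have [h1 h2] := g0 l; have [h3 h4] := g0 l'.
case: b b' => [] [] [e1 e2]; try lia.
  by congr (_ :: _); apply: IH; rewrite [LHS]surjective_pairing [RHS]surjective_pairing; congr pair; lia.
by congr (_ :: _); apply: IH; rewrite [LHS]surjective_pairing [RHS]surjective_pairing; congr pair; lia.
Qed.

Lemma slope_homology X Y u v l : homology X u -> homology Y v ->
  homology ((descend (X, Y) l).1 * (descend (X, Y) l).2)
    (u *+ (slope l).1 + v *+ (slope l).2).
Proof.
elim: l X Y u v => [|b l IH] X Y u v hX hY; first exact: homologyM.
case: b => /=.
  have := IH _ _ _ _ hX (homologyM hX hY).
  by rewrite mulrnDl addrA -mulrnDr.
have := IH _ _ _ _ (homologyM hX hY) hY.
by rewrite mulrnDl -addrA -mulrnDr.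
Qed.

(** The regions of the planar trivalent tree: the two beside the root edge,
and those reached from it in the direction c along the path l. *)
Definition region := (bool + bool * seq bool)%type.

Definition region_elt X Y (i : region) : 'M[R]_2 := match i with
  | inl b => if b then X else Y
  | inr (c, l) => (descend (root c X Y) l).1 * (descend (root c X Y) l).2 end.

Definition region_coord (i : region) : int * int := match i with
  | inl b => if b then (1, 0) else (0, 1)
  | inr (c, l) => ((slope l).1%:Z, if c then (slope l).2%:Z else - (slope l).2%:Z) end.

Lemma region_homology X Y u v i : homology X u -> homology Y v ->
  homology (region_elt X Y i) (u *~ (region_coord i).1 + v *~ (region_coord i).2).
Proof.
move=> hX hY; case: i => [[]|[[] l]] /=.
- by rewrite mulr1z mulr0z addr0.
- by rewrite mulr1z mulr0z add0r.
- by rewrite -!pmulrn; exact: slope_homology.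
- by rewrite mulrNz -mulNrz -!pmulrn; apply: slope_homology => //; exact: homologyV.
Qed.

Lemma region_coord_inj i j :
  region_coord i = region_coord j \/ region_coord i = - region_coord j -> i = j.
Proof.
have g0 := slope_gt0.
case: i => [[]|[[] l]]; case: j => [[]|[[] l']] //= -[] [] // e1 e2;
  try (have [p1 p2] := g0 l); try (have [p3 p4] := g0 l'); try lia.
- congr (inr (_, _)); apply: slope_inj.
  by rewrite [LHS]surjective_pairing [RHS]surjective_pairing; congr pair; lia.
- congr (inr (_, _)); apply: slope_inj.
  by rewrite [LHS]surjective_pairing [RHS]surjective_pairing; congr pair; lia.
Qed.

Lemma region_coord_neq0 i : region_coord i != 0.
Proof.
apply/eqP; case: i => [[]|[c l]] // []; have := slope_gt0 l; lia.
Qed.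

Lemma indep_inj (u v : int * int) (a b a' b' : int) : indep u v ->
  u *~ a + v *~ b = u *~ a' + v *~ b' -> (a, b) = (a', b').
Proof.
rewrite /indep => i /eqP; rewrite -subr_eq0 => /eqP h.
have comp (x y : int * int) (k : int) : (x *~ k).1 = x.1 * k /\ (x *~ k).2 = x.2 * k.
  have pos (n : nat) : (x *+ n).1 = x.1 *+ n /\ (x *+ n).2 = x.2 *+ n.
    by elim: n => // n [IH1 IH2]; rewrite !mulrS /= IH1 IH2.
  rewrite -!mulrzz; case: k => n; first exact: pos.
  have [p1 p2] := pos n.+1; rewrite NegzE !mulrNz; split.
    by rewrite -[LHS]/(- (x *+ n.+1).1) p1.
  by rewrite -[LHS]/(- (x *+ n.+1).2) p2.
have e1 : u.1 * (a - a') + v.1 * (b - b') = 0.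
  have := congr1 fst h; rewrite /= !(comp u u _).1 !(comp v v _).1 => e; rewrite -[RHS]e; ring.
have e2 : u.2 * (a - a') + v.2 * (b - b') = 0.
  have := congr1 snd h; rewrite /= !(comp u u _).2 !(comp v v _).2 => e; rewrite -[RHS]e; ring.
have k1 : (u.1 * v.2 - u.2 * v.1) * (a - a') = 0.
  transitivity (v.2 * (u.1 * (a - a') + v.1 * (b - b')) - v.1 * (u.2 * (a - a') + v.2 * (b - b'))).
    by ring.
  by rewrite e1 e2 !mulr0 subr0.
have k2 : (u.1 * v.2 - u.2 * v.1) * (b - b') = 0.
  transitivity (u.1 * (u.2 * (a - a') + v.2 * (b - b')) - u.2 * (u.1 * (a - a') + v.1 * (b - b'))).
    by ring.
  by rewrite e1 e2 !mulr0 subr0.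
move/eqP: k1; rewrite mulf_eq0 (negPf i) subr_eq0 => /eqP ->.
by move/eqP: k2; rewrite mulf_eq0 (negPf i) subr_eq0 => /eqP ->.
Qed.

(** Conjugate elements have the same class. So the classes of the two regions
are multiples of each other, hence equal up to sign, and the slopes are
distinct up to sign. *)
Lemma region_conj_inj X Y i j g g' (k k' : int) : nielsen X Y -> G g -> G g' ->
  g^-1 * region_elt X Y j * g = region_elt X Y i ^ k ->
  g'^-1 * region_elt X Y i * g' = region_elt X Y j ^ k' -> i = j.
Proof.
move=> n Gg Gg' e1 e2; have [u [v [hX hY uv]]] := nielsen_homology n.
have hi := region_homology i hX hY; have hj := region_homology j hX hY.
have f1 := homology_conj Gg hj; rewrite e1 in f1.
have f2 := homology_conj Gg' hi; rewrite e2 in f2.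
have := homology_unique f1 (homologyXz k hi); have := homology_unique f2 (homologyXz k' hj).
rewrite !mulrzDl -!mulrzA => /(indep_inj uv) [a1 a2] /(indep_inj uv) [b1 b2].
have ni := region_coord_neq0 i.
apply: region_coord_inj; rewrite [region_coord i]surjective_pairing [region_coord j]surjective_pairing.
move: ni; rewrite [region_coord i]surjective_pairing.
move: a1 a2 b1 b2; move: (region_coord i).1 (region_coord i).2 (region_coord j).1 (region_coord j).2.
move=> a b c d -> -> c1 d1 ni.
have unit_int : k * k' = 1 -> k = 1 \/ k = -1.
  move=> /(congr1 absz); rewrite abszM => /eqP; rewrite muln_eq1 => /andP[/eqP k1 _].
  by case: (k) k1 => [[|[|m]]|[|m]] //; [left | right].
have kk : k = 1 \/ k = -1.
  have [c0|c0] := eqVneq c 0; last first.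
    have : c * (k' * k - 1) = 0 by rewrite mulrBr mulr1 mulrA -c1 subrr.
    move/eqP; rewrite mulf_eq0 (negPf c0) subr_eq0 mulrC => /eqP; exact: unit_int.
  have [d0|d0] := eqVneq d 0; first by move: ni; rewrite c0 d0 !mul0r eqxx.
  have : d * (k' * k - 1) = 0 by rewrite mulrBr mulr1 mulrA -d1 subrr.
  move/eqP; rewrite mulf_eq0 (negPf d0) subr_eq0 mulrC => /eqP; exact: unit_int.
case: kk => kE; rewrite kE in c1 d1.
  by left; congr pair; [rewrite [RHS]c1 mulr1 | rewrite [RHS]d1 mulr1].
right; rewrite -[- (c, d)]/(- c, - d); congr pair.
  by rewrite [in RHS]c1 mulrN1 opprK.
by rewrite [in RHS]d1 mulrN1 opprK.
Qed.

Lemma commutator_homology : homology (comm A0 B0) 0.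
Proof.
have [u [v [hA hB _]]] := nielsen_homology (nielsen_refl A0 B0).
have := homologyM (homologyM (homologyM hB hA) (homologyV hB)) (homologyV hA).
by rewrite (addrC v) addrK subrr.
Qed.

(** A multiple of the nonzero class of a region vanishes only for the exponent
0. *)
Lemma region_power_commutator X Y i g (k : int) h : nielsen X Y -> G g ->
  homology h 0 -> g^-1 * h * g = region_elt X Y i ^ k -> h = 1.
Proof.
move=> n Gg h0 e; have [u [v [hX hY uv]]] := nielsen_homology n.
have hi := region_homology i hX hY; have ni := region_coord_neq0 i.
have f1 := homology_conj Gg h0; rewrite e in f1.
have := homology_unique f1 (homologyXz k hi).
rewrite mulrzDl -!mulrzA -[LHS](_ : u *~ 0 + v *~ 0 = 0) ?mulr0z ?addr0 //.
rewrite -(mulr0z u) -{1}[u *~ 0]addr0 -{1}(mulr0z v) => /(indep_inj uv) [a0 b0].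
have k0 : k = 0.
  have [//|kn] := eqVneq k 0.
  move/esym/eqP: a0; rewrite mulf_eq0 (negPf kn) orbF => /eqP a0.
  move/esym/eqP: b0; rewrite mulf_eq0 (negPf kn) orbF => /eqP b0.
  by move: ni; rewrite [region_coord i]surjective_pairing a0 b0 eqxx.
move: e; rewrite k0 expr0z => /(congr1 (fun x => g * x * g^-1)).
have ug := det1_unit (G_det dA0 dB0 Gg).
by rewrite mulr1 divrr // !mulrA divrr // mul1r mulrK.
Qed.
End Abelianization.

(** * Common ends of closed geodesics *)

Section Ends.
Variable R : realType.
Implicit Types F g h X Y : 'M[R]_2.

Lemma frame_decomp F (v : 'cV[R]_2) : \det F = 1 ->
  v = br v (src F) *: tgt F + br (tgt F) v *: src F.
Proof. by move=> dF; rewrite -br_decomp br_frame dF scale1r. Qed.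

Lemma frame_ext g h : tgt g = tgt h -> src g = src h -> g = h.
Proof.
move=> e1 e2; apply: mx2P.
- by have := congr1 (fun v : 'cV_2 => v 0 0) e1; rewrite ![col _ _ _ _]mxE.
- by have := congr1 (fun v : 'cV_2 => v 0 0) e2; rewrite ![col _ _ _ _]mxE.
- by have := congr1 (fun v : 'cV_2 => v 1 0) e1; rewrite ![col _ _ _ _]mxE.
- by have := congr1 (fun v : 'cV_2 => v 1 0) e2; rewrite ![col _ _ _ _]mxE.
Qed.

(** The eigenlines of h are the two ends of F. *)
Lemma axial_same_ends F F' h : \det F = 1 -> \det F' = 1 -> axial F h -> fixes_ends h F' ->
  (br (tgt F) (tgt F') = 0 /\ br (src F) (src F') = 0) \/
  (br (tgt F) (src F') = 0 /\ br (src F) (tgt F') = 0).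
Proof.
move=> dF dF' [m [m0 m2 hp hn]] [[a ha] [b hb]].
have F1 : br (tgt F) (src F) = 1 by rewrite br_frame.
have mm : m - m^-1 != 0.
  rewrite subr_eq0; apply: contra m2 => /eqP e.
  by rewrite expr2 {2}e divff.
have one v c : h *m v = c *: v -> br (tgt F) v = 0 \/ br (src F) v = 0.
  move=> hv; have e : h *m v = (m * br v (src F)) *: tgt F + (m^-1 * br (tgt F) v) *: src F.
    rewrite {1}(frame_decomp v dF) mulmxDr -!scalemxAr hp hn !scalerA.
    by rewrite mulrC [_ * m^-1]mulrC.
  have e1 : c * br v (src F) = m * br v (src F).
    by rewrite -brZl -hv e brDl !brZl br0 F1 mulr0 addr0 mulr1.
  have e2 : c * br (tgt F) v = m^-1 * br (tgt F) v.
    by rewrite -brZr -hv e brDr !brZr br0 F1 mulr0 add0r mulr1.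
  have : (m - m^-1) * (br v (src F) * br (tgt F) v) == 0.
    by rewrite mulrBl subr_eq0 mulrA -e1 mulrCA -e2; apply/eqP; ring.
  rewrite mulf_eq0 (negPf mm) /= mulf_eq0 => /orP[/eqP h0|/eqP]; last by left.
  by right; rewrite brC h0 oppr0.
have [p0 n0] := frame_neq0 dF; have [p'0 n'0] := frame_neq0 dF'.
have F'1 : br (tgt F') (src F') = 1 by rewrite br_frame.
have excl v : v != 0 -> br v (tgt F') = 0 -> br v (src F') = 0 -> False.
  move=> v0 h1 /(br_eq0P v0)[c cE]; move/eqP: F'1; rewrite cE brZr brC h1 oppr0 mulr0.
  by rewrite eq_sym oner_eq0.
case: (one _ _ ha) (one _ _ hb) => h1 [h2|h2].
- by case: (excl _ p0 h1 h2).
- by left.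
- by right.
- by case: (excl _ n0 h1 h2).
Qed.

Lemma axialP F h (l m : R) : 0 < l -> m ^+ 2 = expR l -> h *m tgt F = m *: tgt F ->
  h *m src F = m^-1 *: src F -> axial F h.
Proof.
move=> l0 m2 hp hn; exists m; split=> //.
  by rewrite -sqrf_eq0 m2 expR_eq0.
by rewrite m2 gt_eqF // expR_gt1.
Qed.

Lemma cosh_le (x y : R) : 0 <= x -> x <= y -> cosh x <= cosh y.
Proof.
move=> x0 xy; rewrite !coshE ler_pM2r ?invr_gt0 // -subr_ge0.
have ex := expR_gt0 x; have ey := expR_gt0 y.
have -> : expR y + (expR y)^-1 - (expR x + (expR x)^-1) =
   (expR y - expR x) * (1 - (expR x * expR y)^-1) by field; rewrite !gt_eqF.
apply: mulr_ge0; first by rewrite subr_ge0 ler_expR.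
rewrite subr_ge0 invf_le1 ?mulr_gt0 // -expRD -expR0 ler_expR; lra.
Qed.

Lemma cosh_gt1 (x : R) : 0 < x -> 1 < cosh x.
Proof.
move=> x0; have e1 : 1 < expR x by rewrite expR_gt1.
have e0 : 0 < expR x by exact: expR_gt0.
rewrite coshE -subr_gt0; have -> : (expR x + (expR x)^-1) / 2 - 1 = (expR x - 1) ^+ 2 / (2 * expR x).
  by field; rewrite gt_eqF.
by apply: divr_gt0; [rewrite exprn_gt0 // subr_gt0 | rewrite mulr_gt0].
Qed.
End Ends.

Section Discrete.
Variable R : realType.
Variables A0 B0 : 'M[R]_2.
Hypotheses (dA0 : \det A0 = 1) (dB0 : \det B0 = 1).
Hypothesis discrete : forall z, upper_half_plane z ->
  exists2 r : R, 0 < r & forall w : word, reduced w -> w != [::] ->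
      r <= hdist z (mobius (eval_word A0 B0 w) z).
Local Notation G := (generated2 A0 B0).
Implicit Types F g h X Y : 'M[R]_2.

(** Conjugation by the powers of h divides t by arbitrarily large numbers. The
conjugates of U would move the base point of the axis by arbitrarily small
distances, which the discreteness of the group excludes. *)
Lemma unipotent_trivial F h U (l m t : R) : \det F = 1 -> G h -> G U -> 0 < l ->
  m ^+ 2 = expR l -> h *m tgt F = m *: tgt F -> h *m src F = m^-1 *: src F ->
  U *m tgt F = tgt F -> U *m src F = src F + t *: tgt F -> t = 0.
Proof.
move=> dF Gh GU l0 m2 hp hn Up Un; have dh := G_det dA0 dB0 Gh.
have dU := G_det dA0 dB0 GU.
have m0 : m != 0 by rewrite -sqrf_eq0 m2 expR_eq0.
have [r r0 hr] := G_discrete dA0 dB0 discrete (hline_Im 0 dF).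
have powp n : h ^+ n *m tgt F = m ^+ n *: tgt F.
  elim: n => [|n IH]; first by rewrite !expr0 mul1mx scale1r.
  by rewrite exprS -mulmxE -mulmxA IH -scalemxAr hp scalerA exprSr.
have pown n : h ^+ n *m src F = m ^- n *: src F.
  elim: n => [|n IH]; first by rewrite !expr0 mul1mx invr1 scale1r.
  by rewrite exprS -mulmxE -mulmxA IH -scalemxAr hn scalerA exprSr -invfM mulrC.
pose V n := (h ^+ n)^-1 * U * h ^+ n.
have GV n : G (V n).
  have Gn : G (h ^+ n) by exact: G_X.
  by apply: G_M => //; apply: G_M => //; exact: G_V.
have dn n : \det (h ^+ n) = 1 by exact: det_exp2.
have Vp n : V n *m tgt F = tgt F.
  rewrite /V -!mulmxE -!mulmxA powp -!scalemxAr Up.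
  by rewrite -[in RHS](mulmxVK2 (tgt F) (dn n)) powp -!scalemxAr.
have Vn n : V n *m src F = src F + (t / expR l ^+ n) *: tgt F.
  rewrite /V -!mulmxE -!mulmxA pown -!scalemxAr Un mulmxDr.
  have -> : (h ^+ n)^-1 *m src F = m ^+ n *: src F.
    by rewrite -[in RHS](mulmxVK2 (src F) (dn n)) pown -scalemxAr scalerA divff ?expf_neq0 // scale1r.
  rewrite -scalemxAr; have -> : (h ^+ n)^-1 *m tgt F = m ^- n *: tgt F.
    by rewrite -[in RHS](mulmxVK2 (tgt F) (dn n)) powp -scalemxAr scalerA mulVf ?expf_neq0 // scale1r.
  rewrite scalerDr !scalerA mulVf ?expf_neq0 // scale1r -m2 -exprM mulnC exprM expr2 invfM.
  by congr (_ + _ *: _); ring.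
have trivial n : V n = 1 -> t = 0.
  move=> V1; have := Vn n; rewrite V1 mul1mx => /eqP; rewrite -subr_eq0 opprD addrA subrr add0r.
  rewrite oppr_eq0 scaler_eq0 (negPf (frame_neq0 dF).1) orbF mulf_eq0 invr_eq0 expf_eq0 expR_eq0 andbF orbF.
  by move/eqP.
apply: contrapT => t0.
have far n : r <= hdist (hline F 0) (mobius (V n) (hline F 0)).
  by apply: hr => // V1; apply: t0; exact: trivial V1.
pose q := 2 * (cosh r - 1); have q0 : 0 < q by rewrite mulr_gt0 // subr_gt0 cosh_gt1.
have small n : q <= (t / expR l ^+ n) ^+ 2.
  have dV := G_det dA0 dB0 (GV n).
  pose u := t / expR l ^+ n; have dT : \det (mx2 1 u 0 1) = 1.
    by rewrite det2 !mx2_entries; ring.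
  have VF : V n * F = F * mx2 1 u 0 1.
    have e1 : tgt (V n * F) = tgt (F * mx2 1 u 0 1).
      have -> : tgt (V n * F) = tgt F by rewrite (tgtM (V n)) -[RHS](Vp n).
      by apply: cv2P; rewrite [LHS]mxE [RHS]mxE mx2E !mx2_entries; ring.
    have e2 : src (V n * F) = src (F * mx2 1 u 0 1).
      have -> : src (V n * F) = src F + u *: tgt F by rewrite (srcM (V n)) -[RHS](Vn n).
      by apply: cv2P; rewrite [RHS]mxE mx2E !mx2_entries !mxE; ring.
    exact: frame_ext.
  have i0 : 0 < complex.Im (0 +i* expR (0 : R)) by exact: expR_gt0.
  have := far n; rewrite -hlineM // VF hlineM // /hline hdist_mobius ?mobius_Im_gt0 //.
  rewrite hdistE ?mobius_Im_gt0 //; set k := hinner _ _ => rk.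
  have kE : k = 1 + u ^+ 2 / 2.
    rewrite /k /hinner; have [-> -> ->] := hcoord_mobius dT i0.
    by rewrite !mx2_entries /ha /hb /hc /= expR0; field.
  have k1 : 1 <= k by rewrite kE lerDl divr_ge0 // sqr_ge0.
  have := cosh_le (ltW r0) rk; rewrite cosh_arcosh // kE /q -/u.
  move: (cosh r) => C; lra.
have E1 n : 1 + n%:R * l <= expR l ^+ n.
  have := expR_ge1Dx (n%:R * l); by rewrite expRM_natl.
have t2 : 0 <= t ^+ 2 by exact: sqr_ge0.
have bound n : n%:R * (q * l) <= t ^+ 2.
  have := small n; rewrite expr_div_n ler_pdivlMr; last by rewrite exprn_gt0 // exprn_gt0 // expR_gt0.
  move=> h1; apply: le_trans h1; rewrite mulrCA ler_pM2l //.
  have n0 : 0 <= n%:R * l by rewrite mulr_ge0 // ltW.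
  have := E1 n; move: (expR l ^+ n) => E; nra.
have := bound (Num.truncn (t ^+ 2 / (q * l))).+1.
apply/negP; rewrite -ltNge -ltr_pdivrMr; first exact: truncnS_gt.
exact: mulr_gt0.
Qed.

(** The commutator of K and h fixes the vector [tgt F], hence is unipotent,
and trivial by [unipotent_trivial]. So K commutes with h. *)
Lemma shared_tgt F h K (l m : R) : \det F = 1 -> G h -> G K -> 0 < l ->
  m ^+ 2 = expR l -> h *m tgt F = m *: tgt F -> h *m src F = m^-1 *: src F ->
  eigendir K (tgt F) -> eigendir K (src F).
Proof.
move=> dF Gh GK l0 m2 hp hn [a Ka]; have dh := G_det dA0 dB0 Gh; have dK := G_det dA0 dB0 GK.
have m0 : m != 0 by rewrite -sqrf_eq0 m2 expR_eq0.
have [p0 n0] := frame_neq0 dF.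
have a0 : a != 0.
  by apply: contraNneq (mulmx2_neq0 dK p0) => a0; rewrite Ka a0 scale0r.
pose U := K^-1 * h^-1 * K * h.
have GU : G U by apply: G_M => //; apply: G_M => //; apply: G_M; exact: G_V.
have dU := G_det dA0 dB0 GU.
have hip : h^-1 *m tgt F = m^-1 *: tgt F.
  by rewrite -[in RHS](mulmxVK2 (tgt F) dh) hp -scalemxAr scalerA mulVf // scale1r.
have Kip : K^-1 *m tgt F = a^-1 *: tgt F.
  by rewrite -[in RHS](mulmxVK2 (tgt F) dK) Ka -scalemxAr scalerA mulVf // scale1r.
have Up : U *m tgt F = tgt F.
  rewrite /U -!mulmxE -!mulmxA hp -!scalemxAr Ka -!scalemxAr hip -!scalemxAr Kip !scalerA.
  rewrite (_ : _ * _ = 1) ?scale1r //; by field; rewrite a0 m0.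
have Un : U *m src F = src F + br (U *m src F) (src F) *: tgt F.
  rewrite {1}(frame_decomp (U *m src F) dF) -{2}Up br_mul // br_frame dF scale1r addrC //.
have t0 := unipotent_trivial dF Gh GU l0 m2 hp hn Up Un.
rewrite t0 scale0r addr0 in Un.
have U1 : U = 1.
  apply: (G_free dA0 dB0 discrete GU (hline_Im 0 dF)).
  by rewrite -hlineM //; congr (hline _ _); apply: frame_ext; rewrite ?tgtM ?srcM.
have Kh : K * h = h * K.
  have := congr1 (fun x => h * K * x) U1; rewrite mulr1 /U !mulrA.
  by rewrite mulrK ?det1_unit // divrr ?det1_unit // mul1r.
by case: (commuting_fixes dF dh (axialP l0 m2 hp hn) Kh).
Qed.

(** Exchanging the two ends amounts to replacing h by its inverse. *)
Lemma shared_src F h K (l m : R) : \det F = 1 -> G h -> G K -> 0 < l ->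
  m ^+ 2 = expR l -> h *m tgt F = m *: tgt F -> h *m src F = m^-1 *: src F ->
  eigendir K (src F) -> eigendir K (tgt F).
Proof.
move=> dF Gh GK l0 m2 hp hn Ks; have dh := G_det dA0 dB0 Gh.
have m0 : m != 0 by rewrite -sqrf_eq0 m2 expR_eq0.
pose F' := F * mx2 0 (-1) 1 0.
have dJ : \det (mx2 0 (-1) 1 0 : 'M[R]_2) = 1 by rewrite det2 !mx2_entries; ring.
have dF' : \det F' = 1 by exact: det_mul2.
have tF' : tgt F' = src F.
  by apply: cv2P; rewrite [LHS]mxE mx2E !mx2_entries !mxE; ring.
have sF' : src F' = - tgt F.
  by apply: cv2P; rewrite [LHS]mxE mx2E !mx2_entries !mxE; ring.
have hip : h^-1 *m tgt F = m^-1 *: tgt F.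
  by rewrite -[in RHS](mulmxVK2 (tgt F) dh) hp -scalemxAr scalerA mulVf // scale1r.
have hin : h^-1 *m src F = m *: src F.
  by rewrite -[in RHS](mulmxVK2 (src F) dh) hn -scalemxAr scalerA divff // scale1r.
have [a Ka] : eigendir K (src F').
  apply: (@shared_tgt F' h^-1 K l m) => //; rewrite ?tF' ?sF' //; first exact: G_V.
  by rewrite mulmxN hip scalerN.
by exists a; move: Ka; rewrite sF' mulmxN scalerN => /oppr_inj.
Qed.

Lemma eigendir_conj g K v : \det g = 1 ->
  eigendir K (g *m v) <-> eigendir (g^-1 * K * g) v.
Proof.
move=> dg; split=> -[a e]; exists a.
  by rewrite -!mulmxE -!mulmxA e -scalemxAr mulmxVK2.
by rewrite scalemxAr -e -!mulmxE -!mulmxA mulmxKV2.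
Qed.

(** If the axis had one end in common with a translate of the boundary
geodesic, it would also have the other one, by [shared_tgt] and [shared_src],
and the two geodesics would have the same projection. *)
Lemma simple_axis_frame F h l FK : \det F = 1 -> simple_axis A0 B0 F h l ->
  \det FK = 1 -> axial FK (comm A0 B0) ->
  shadow G (hline F) <> shadow G (hline FK) -> simple_frame A0 B0 F.
Proof.
move=> dF sF dFK aK ne; have [m m2 [hp hn]] := simple_axis_ends dA0 dB0 dF sF.
have [Gh l0 _ _] := sF.
have GK : G (comm A0 B0).
  have [GA GB] := nielsen_G dA0 dB0 (nielsen_refl A0 B0).
  by apply: G_M; [apply: G_M; [exact: G_M | exact: G_V] | exact: G_V].
have conj g v : G g -> eigendir (comm A0 B0) (g *m v) -> eigendir (g^-1 * comm A0 B0 * g) v.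
  by move=> /(G_det dA0 dB0) dg; case: (eigendir_conj (comm A0 B0) v dg).
have conj' g v : G g -> eigendir (g^-1 * comm A0 B0 * g) v -> eigendir (comm A0 B0) (g *m v).
  by move=> /(G_det dA0 dB0) dg; case: (eigendir_conj (comm A0 B0) v dg).
have GKg g : G g -> G (g^-1 * comm A0 B0 * g).
  by move=> Gg; apply: G_M => //; apply: G_M => //; exact: G_V.
have fin g : G g -> eigendir (comm A0 B0) (g *m tgt F) -> eigendir (comm A0 B0) (g *m src F) -> False.
  move=> Gg e1 e2; apply: ne; have dg := G_det dA0 dB0 Gg.
  have dgF := det_mul2 dg dF.
  have fe : fixes_ends (comm A0 B0) (g * F) by split; rewrite ?tgtM ?srcM.
  rewrite -(shadow_G dA0 dB0 Gg dF); apply: (shadow_same_ends A0 B0 dFK dgF).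
  exact: axial_same_ends aK fe.
split=> //.
- by move=> g Gg; exact: (simple_axis_unlinked dA0 dB0 discrete dF sF).
- move=> g Gg e; apply: (fin g Gg e); apply: conj' => //.
  exact: (shared_tgt dF Gh (GKg _ Gg) l0 m2 hp hn (conj _ _ Gg e)).
- move=> g Gg e; apply: (fin g Gg _ e); apply: conj' => //.
  exact: (shared_src dF Gh (GKg _ Gg) l0 m2 hp hn (conj _ _ Gg e)).
Qed.
End Discrete.

(** * Enumeration of the simple closed geodesics *)

Section Enumeration.
Variable R : realType.
Variables A0 B0 : 'M[R]_2.
Hypotheses (dA0 : \det A0 = 1) (dB0 : \det B0 = 1).
Hypothesis discrete : forall z, upper_half_plane z ->
  exists2 r : R, 0 < r & forall w : word, reduced w -> w != [::] ->
      r <= hdist z (mobius (eval_word A0 B0 w) z).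
Hypothesis trK : \tr (comm A0 B0) < -2.
Hypotheses (trA0 : 2 < \tr A0) (trB0 : 2 < \tr B0).
Local Notation G := (generated2 A0 B0).
Local Notation nielsen := (nielsen A0 B0).
Implicit Types F g h X Y : 'M[R]_2.

Lemma nielsen_root X Y c : nielsen X Y -> nielsen (root c X Y).1 (root c X Y).2.
Proof. by case: c => //= n; exact: nielsen_inv. Qed.

Lemma region_basis X Y i : nielsen X Y ->
  exists X' Y' (b : bool), nielsen X' Y' /\ region_elt X Y i = if b then X' else Y'.
Proof.
move=> n; case: i => [b|[c l]]; first by exists X, Y, b.
have := nielsen_descend l (nielsen_root c n); rewrite -surjective_pairing => nd.
exists (descend (root c X Y) l).1, ((descend (root c X Y) l).1 * (descend (root c X Y) l).2), false.
by split=> //; exact: nielsen_left.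
Qed.

Lemma region_generator X Y i : nielsen X Y ->
  exists F l, [/\ \det F = 1, simple_axis A0 B0 F (region_elt X Y i) l,
    \tr (region_elt X Y i) = 2 * cosh (l / 2) & 2 < \tr (region_elt X Y i)].
Proof.
move=> /(region_basis i) [X' [Y' [b [n ->]]]].
have [x2 y2] := nielsen_tr dA0 dB0 trK trA0 trB0 n.
have [F [l [dF sF tF]]] := simple_generator dA0 dB0 trK trA0 trB0 b n.
by exists F, l; split=> //; case: (b).
Qed.

Lemma descend_rcons (s : 'M[R]_2 * 'M[R]_2) l b :
  descend s (rcons l b) = child b (descend s l).
Proof. by rewrite /descend -cats1 foldl_cat. Qed.

(** Each component of a basis in the tree was a product when it first appeared
on the path, unless it belongs to the root. *)
Lemma descend_region X Y c l (b : bool) : exists i,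
  let g := if b then (descend (root c X Y) l).1 else (descend (root c X Y) l).2 in
  g = region_elt X Y i \/ g = (region_elt X Y i)^-1.
Proof.
elim/last_ind: l b => [|l a IH] b.
  exists (inl b); case: b; case: c => /=; rewrite /descend /=; by [left | right].
have head : exists i, (descend (root c X Y) l).1 * (descend (root c X Y) l).2 =
  region_elt X Y i by exists (inr (c, l)).
rewrite descend_rcons; case: a b => -[] /=.
- exact: (IH true).
- by case: head => i ->; exists i; left.
- by case: head => i ->; exists i; left.
- exact: (IH false).
Qed.

Variable FK : 'M[R]_2.
Hypotheses (dFK : \det FK = 1) (aFK : axial FK (comm A0 B0)).

Lemma comm_G : G (comm A0 B0).
Proof.
have [GA GB] := nielsen_G dA0 dB0 (nielsen_refl A0 B0).
by apply: G_M; [apply: G_M; [exact: G_M | exact: G_V] | exact: G_V].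
Qed.

(** The commutator is not trivial but has class 0 in homology, so that it
cannot be conjugate to a power of a region. *)
Lemma region_not_boundary X Y i F l : nielsen X Y -> \det F = 1 ->
  simple_axis A0 B0 F (region_elt X Y i) l ->
  shadow G (hline F) <> shadow G (hline FK).
Proof.
move=> n dF sF /(shadow_eq dA0 dB0 dF dFK) [g [e [k [Gg _ eP]]]].
have GK := comm_G; have dK := G_det dA0 dB0 GK; have dg := G_det dA0 dB0 Gg.
have [m [m0 m2 hp hn]] := aFK.
have hl := ends_hyperbolic dK dFK m0 hp hn 0.
rewrite !eP mulr0 add0r in hl.
have Gc : G (g^-1 * comm A0 B0 * g) by apply: G_M => //; apply: G_M => //; exact: G_V.
have Ik := hline_Im k dF; have Ig := mobius_Im_gt0 dg Ik.
have gi := det_inv2 dg.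
have move_g : mobius (g^-1 * comm A0 B0 * g) (hline F k) = hline F (e * (0 + ln (m ^+ 2)) + k).
  rewrite (mobiusM (det_mul2 gi dK) dg Ik) (mobiusM gi dK Ig) hl mobiusK ?hline_Im //.
have [j _ jE] := simple_axis_power dA0 dB0 discrete dF sF Gc move_g.
have K1 := region_power_commutator dA0 dB0 discrete n Gg (commutator_homology dA0 dB0) jE.
have [p0 _] := frame_neq0 dFK.
move: hp; rewrite K1 mul1mx => /eqP; rewrite -subr_eq0 -{1}[tgt FK]scale1r -scalerBl.
rewrite scaler_eq0 (negPf p0) orbF subr_eq0 => /eqP m1.
by move: m2; rewrite -m1 expr1n eqxx.
Qed.

Lemma region_geodesic X Y c l : nielsen X Y ->
  simple_closed_geodesic_of_length G c l -> c <> shadow G (hline FK) ->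
  exists i, forall F l', \det F = 1 -> simple_axis A0 B0 F (region_elt X Y i) l' ->
    shadow G (hline F) = c.
Proof.
move=> n /(simple_closed_geodesicP dA0 dB0) [F [h [dF sF ->]]] ne.
have fF := simple_axis_frame dA0 dB0 discrete dF sF dFK aFK ne.
have [Gh l0 _ _] := sF.
have [m m2 [hp hn]] := simple_axis_ends dA0 dB0 dF sF.
have aF := axialP l0 m2 hp hn.
have [g [c' [s [b [Gg fe]]]]] := classify dA0 dB0 trK n fF Gh aF.
have [i iE] := descend_region X Y c' s b; exists i => F' l' dF' sF'.
have [Gi l'0 _ _] := sF'; have di := G_det dA0 dB0 Gi.
have dg := G_det dA0 dB0 Gg; have dgF := det_mul2 dg dF.
have [p0 n0] := frame_neq0 dgF.
have fe' : fixes_ends (region_elt X Y i) (g * F).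
  case: iE fe => -> [f1 f2]; first by [].
  by split; apply: eigendir_inv.
have [m' m'2 [hp' hn']] := simple_axis_ends dA0 dB0 dF' sF'.
have ends := axial_same_ends dF' dgF (axialP l'0 m'2 hp' hn') fe'.
by rewrite -(shadow_G dA0 dB0 Gg dF) (shadow_same_ends A0 B0 dF' dgF ends).
Qed.

(** Surjectivity is the classification of simple axes, and injectivity the
fact that the regions are told apart by homology. *)
Lemma geodesic_regions X Y : nielsen X Y ->
  exists (geo : region -> set (set R[i])) (len : region -> R),
  [/\ set_bij setT [set c | simple_closed_geodesic G c /\ c <> shadow G (hline FK)] geo,
      forall i, geodesic_length G (geo i) = len i,
      forall i, 0 < len i
    & forall i, \tr (region_elt X Y i) = 2 * cosh (len i / 2) /\ 2 < \tr (region_elt X Y i)].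
Proof.
move=> n; have [fr frP] := choice (fun i => region_generator i n).
have [len lenP] := choice frP.
have geoP i : simple_closed_geodesic_of_length G (shadow G (hline (fr i))) (len i).
  apply/(simple_closed_geodesicP dA0 dB0).
  by have [dF sF _ _] := lenP i; exists (fr i), (region_elt X Y i).
exists (fun i => shadow G (hline (fr i))), len; split.
- split.
  + move=> i _ /=; split; first by exists (len i).
    by have [dF sF _ _] := lenP i; exact: region_not_boundary n dF sF.
  + move=> i j _ _ e; have [dF sF _ _] := lenP i; have [dF' sF' _ _] := lenP j.
    have [g [k [Gg gE _]]] := shadow_eq_conj dA0 dB0 discrete dF dF' sF sF' e.
    have [g' [k' [Gg' gE' _]]] := shadow_eq_conj dA0 dB0 discrete dF' dF sF' sF (esym e).
    exact: (region_conj_inj dA0 dB0 discrete n Gg Gg' gE gE').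
  + move=> c [[l cl] ne]; have [i hi] := region_geodesic n cl ne.
    by have [dF sF _ _] := lenP i; exists i => //; exact: hi dF sF.
- by move=> i; apply: (geodesic_lengthE dA0 dB0 discrete).
- by move=> i; have [_ [_ l0 _ _] _ _] := lenP i.
- by move=> i; have [_ _ tE t2] := lenP i.
Qed.
End Enumeration.

(** * Summation over the tree *)

Fixpoint paths n : seq (seq bool) := if n is m.+1 then
  [::] :: map (cons true) (paths m) ++ map (cons false) (paths m) else [::].

Lemma mem_paths n l : (l \in paths n) = (size l < n)%N.
Proof.
elim: n l => [|n IH] [|b l] //=; rewrite in_cons /= mem_cat ltnS -IH.
have inj (c : bool) : injective (cons c) by move=> ? ? [].
have no (c : bool) : c != b -> (b :: l \in map (cons c) (paths n)) = false.
  by move=> cb; apply/mapP => -[l' _ [e _]]; rewrite e eqxx in cb.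
by case: b no => no; rewrite (mem_map (inj _)) no ?orbF.
Qed.

Lemma paths_uniq n : uniq (paths n).
Proof.
have inj (c : bool) : injective (cons c) by move=> ? ? [].
elim: n => //= n IH; rewrite cat_uniq !map_inj_uniq // IH andbT /=; apply/andP; split.
  by rewrite mem_cat; apply/negP => /orP[] /mapP[].
by apply/hasPn => l /mapP[l' _ ->]; apply/mapP => -[].
Qed.

Definition regions n : seq region := [:: inl true; inl false] ++
  map (fun l => inr (true, l)) (paths n) ++ map (fun l => inr (false, l)) (paths n).

Definition depth (i : region) : nat := if i is inr (_, l) then size l else 0%N.

Lemma mem_regions n i : (depth i < n)%N -> i \in regions n.
Proof.
case: i => [[]|[c l]] //= ln; rewrite !in_cons /= mem_cat; apply/orP.
by case: c; [left | right]; rewrite map_f // mem_paths.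
Qed.

Lemma regions_uniq n : uniq (regions n).
Proof.
have inj (c : bool) : injective (fun l : seq bool => inr (c, l) : region) by move=> ? ? [].
rewrite /regions /= !in_cons /= cat_uniq !map_inj_uniq ?paths_uniq //= andbT.
apply/and3P; split.
- by rewrite mem_cat; apply/negP => /orP[] /mapP[].
- by rewrite mem_cat; apply/negP => /orP[] /mapP[].
- by apply/hasPn => l /mapP[l' _ ->]; apply/mapP => -[].
Qed.

Section Sum.
Variable R : realType.

Lemma sum_paths (D : R) n (P Q : 'M[R]_2) : \det P = 1 -> \det Q = 1 ->
  \sum_(l <- paths n) gap D (\tr ((descend (P, Q) l).1 * (descend (P, Q) l).2)) =
  gap_sum D n (\tr P) (\tr Q) (\tr (P * Q)).
Proof.
elim: n P Q => [|n IH] P Q dP dQ; first by rewrite big_nil.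
have dPQ := det_mul2 dP dQ.
rewrite /= big_cons big_cat !big_map /= addrA; congr (_ + _ + _).
  by rewrite (IH P (P * Q)) // tr_left.
by rewrite (IH (P * Q) Q) // tr_right.
Qed.

Variables A0 B0 : 'M[R]_2.
Hypotheses (dA0 : \det A0 = 1) (dB0 : \det B0 = 1).
Hypothesis trK : \tr (comm A0 B0) < -2.
Hypotheses (trA0 : 2 < \tr A0) (trB0 : 2 < \tr B0).
Local Notation nielsen := (nielsen A0 B0).
Local Notation D := (hole_const A0 B0).

Lemma sum_regions X Y n : nielsen X Y ->
  \sum_(i <- regions n) gap D (\tr (region_elt X Y i)) =
  gap D (\tr X) + gap D (\tr Y) + gap_sum D n (\tr X) (\tr Y) (\tr (X * Y)) +
  gap_sum D n (\tr X) (\tr Y) (\tr X * \tr Y - \tr (X * Y)).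
Proof.
move=> /(nielsen_det dA0 dB0) [dX dY]; have dYi := det_inv2 dY.
rewrite /regions big_cat /= !big_cons big_nil addr0 big_cat /= !big_map /= !addrA.
rewrite (sum_paths D n dX dY); congr (_ + _ + _).
by rewrite (sum_paths D n dX dYi) tr_inv // tr_flip.
Qed.

(** The sums over the regions up to a given depth are cofinal among the finite
sums, and [gap_sum_limit] computes their limit. *)
Lemma region_sum X Y : nielsen X Y -> reduced_basis X Y ->
  (forall i, 2 < \tr (region_elt X Y i)) ->
  (\esum_(i in [set: region]) (gap D (\tr (region_elt X Y i)))%:E = (3 * pi / 2)%:E)%E.
Proof.
move=> n red t2; have D2 := hole_const_gt2 trK.
have s := nielsen_state dA0 dB0 trK trA0 trB0 n.
have g0 i : 0 <= gap D (\tr (region_elt X Y i)).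
  by apply: ltW; apply: gap_gt0 (t2 i); exact: lt_trans D2.
have finD k : finite_set [set` regions k] by exact: finite_seq.
have sumD k : (\sum_(i \in [set` regions k]) (gap D (\tr (region_elt X Y i)))%:E =
    (\sum_(i <- regions k) gap D (\tr (region_elt X Y i)))%:E)%E.
  by rewrite fsumEFin // -fsbig_seq ?regions_uniq.
apply/eqP; rewrite eq_le; apply/andP; split.
  apply: ge_ereal_sup => _ [A [finA _] <-].
  have [N hN] : exists N, forall i, A i -> (depth i < N)%N.
    have /finite_seqP[r rE] := finA; exists (\max_(i <- r) depth i).+1 => i Ai.
    by rewrite ltnS; apply: leq_bigmax_seq => //; move: Ai; rewrite rE.
  have [k0 hk] := gap_sum_limit D2 s red (ltr01 : (0 : R) < 1).
  pose k := maxn k0 N.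
  apply: (@le_trans _ _ (\sum_(i \in [set` regions k]) (gap D (\tr (region_elt X Y i)))%:E)%E).
    apply: lee_fsum_nneg_subset => //.
    - move=> i; rewrite !inE => Ai; apply: mem_regions.
      by apply: leq_trans (hN i Ai) _; rewrite leq_maxr.
    - by move=> i _; rewrite lee_fin.
  rewrite sumD lee_fin sum_regions //.
  by have /andP[] := hk k (leq_maxl _ _).
apply/lee_addgt0Pr => e e0; rewrite -leeBlDr //.
have [k0 hk] := gap_sum_limit D2 s red e0.
apply: esum_ge; exists [set` regions k0]; first by split.
rewrite sumD -EFinB lee_fin sum_regions // ltW //.
by have /andP[] := hk k0 (leqnn _).
Qed.

Lemma gap_length x (l L : R) : 0 < l -> x = 2 * cosh (l / 2) ->
  cosh L = D / 2 -> atan (cosh L / sinh (l / 2)) = gap D x.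
Proof.
move=> l0 -> ->; rewrite /gap; congr atan.
have h : 0 < sinh (l / 2) by apply: sinh_gt0; rewrite divr_gt0.
have -> : (2 * cosh (l / 2)) ^+ 2 - 4 = (2 * sinh (l / 2)) ^+ 2.
  by have := cosh2_sinh2 (l / 2); move: (cosh _) (sinh _) => c s' e; lra.
rewrite sqrtr_sqr ger0_norm; first by field; rewrite gt_eqF.
by rewrite mulr_ge0 // ltW.
Qed.

Hypothesis discrete : forall z, upper_half_plane z ->
  exists2 r : R, 0 < r & forall w : word, reduced w -> w != [::] ->
      r <= hdist z (mobius (eval_word A0 B0 w) z).

Lemma geodesic_sum FK (L : R) : \det FK = 1 -> axial FK (comm A0 B0) ->
  cosh L = D / 2 ->
  (\esum_(c in [set c : set (set R[i]) |
                  simple_closed_geodesic (generated2 A0 B0) c /\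
                  c <> shadow (generated2 A0 B0) (hline FK)])
     (atan (cosh L / sinh (geodesic_length (generated2 A0 B0) c / 2)))%:E)%E
  = (3 * pi / 2)%:E.
Proof.
move=> dFK aFK LD; have [X [Y [n red]]] := reduced_basis_exists dA0 dB0 trK trA0 trB0.
have [geo [len [bij lenE len0 tr2]]] := geodesic_regions dA0 dB0 discrete trK trA0 trB0 dFK aFK n.
rewrite (@reindex_esum _ _ _ _ _ geo _ bij) -(region_sum n red); last by move=> i; case: (tr2 i).
apply: eq_esum => i _; congr EFin; rewrite lenE.
by apply: gap_length => //; case: (tr2 i).
Qed.
End Sum.

(** * The trace of the commutator *)

Section Hyperbolic.
Variable R : realType.
Implicit Types F g h : 'M[R]_2.

Lemma hyperbolic_frame g s (l : R) : \det g = 1 -> hyperbolic_along g s l ->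
  exists F m, [/\ \det F = 1, s = hline F, m ^+ 2 = expR l,
    g *m tgt F = m *: tgt F & g *m src F = m^-1 *: src F].
Proof.
move=> dg [l0 /geodesic_frame[F dF sF] gl].
have sE : s = hline F by apply/funext.
have ne : (0 : R) != 1 by rewrite eq_sym oner_eq0.
rewrite sE in gl.
have [m m2 [hp hn]] := hyperbolic_ends dg dF ne (gl 0) (gl 1).
by exists F, m.
Qed.

Lemma frame_diag F g (m : R) : \det F = 1 -> g *m tgt F = m *: tgt F ->
  g *m src F = m^-1 *: src F -> g = F * mx2 m 0 0 m^-1 * F^-1.
Proof.
move=> dF hp hn; apply: (mulIr (det1_unit dF)); rewrite mulrVK ?det1_unit //.
apply: frame_ext.
  by rewrite (tgtM g F) hp; apply: cv2P; rewrite [LHS]mxE [tgt _ _ _]mxE [RHS]mxE mx2E !mx2_entries; ring.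
by rewrite (srcM g F) hn; apply: cv2P; rewrite [LHS]mxE [src _ _ _]mxE [RHS]mxE mx2E !mx2_entries; ring.
Qed.

Lemma diag_tr (m l : R) : m ^+ 2 = expR l -> (m + m^-1) ^+ 2 = 2 + 2 * cosh l.
Proof.
move=> m2; have m0 : m != 0 by rewrite -sqrf_eq0 m2 expR_eq0.
by rewrite coshE -m2; field.
Qed.

Lemma hyperbolic_tr g s (l : R) : \det g = 1 -> hyperbolic_along g s l ->
  \tr g ^+ 2 = 2 + 2 * cosh l.
Proof.
move=> dg /(hyperbolic_frame dg) [F [m [dF _ m2 hp hn]]].
by rewrite (frame_diag dF hp hn) tr_conj // tr2 !mx2_entries (diag_tr m2).
Qed.

(** The matrix K that takes one frame to the other fixes the common point of
the two axes, hence is a rotation with entries c = K 0 0 and s = K 1 0.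
Conjugating one of the elements to diagonal form shows that the trace is 2 -
(c s (m - 1 / m) (m' - 1 / m')) ^ 2. *)
Lemma meeting_axes g s l h s' (l' : R) : \det g = 1 -> \det h = 1 ->
  hyperbolic_along g s l -> hyperbolic_along h s' l' -> s 0 = s' 0 ->
  \tr (comm g h) <= 2.
Proof.
move=> dg dh /(hyperbolic_frame dg) [F [m [dF sE m2 gp gn]]].
move=> /(hyperbolic_frame dh) [F' [m' [dF' s'E m'2 hp hn]]] e0.
have m0 : m != 0 by rewrite -sqrf_eq0 m2 expR_eq0.
have m'0 : m' != 0 by rewrite -sqrf_eq0 m'2 expR_eq0.
(* the rotation between the two frames at the common point *)
pose K := F^-1 * F'; have dFi := det_inv2 dF; have dF'i := det_inv2 dF'.
have dK : \det K = 1 by exact: det_mul2.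
have i0 : 0 < complex.Im (0 +i* (1 : R)) by exact: ltr01.
have Ki : mobius K (0 +i* 1) = 0 +i* 1.
  rewrite /K mobiusM //; move: e0; rewrite sE s'E /hline expR0 => <-.
  by rewrite mobiusK.
have dK' := dK; rewrite det2 in dK'.
have den := mobius_den_gt0 dK i0.
move: Ki; rewrite mobiusE // => -[]; rewrite /mobius_den /= in den *.
rewrite !mulr0 !add0r expr1n !mulr1 in den *.
set d := (X in 0 < X) in den *; move=> /eqP; rewrite mulf_eq0 invr_eq0 (gt_eqF den) orbF => /eqP e1.
move=> /(congr1 (fun x => x * d)); rewrite mul1r mulVf ?gt_eqF // => e2.
rewrite /d mul1r in e2.
have [kr ks] : K 0 1 = - K 1 0 /\ K 1 1 = K 0 0.
  move: dK' e1 e2; move: (K 0 0) (K 0 1) (K 1 0) (K 1 1) => a b c d' f1 f2 f3.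
  split.
    transitivity (b * (c ^+ 2 + d' ^+ 2)); first by rewrite [c ^+ 2 + _]addrC -f3 mulr1.
    transitivity (c * (b * c) + d' * (b * d')); first by ring.
    rewrite (_ : b * c = a * d' - 1); last by lra.
    by rewrite (_ : b * d' = - (a * c)); [ring | lra].
  transitivity (d' * (a * d' - b * c)); first by rewrite f1 mulr1.
  transitivity (a * (d' ^+ 2) - c * (b * d')); first by ring.
  rewrite (_ : b * d' = - (a * c)); last by lra.
  by rewrite -[RHS]mulr1 f3; ring.
have pq : K 0 0 ^+ 2 + K 1 0 ^+ 2 = 1 by rewrite e2 ks; ring.
have gE := frame_diag dF gp gn; have hE := frame_diag dF' hp hn.
have tg : \tr g = m + m^-1 by rewrite gE tr_conj // tr2 !mx2_entries.
have th : \tr h = m' + m'^-1 by rewrite hE tr_conj // tr2 !mx2_entries.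
have tgh : \tr (g * h) = m * (K 0 0 ^+ 2 * m' + K 1 0 ^+ 2 / m') +
   (K 1 0 ^+ 2 * m' + K 0 0 ^+ 2 / m') / m.
  transitivity (\tr (F * (mx2 m 0 0 m^-1 * K * mx2 m' 0 0 m'^-1 * K^-1) * F^-1)).
    congr (\tr _); rewrite gE hE /K invrM ?det1_unit // invrK !mulrA.
    by rewrite mulrK // det1_unit.
  rewrite tr_conj //; move: (K) dK kr ks => k dk k1 k2.
  by rewrite (inv2 dk) tr2 !mx2E !mx2_entries k1 k2; field; rewrite m0 m'0.
have -> : \tr (comm g h) = 2 - (K 0 0 * K 1 0 * (m - m^-1) * (m' - m'^-1)) ^+ 2.
  apply: (addIr 2); rewrite tr_commE // tg th tgh; move: pq.
  move: (K 0 0) (K 1 0) => a b pq.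
  have -> : a ^+ 2 = 1 - b ^+ 2 by rewrite -pq addrK.
  have -> : (a * b * (m - m^-1) * (m' - m'^-1)) ^+ 2 =
    (1 - b ^+ 2) * b ^+ 2 * (m - m^-1) ^+ 2 * (m' - m'^-1) ^+ 2 by rewrite -pq; ring.
  by field; rewrite m0 m'0.
by rewrite gerBl sqr_ge0.
Qed.
End Hyperbolic.

(** * The one-holed torus *)

Section Signs.
Variable R : realType.
Implicit Types (X Y g : 'M[R]_2) (a b e : R).

Lemma sign_cases e : e ^+ 2 = 1 -> e = 1 \/ e = -1.
Proof. by move/eqP; rewrite sqrf_eq1 => /orP[] /eqP ->; [left | right]. Qed.

Lemma mobius_sign e g z : e ^+ 2 = 1 -> mobius (e *: g) z = mobius g z.
Proof. by move/sign_cases => [] ->; rewrite ?scale1r // scaleN1r mobiusN. Qed.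

Lemma sign_inv e g : e ^+ 2 = 1 -> \det g = 1 -> (e *: g)^-1 = e *: g^-1.
Proof. by move/sign_cases => [] -> dg; rewrite ?scale1r // !scaleN1r invrN. Qed.

Lemma sign_det e g : e ^+ 2 = 1 -> \det (e *: g) = \det g.
Proof. by move=> e2; rewrite detZ e2 mul1r. Qed.

Lemma sign_comm a b X Y : a ^+ 2 = 1 -> b ^+ 2 = 1 -> \det X = 1 -> \det Y = 1 ->
  comm (a *: X) (b *: Y) = comm X Y.
Proof.
move=> a2 b2 dX dY; rewrite /comm !sign_inv //.
by rewrite -!(scalerAl, scalerAr) !scalerA (_ : _ * _ = 1) ?scale1r // -[RHS](mulr1 1) -{1}a2 -b2; ring.
Qed.

Lemma sign_word a b X Y w : a ^+ 2 = 1 -> b ^+ 2 = 1 -> \det X = 1 -> \det Y = 1 ->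
  exists2 e, e ^+ 2 = 1 & eval_word (a *: X) (b *: Y) w = e *: eval_word X Y w.
Proof.
move=> a2 b2 dX dY; elim: w => [|x w [e e2 IH]].
  by exists 1; rewrite ?expr1n // !eval_nil scale1r.
have [c c2 cE] : exists2 c, c ^+ 2 = 1 & eval_letter (a *: X) (b *: Y) x = c *: eval_letter X Y x.
  rewrite /eval_letter; case: x => [[] []] /=;
    [exists a | exists a | exists b | exists b]; rewrite ?sign_inv //.
exists (c * e); first by rewrite exprMn c2 e2 mulr1.
by rewrite !eval_cons IH cE -scalerAl -scalerAr scalerA.
Qed.

Lemma sign_proj a b X Y : a ^+ 2 = 1 -> b ^+ 2 = 1 -> \det X = 1 -> \det Y = 1 ->
  @Defs.proj R (generated2 (a *: X) (b *: Y)) = @Defs.proj R (generated2 X Y).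
Proof.
move=> a2 b2 dX dY; apply/funext => z; apply/seteqP; split=> x [g [w _ <-] <-].
  have [e e2 ->] := sign_word w a2 b2 dX dY.
  by exists (eval_word X Y w); [exists w | rewrite mobius_sign].
have [e e2 eE] := sign_word w a2 b2 dX dY.
by exists (eval_word (a *: X) (b *: Y) w); [exists w | rewrite eE mobius_sign].
Qed.

(** Changing the sign of a generator affects neither the Mobius maps nor the
commutator, so that both generators can be given positive traces. *)
Lemma positive_sign g : 4 < \tr g ^+ 2 -> exists2 e, e ^+ 2 = 1 & 2 < \tr (e *: g).
Proof.
move=> t4; have [t0|t0] := lerP 0 (\tr g); [exists 1 | exists (-1)];
  rewrite ?sqrrN ?expr1n // mxtraceZ; nra.
Qed.

End Signs.

Theorem theorem2 (R : realType) (M : one_holed_torus R) :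
  (\esum_(c in [set c : set (set R[i]) |
                  simple_closed_geodesic (deck_group M) c /\
                  c <> boundary_geodesic M])
     (atan (cosh (boundary_length M / 4) /
            sinh (geodesic_length (deck_group M) c / 2)))%:E)%E
  = (3 * pi / 2)%:E.
Proof.
have d1 := det_rho1 M; have d2 := det_rho2 M.
have h1 := axis1P M; have h2 := axis2P M; have hK := boundary_axisP M.
have [l10 _ _] := h1; have [l20 _ _] := h2; have [lK0 _ _] := hK.
have dK : \det (comm (rho1 M) (rho2 M)) = 1 by rewrite !det_mul2 ?det_inv2.
rewrite -comm_inv // in hK; have dKi := det_inv2 dK.
have big g s (l : R) : \det g = 1 -> hyperbolic_along g s l -> 4 < \tr g ^+ 2.
  move=> dg hg; have [l0 _ _] := hg; rewrite (hyperbolic_tr dg hg).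
  by have := cosh_gt1 l0; lra.
have [a a2 trA] := positive_sign (big _ _ _ d1 h1).
have [b b2 trB] := positive_sign (big _ _ _ d2 h2).
set A := a *: rho1 M in trA; set B := b *: rho2 M in trB.
have dA : \det A = 1 by rewrite sign_det.
have dB : \det B = 1 by rewrite sign_det.
have cE : comm A B = comm (rho1 M) (rho2 M) by exact: sign_comm.
have tK2 := hyperbolic_tr dKi hK; rewrite tr_inv // in tK2.
have tK : \tr (comm (rho1 M) (rho2 M)) <= 2 := meeting_axes d1 d2 h1 h2 (base_point M).
have trK : \tr (comm A B) < -2.
  rewrite cE; have := big _ _ _ dKi hK; rewrite tr_inv //; move: tK; move: (\tr _) => k; nra.
have discrete z : upper_half_plane z -> exists2 r : R, 0 < r & forall w : word,
    reduced w -> w != [::] -> r <= hdist z (mobius (eval_word A B w) z).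
  move=> z0; have [r r0 hr] := @covering_action _ M _ z0; exists r => // w rw w0.
  by have [e e2 ->] := sign_word w a2 b2 d1 d2; rewrite mobius_sign //; exact: hr.
have [FK [m [dFK sK m2 kp kn]]] := hyperbolic_frame dKi hK.
have aFK : axial FK (comm A B).
  by rewrite cE -[comm _ _]invrK; apply: axial_inv dKi (axialP lK0 m2 kp kn).
have LD : cosh (boundary_length M / 4) = hole_const A B / 2.
  (* the square of the trace gives cosh (4 L), and its sign cosh (2 L) *)
  set L := boundary_length M / 4.
  have c0 : 1 < cosh L by apply: cosh_gt1; rewrite divr_gt0.
  have C0 : 1 < cosh (L + L) by apply: cosh_gt1; rewrite addr_gt0 // divr_gt0.
  have e1 : cosh (L + L) = 2 * cosh L ^+ 2 - 1.
    by rewrite coshD -!expr2; have := cosh2_sinh2 L; lra.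
  have e2 : cosh (boundary_length M) = 2 * cosh (L + L) ^+ 2 - 1.
    have -> : boundary_length M = (L + L) + (L + L) by rewrite /L; field.
    by rewrite coshD -!expr2; have := cosh2_sinh2 (L + L); lra.
  have kE : \tr (comm A B) = - (2 * cosh (L + L)).
    move: tK2 trK; rewrite -cE e2; move: (\tr _) (cosh (L + L)) C0 => k c c1 k2 kn2.
    have : (k - 2 * c) * (k + 2 * c) = 0 by ring: k2.
    by move=> /eqP; rewrite mulf_eq0 => /orP[] /eqP; lra.
  have D2 := hole_const_sqr trK; have D0 : 0 < hole_const A B by apply: lt_trans (hole_const_gt2 trK).
  rewrite kE e1 in D2.
  have : (hole_const A B - 2 * cosh L) * (hole_const A B + 2 * cosh L) = 0 by ring: D2.
  by move=> /eqP; rewrite mulf_eq0 => /orP[] /eqP; lra.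
have pE : @Defs.proj R (deck_group M) = @Defs.proj R (generated2 A B) by rewrite -(sign_proj a2 b2 d1 d2).
rewrite -(geodesic_sum dA dB trK trA trB discrete dFK aFK LD).
rewrite /simple_closed_geodesic /geodesic_length /boundary_geodesic /shadow sK.
rewrite /simple_closed_geodesic_of_length /shadow pE.
by [].
Qed.
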